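(* Let $M$ be an $n$-dimensional manifold and let $L(x,y)$ be a regular Lagrangian on $TM$ (respectively, let $F(x,y)$ be a fundamental Finsler function and put $L=F^2$). Then the canonical structures ${}^L\mathbf N$, ${}^L\mathbf g$, ${}^L\widehat{\mathbf D}$ (respectively ${}^F\mathbf N$, ${}^F\mathbf g$, ${}^F\widehat{\mathbf D}$) determined by $L$ (respectively by $F$) define on $\widetilde{TM}=TM\setminus\{0\}$ the structure of an N-anholonomic Riemann–Cartan manifold. That is, ${}^L\mathbf N$ is an N-connection, ${}^L\mathbf g$ is a d-metric and ${}^L\widehat{\mathbf D}$ is a d-connection adapted to ${}^L\mathbf N$ with ${}^L\widehat{\mathbf D}\,{}^L\mathbf g=0$ (and likewise for $F$). In this sense any Lagrange mechanics with regular Lagrangian, and any Finsler geometry, can be modelled as a nonholonomic Riemann–Cartan geometry.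
   Context: **N-connections.** For a manifold $\mathbf V$ with vertical subbundle $v\mathbf V\subset T\mathbf V$ (here $\mathbf V=\widetilde{TM}$, $v\mathbf V=\ker d\pi$, $\pi:TM\to M$), an N-connection is a splitting $T\mathbf V=h\mathbf V\oplus v\mathbf V$. A d-metric is a nondegenerate metric of the form $g\oplus{}^\bullet g$ with $g$ on $h\mathbf V$ and ${}^\bullet g$ on $v\mathbf V$ (h- and v-subspaces orthogonal). A d-connection is a linear connection whose parallel transport preserves the splitting. An N-anholonomic Riemann–Cartan manifold is a manifold with an N-connection, a d-metric $\mathbf g$ and a d-connection $\mathbf D$ with $\mathbf D\mathbf g=0$. **Lagrangians.** $L:TM\to\mathbb R$ is $C^\infty$ on $\widetilde{TM}$ and continuous on the null section. It is regular if ${}^Lg_{ij}=\frac12\frac{\partial^2L}{\partial y^i\partial y^j}$ has rank $n$ on $\widetilde{TM}$ (and constant signature there). A fundamental Finsler function $F$ satisfies $F(x,\lambda y)=\lambda F(x,y)$ for nonzero $\lambda\in\mathbb R$, and $L=F^2$ is regarded as a regular Lagrangian. **Canonical structures.** In coordinates $(x^i,y^i)$ on $TM$, with ${}^Lg^{ij}$ inverse to ${}^Lg_{ij}$, let $$2G^i=\tfrac12\,{}^Lg^{ij}\Big(\frac{\partial^2L}{\partial y^j\partial x^k}y^k-\frac{\partial L}{\partial x^j}\Big),\qquad {}^LN^i_j=\frac{\partial G^i}{\partial y^j}.$$ The adapted frame is $e_i=\partial_{x^i}-{}^LN_i^k\partial_{y^k}$, ${}^\bullet e_i=\partial_{y^i}$,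 with dual coframe $e^i=dx^i$, ${}^\bullet e^i=dy^i+{}^LN^i_kdx^k$; $h\widetilde{TM}$ is spanned by the $e_i$. The d-metric is $${}^L\mathbf g={}^Lg_{ij}\,e^i\otimes e^j+{}^Lg_{ij}\,{}^\bullet e^i\otimes{}^\bullet e^j.$$ The canonical d-connection ${}^L\widehat{\mathbf D}$ is given by ${}^L\widehat{\mathbf D}_{e_k}e_j=\widehat L^i_{jk}e_i$, ${}^L\widehat{\mathbf D}_{e_k}{}^\bullet e_j=\widehat L^i_{jk}{}^\bullet e_i$, ${}^L\widehat{\mathbf D}_{{}^\bullet e_k}e_j=\widehat C^i_{jk}e_i$, ${}^L\widehat{\mathbf D}_{{}^\bullet e_k}{}^\bullet e_j=\widehat C^i_{jk}{}^\bullet e_i$, where, writing $g_{ij}={}^Lg_{ij}$, $$\widehat L^i_{jk}=\tfrac12g^{ir}(e_kg_{jr}+e_jg_{kr}-e_rg_{jk}),\qquad \widehat C^i_{jk}=\tfrac12g^{ir}({}^\bullet e_kg_{jr}+{}^\bullet e_jg_{kr}-{}^\bullet e_rg_{jk}).$$ The structures ${}^F\mathbf N,{}^F\mathbf g,{}^F\widehat{\mathbf D}$ are those for $L=F^2$. *)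

(* Defs.v *)
(* MathComp-Analysis, over an arbitrary [R : realType]. *)
From HB Require Import structures.
From mathcomp Require Import all_boot all_order all_algebra.
From mathcomp Require Import all_classical all_reals all_analysis.

Set Implicit Arguments.
Unset Strict Implicit.
Unset Printing Implicit Defensive.

Import Order.TTheory GRing.Theory Num.Theory.
Import numFieldNormedType.Exports.

Local Open Scope classical_set_scope.
Local Open Scope ring_scope.

(** * C^infinity maps on open subsets of normed spaces *)

Fixpoint Ck (R : realType) (V W : normedModType R) (k : nat)
    (U : set V) (f : V -> W) : Prop :=
  match k with
  | 0 => forall x, U x -> {for x, continuous f}
  | k'.+1 => (forall x, U x -> differentiable f x) /\
             (forall v, Ck k' U ('D_v f))
  end.

Definition smooth_on (R : realType) (V W : normedModType R)
    (U : set V) (f : V -> W) : Prop := forall k, Ck k U f.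

(** * Manifolds *)

(* Data of an [m]-dimensional atlas.  The underlying set of the manifold is the
   subset [pts] of the type [pt], so that an open submanifold keeps the same
   type.  [chart i] and [inv i] are only meaningful on [dom i] and on its image;
   [chart_at p] is a preferred chart around [p].

   The tangent space at [p] is ['rV[R]_m]: a tangent vector is represented by its
   components in the chart [chart_at p]; see [tcoord] and [tvec] below. *)
Record atlas (R : realType) (m : nat) := Atlas {
  pt : Type;
  pts : set pt;
  idx : Type;
  dom : idx -> set pt;
  chart : idx -> pt -> 'rV[R]_m;
  inv : idx -> 'rV[R]_m -> pt;
  chart_at : pt -> idx }.

Arguments pts {R m} A : rename.
Arguments idx {R m} A : rename.
Arguments dom {R m} A i : rename.
Arguments chart {R m} A i : rename.
Arguments inv {R m} A i : rename.
Arguments chart_at {R m} A p : rename.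

Definition vfield (R : realType) (m : nat) (A : atlas R m) : Type :=
  pt A -> 'rV[R]_m.

(* Open sets of the topology defined by the atlas. *)
Definition mopen (R : realType) (m : nat) (A : atlas R m) (O : set (pt A)) :
    Prop :=
  O `<=` pts A /\
  forall i : idx A, open (chart A i @` (O `&` dom A i)).

Section Manifolds.
Context {R : realType} {m : nat} (A : atlas R m).
Implicit Types (O : set (pt A)) (p q : pt A) (i j : idx A) (X Y Z : vfield A).

(* Second countability is expressed by a countable cover by chart domains. *)
Record smooth_manifold : Prop := SmoothManifold {
  dom_pts : forall i, dom A i `<=` pts A;
  chart_atP : forall p, pts A p -> dom A (chart_at A p) p;
  chartK : forall i p, dom A i p -> inv A i (chart A i p) = p;
  overlap_open : forall i j, open (chart A i @` (dom A i `&` dom A j));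
  transition_smooth : forall i j,
    smooth_on (chart A i @` (dom A i `&` dom A j)) (chart A j \o inv A i);
  manifold_hausdorff : forall p q, pts A p -> pts A q -> p <> q ->
    exists O O', [/\ mopen O, mopen O', O p, O' q & O `&` O' = set0];
  manifold_countable : exists J : set (idx A),
    countable J /\ pts A `<=` \bigcup_(i in J) dom A i }.

(* Components in the chart [i] of the tangent vector [v] at [p]. *)
Definition tcoord p i (v : 'rV[R]_m) : 'rV[R]_m :=
  'd (chart A i \o inv A (chart_at A p)) (chart A (chart_at A p) p) v.

(* The tangent vector at [p] with components [w] in the chart [i]. *)
Definition tvec p i (w : 'rV[R]_m) : 'rV[R]_m :=
  'd (chart A (chart_at A p) \o inv A i) (chart A i p) w.

Definition coord_field i (b : 'I_m) : vfield A :=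
  fun p => tvec p i (delta_mx 0 b).

(* The derivative [v(f)]. *)
Definition dirder p (v : 'rV[R]_m) (f : pt A -> R) : R :=
  'd (f \o inv A (chart_at A p)) (chart A (chart_at A p) p) v.

Definition smooth_fun O (f : pt A -> R) : Prop :=
  forall i, smooth_on (chart A i @` (O `&` dom A i)) (f \o inv A i).

Definition smooth_vf O X : Prop :=
  forall i, smooth_on (chart A i @` (O `&` dom A i))
    (fun x => tcoord (inv A i x) i (X (inv A i x))).

Definition smooth_fun_near p (f : pt A -> R) : Prop :=
  exists O, [/\ mopen O, O p & smooth_fun O f].

Definition smooth_vf_near p X : Prop :=
  exists O, [/\ mopen O, O p & smooth_vf O X].

(* Smooth vector subbundles of the tangent bundle; the rows of [e q] are the
   values at [q] of a local frame. *)
Definition subbundle (H : pt A -> set 'rV[R]_m) : Prop :=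
  forall p, pts A p ->
  exists (r : nat) (O : set (pt A)) (e : pt A -> 'M[R]_(r, m)),
    [/\ mopen O, O p, forall k, smooth_vf O (fun q => row k (e q)) &
        forall q, O q -> row_free (e q) /\
          forall x : 'rV[R]_m, H q x <-> (x <= e q)%MS].

(** ** Metrics *)

Record metric (g : pt A -> 'rV[R]_m -> 'rV[R]_m -> R) : Prop := Metric {
  metric_sym : forall p x y, pts A p -> g p x y = g p y x;
  metric_linear : forall p a x y z, pts A p ->
    g p (a *: x + y) z = a * g p x z + g p y z;
  metric_nondegenerate : forall p x, pts A p -> (forall y, g p x y = 0) -> x = 0;
  metric_smooth : forall O X Y, mopen O -> smooth_vf O X -> smooth_vf O Y ->
    smooth_fun O (fun p => g p (X p) (Y p)) }.

(** ** Linear connections *)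

(* [D p v Y] is the covariant derivative at [p] of the local vector field [Y] in
   the direction [v]; it is only constrained for [Y] smooth near [p]. *)
Record linear_connection (D : pt A -> 'rV[R]_m -> vfield A -> 'rV[R]_m) :
    Prop := LinearConnection {
  conn_local : forall p v O Y Y', mopen O -> O p -> smooth_vf O Y ->
    (forall q, O q -> Y q = Y' q) -> D p v Y = D p v Y';
  conn_linear : forall p a v w Y, pts A p -> smooth_vf_near p Y ->
    D p (a *: v + w) Y = a *: D p v Y + D p w Y;
  conn_add : forall p v Y Y', pts A p ->
    smooth_vf_near p Y -> smooth_vf_near p Y' ->
    D p v (fun q => Y q + Y' q) = D p v Y + D p v Y';
  conn_leibniz : forall p v f Y, pts A p ->
    smooth_fun_near p f -> smooth_vf_near p Y ->
    D p v (fun q => f q *: Y q) = dirder p v f *: Y p + f p *: D p v Y;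
  conn_smooth : forall O X Y, mopen O -> smooth_vf O X -> smooth_vf O Y ->
    smooth_vf O (fun p => D p (X p) Y) }.

(* [D g = 0] *)
Definition metric_compatible (D : pt A -> 'rV[R]_m -> vfield A -> 'rV[R]_m)
    (g : pt A -> 'rV[R]_m -> 'rV[R]_m -> R) : Prop :=
  forall O X Y Z p, mopen O -> O p ->
    smooth_vf O X -> smooth_vf O Y -> smooth_vf O Z ->
    dirder p (X p) (fun q => g q (Y q) (Z q))
      - g p (D p (X p) Y) (Z p) - g p (Y p) (D p (X p) Z) = 0.

(** ** Parallel transport *)

Definition smooth_curve (J : set R) (c : R -> pt A) : Prop :=
  (forall t, J t -> pts A (c t)) /\
  forall i, open (J `&` c @^-1` dom A i) /\
    smooth_on (J `&` c @^-1` dom A i) (chart A i \o c).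

Definition velocity (c : R -> pt A) (t : R) : 'rV[R]_m :=
  'D_1 (chart A (chart_at A (c t)) \o c) t.

(* The field [X t], tangent at [c t], is parallel: in each chart, with
   [X = X^b \partial_b],
   [D_{c'} X = (X^b)' \partial_b + X^b D_{c'} \partial_b] vanishes. *)
Definition parallel (D : pt A -> 'rV[R]_m -> vfield A -> 'rV[R]_m)
    (J : set R) (c : R -> pt A) (X : R -> 'rV[R]_m) : Prop :=
  forall i t, J t -> dom A i (c t) ->
    let Xi : R -> 'rV[R]_m := fun s => tcoord (c s) i (X s) in
    derivable Xi t 1 /\
    'D_1 Xi t + \sum_(b < m) Xi t 0 b *:
      tcoord (c t) i (D (c t) (velocity c t) (coord_field i b)) = 0.

Definition transport_preserves (D : pt A -> 'rV[R]_m -> vfield A -> 'rV[R]_m)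
    (H : pt A -> set 'rV[R]_m) : Prop :=
  forall (a b : R) (c : R -> pt A) (X : R -> 'rV[R]_m),
    let J := [set t : R | a < t < b] in
    smooth_curve J c -> parallel D J c X ->
    forall s t, J s -> J t -> H (c s) (X s) -> H (c t) (X t).

(** ** N-anholonomic Riemann-Cartan manifolds *)

Section Nanholonomic.
Variables (vert hor : pt A -> set 'rV[R]_m).

Record N_connection : Prop := NConnection {
  vert_subbundle : subbundle vert;
  hor_subbundle : subbundle hor;
  hor_vert_split : forall p (x : 'rV[R]_m), pts A p ->
    exists! hv : 'rV[R]_m * 'rV[R]_m,
      [/\ hor p hv.1, vert p hv.2 & x = hv.1 + hv.2] }.

Record d_metric (g : pt A -> 'rV[R]_m -> 'rV[R]_m -> R) : Prop := DMetric {
  d_metric_metric : metric g;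
  d_metric_orthogonal : forall p x y, pts A p ->
    hor p x -> vert p y -> g p x y = 0 }.

Record d_connection (D : pt A -> 'rV[R]_m -> vfield A -> 'rV[R]_m) : Prop :=
  DConnection {
  d_connection_linear : linear_connection D;
  d_connection_hor : transport_preserves D hor;
  d_connection_vert : transport_preserves D vert }.

Record N_anholonomic_Riemann_Cartan
    (g : pt A -> 'rV[R]_m -> 'rV[R]_m -> R)
    (D : pt A -> 'rV[R]_m -> vfield A -> 'rV[R]_m) : Prop :=
  NAnholonomicRiemannCartan {
  rc_manifold : smooth_manifold;
  rc_N_connection : N_connection;
  rc_d_metric : d_metric g;
  rc_d_connection : d_connection D;
  rc_compatible : metric_compatible D g }.
End Nanholonomic.

End Manifolds.

(* The differential at [p] of a map between manifolds. *)
Definition dmap (R : realType) (m k : nat) (A : atlas R m) (B : atlas R k)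
    (f : pt A -> pt B) (p : pt A) (v : 'rV[R]_m) : 'rV[R]_k :=
  'd (chart B (chart_at B (f p)) \o f \o inv A (chart_at A p))
    (chart A (chart_at A p) p) v.

(** * The tangent bundle and its slit version *)

(* The charts are the induced coordinates [(x, y)]. *)
Definition TM (R : realType) (n : nat) (M : atlas R n) : atlas R (n + n) :=
  {| pt := (pt M * 'rV[R]_n)%type;
     pts := [set u | pts M u.1];
     idx := idx M;
     dom := fun i => [set u | dom M i u.1];
     chart := fun i u => row_mx (chart M i u.1) (tcoord u.1 i u.2);
     inv := fun i z => let p := inv M i (lsubmx z) in (p, tvec p i (rsubmx z));
     chart_at := fun u => chart_at M u.1 |}.

Definition open_submanifold (R : realType) (m : nat) (A : atlas R m)
    (O : set (pt A)) : atlas R m :=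
  {| pt := pt A;
     pts := pts A `&` O;
     idx := idx A;
     dom := fun i => dom A i `&` O;
     chart := chart A;
     inv := inv A;
     chart_at := chart_at A |}.

Definition slitTM (R : realType) (n : nat) (M : atlas R n) : atlas R (n + n) :=
  open_submanifold (A := TM M) [set u | u.2 != 0].

Definition vertical (R : realType) (n : nat) (M : atlas R n)
    (u : pt (slitTM M)) : set 'rV[R]_(n + n) :=
  [set X | dmap (A := slitTM M) (B := M) fst u X = 0].

(** * Coordinate expressions *)

(* Here [l] is the expression of the Lagrangian in coordinates
   [z = row_mx x y]. *)
Section Coordinates.
Context {R : realType} {n : nat}.
Implicit Types (f l : 'rV[R]_(n + n) -> R) (z : 'rV[R]_(n + n)) (i j k : 'I_n).

Definition dx k f : 'rV[R]_(n + n) -> R := 'D_(row_mx (delta_mx 0 k) 0) f.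
Definition dy k f : 'rV[R]_(n + n) -> R := 'D_(row_mx 0 (delta_mx 0 k)) f.

Definition Lg l z : 'M[R]_n := \matrix_(i, j) (2^-1 * dy i (dy j l) z).

(* [G^i], with the factor of [2 G^i = ...] divided out *)
Definition spray l i z : R :=
  2^-1 * (2^-1 * \sum_j invmx (Lg l z) i j *
    (\sum_k dy j (dx k l) z * z 0 (rshift n k) - dx j l z)).

(* [N^i_j] *)
Definition Ncoef l i j z : R := dy j (spray l i) z.

(* [e_k f] *)
Definition adx l k f z : R := dx k f z - \sum_r Ncoef l r k z * dy r f z.

(* [\hat L^i_{jk}] and [\hat C^i_{jk}] *)
Definition Lhat l i j k z : R :=
  2^-1 * \sum_r invmx (Lg l z) i r *
    (adx l k (fun w => Lg l w j r) z + adx l j (fun w => Lg l w k r) z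
     - adx l r (fun w => Lg l w j k) z).

Definition Chat l i j k z : R :=
  2^-1 * \sum_r invmx (Lg l z) i r *
    (dy k (fun w => Lg l w j r) z + dy j (fun w => Lg l w k r) z
     - dy r (fun w => Lg l w j k) z).

(* Components of [e_k] and [\bullet e_k]. *)
Definition hframe l k z : 'rV[R]_(n + n) :=
  row_mx (delta_mx 0 k) (\row_r - Ncoef l r k z).
Definition vframe k : 'rV[R]_(n + n) := row_mx 0 (delta_mx 0 k).

(* [e^i] and [\bullet e^i], evaluated at the vector with components [w]. *)
Definition hcoframe i (w : 'rV[R]_(n + n)) : R := w 0 (lshift n i).
Definition vcoframe l i z (w : 'rV[R]_(n + n)) : R :=
  w 0 (rshift n i) + \sum_k Ncoef l i k z * w 0 (lshift n k).

(* Sylvester normal form with [a] plus signs and [b] minus signs. *)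
Definition has_signature (g : 'M[R]_n) (a b : nat) : Prop :=
  (a + b <= n)%N /\
  exists2 P : 'M[R]_n, P \in unitmx &
    P *m g *m P^T =
    diag_mx (\row_k if (k < a)%N then 1 else if (k < a + b)%N then -1 else 0).

End Coordinates.

(** * Lagrangians and their canonical structures *)

Section Lagrange.
Context {R : realType} {n : nat} (M : atlas R n).
Implicit Types (L F : pt (TM M) -> R) (i : idx M) (u : pt (slitTM M)).

Definition loc L i : 'rV[R]_(n + n) -> R := L \o inv (TM M) i.

Definition zc i u : 'rV[R]_(n + n) := chart (TM M) i u.

Record regular_lagrangian L : Prop := RegularLagrangian {
  lagrangian_smooth : smooth_fun (A := slitTM M) (pts (slitTM M)) L;
  lagrangian_null_continuous : forall i (p : pt M), dom M i p ->
    {for zc i (p, 0), continuous (loc L i)};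
  lagrangian_rank : forall i u, dom (slitTM M) i u ->
    \rank (Lg (loc L i) (zc i u)) = n;
  lagrangian_signature : exists a b, forall i u, dom (slitTM M) i u ->
    has_signature (Lg (loc L i) (zc i u)) a b }.

Record fundamental_finsler F : Prop := FundamentalFinsler {
  finsler_homogeneous : forall (p : pt M) (y : 'rV[R]_n) (a : R),
    pts M p -> a != 0 -> F (p, a *: y) = a * F (p, y);
  finsler_regular : regular_lagrangian (fun u => F u ^+ 2) }.

(* The adapted frame of the chart [i], as vector fields. *)
Definition eh L i (k : 'I_n) : vfield (slitTM M) :=
  fun u => tvec (A := slitTM M) u i (hframe (loc L i) k (zc i u)).
Definition ev i (k : 'I_n) : vfield (slitTM M) :=
  fun u => tvec (A := slitTM M) u i (vframe k).

Record canonical L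
    (hor : pt (slitTM M) -> set 'rV[R]_(n + n))
    (g : pt (slitTM M) -> 'rV[R]_(n + n) -> 'rV[R]_(n + n) -> R)
    (D : pt (slitTM M) -> 'rV[R]_(n + n) -> vfield (slitTM M) ->
         'rV[R]_(n + n)) : Prop := IsCanonical {
  canonical_hor : forall i u, dom (slitTM M) i u ->
    hor u = [set X | exists a : 'I_n -> R, X = \sum_k a k *: eh L i k u];
  canonical_metric : forall i u, dom (slitTM M) i u -> forall X Y,
    let l := loc L i in
    let z := zc i u in
    let x := tcoord (A := slitTM M) u i X in
    let y := tcoord (A := slitTM M) u i Y in
    g u X Y =
      \sum_a \sum_b Lg l z a b * (hcoframe a x * hcoframe b y) +
      \sum_a \sum_b Lg l z a b * (vcoframe l a z x * vcoframe l b z y);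
  canonical_linear : linear_connection D;
  canonical_hh : forall i u, dom (slitTM M) i u -> forall j k,
    D u (eh L i k u) (eh L i j) =
      \sum_a Lhat (loc L i) a j k (zc i u) *: eh L i a u;
  canonical_hv : forall i u, dom (slitTM M) i u -> forall j k,
    D u (eh L i k u) (ev i j) =
      \sum_a Lhat (loc L i) a j k (zc i u) *: ev i a u;
  canonical_vh : forall i u, dom (slitTM M) i u -> forall j k,
    D u (ev i k u) (eh L i j) =
      \sum_a Chat (loc L i) a j k (zc i u) *: eh L i a u;
  canonical_vv : forall i u, dom (slitTM M) i u -> forall j k,
    D u (ev i k u) (ev i j) =
      \sum_a Chat (loc L i) a j k (zc i u) *: ev i a u }.

(* The coordinate formulas above determine globally defined structures on the
   slit tangent bundle, and these form an N-anholonomic Riemann-Cartan manifold.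
   [D] is determined on vector fields that are smooth near the base point. *)
Definition canonical_Riemann_Cartan L : Prop :=
  exists hor g D,
    [/\ canonical L hor g D,
        forall hor' g' D', canonical L hor' g' D' ->
          forall u, pts (slitTM M) u ->
          [/\ hor' u = hor u,
              forall X Y, g' u X Y = g u X Y &
              forall X (Y : vfield (slitTM M)), smooth_vf_near u Y ->
                D' u X Y = D u X Y] &
        N_anholonomic_Riemann_Cartan (vertical (M := M)) hor g D].

End Lagrange.

(* Main.v *)
Require Import Defs.
From HB Require Import structures.
From mathcomp Require Import all_boot all_order all_algebra.
From mathcomp Require Import all_classical all_reals all_analysis.
From mathcomp Require Import ring lra.

Set Implicit Arguments.
Unset Strict Implicit.
Unset Printing Implicit Defensive.

Import Order.TTheory GRing.Theory Num.Theory.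
Import numFieldNormedType.Exports.

Local Open Scope classical_set_scope.
Local Open Scope ring_scope.
Local Notation inv := Defs.inv.

(** In the coordinates [(x, y)] of a chart, everything is built from the matrix [g] of
    halved second derivatives of [L] along the fibres and from the matrix [N] of the
    nonlinear connection. A tangent vector splits into its base part [h] and its
    vertical part [v = y' + h N] ([vpart]). The canonical connection acts on both
    parts by one matrix-valued form [omega] ([conn_form]), built from the symbols
    [\hat L] and [\hat C]: the derivative of [h] is [dh + h omega], and likewise for
    [v]. Most of the theorem is thus local linear algebra, provided these objects do
    not depend on the chart.

    Chart independence. Let [phi] be a transition map of [M], [P] its Jacobian matrix
    and [Q] the second derivative of [phi] in the direction [y]; primes refer to the
    second chart. The
    Euler-Lagrange expressions show that the spray transforms as a vector, up to half
    of the second derivative of [phi] on [(y, y)] ([spray_change]); differentiating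
    along the fibre gives [N P = P N' + Q] ([Nmx_change]), hence the vertical part is
    simply multiplied by [P] ([vpart_change]) and the adapted frames correspond. The
    symbols are the only ones that are symmetric and compatible with [g]
    ([christoffel_unique]); the transported symbols have both properties, so they
    agree ([christoffel_change]). This yields [dP + P omega' = omega P]
    ([conn_form_change]), which says that the covariant derivatives computed in two
    charts correspond ([covD_change], [canon_connE]). Symmetry of second derivatives
    ([derive_commute]) is used throughout.

    The structures. The horizontal bundle is the kernel of the vertical part, and the
    adapted frames are smooth local frames of both bundles ([canon_N_connection]).
    The metric is [g] on base parts plus [g] on vertical parts; it is nondegenerate
    since [g] is invertible, and compatible with the connection since
    [omega g + (omega g)^T = dg] ([conn_form_metric], [canon_compatible]). Along a
    curve, a parallel field has base and vertical parts that solve a homogeneous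
    linear differential equation in each chart; a solution that vanishes once
    vanishes identically ([linear_ode_zero]), so parallel transport preserves the
    horizontal and the vertical bundle ([transport_zero]). Finally, the formulas of
    the adapted frame determine the three structures, because a linear connection
    is determined by its values on a frame ([conn_determined]).

    The Finsler case is the Lagrangian case for [L = F^2]. *)

(** * Smooth maps between normed spaces *)

Section NearEq.
Context {R : realType} {V W : normedModType R}.
Implicit Types (f g : V -> W) (x : V).

Lemma near_eq_diff_locally f g x : (\near x, f x = g x) -> differentiable f x ->
  g \o shift x = cst (g x) + 'd f x +o_ 0 id.
Proof.
move=> fg df; have /eqaddoP dfo := diff_locally df; apply/eqaddoP => e e0.
have fgs : \forall h \near 0, f (h + x) = g (h + x).
  by move: fg; rewrite (near_shift 0) /= subr0.
apply: filterS2 (dfo e e0) fgs => h.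
rewrite /= !fctE /= => + <-.
by rewrite (nbhs_singleton fg).
Qed.

Lemma near_eq_diff f g x : (\near x, f x = g x) -> differentiable f x ->
  'd g x = 'd f x :> (V -> W).
Proof.
move=> fg df; apply: diff_unique (near_eq_diff_locally fg df).
exact: diff_continuous.
Qed.

Lemma near_eq_differentiable f g x : (\near x, f x = g x) ->
  differentiable f x -> differentiable g x.
Proof.
move=> fg df; apply/diff_locallyP; rewrite (near_eq_diff fg df); split.
  exact: diff_continuous.
exact: near_eq_diff_locally.
Qed.

Lemma open_near (U : set V) (P : V -> Prop) x : open U -> U x ->
  (forall y, U y -> P y) -> \near x, P x.
Proof. by move=> oU Ux UP; apply: filterS UP _; exact: open_nbhs_nbhs. Qed.

Lemma open_preimage_on (U : set V) (B : set W) f : open U ->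
  (forall x, U x -> {for x, continuous f}) -> open B -> open (U `&` f @^-1` B).
Proof.
move=> oU cf oB; rewrite openE => x [Ux Bfx]; rewrite /interior.
have nU : nbhs x U by exact: open_nbhs_nbhs.
have nB : nbhs (f x) B by exact: open_nbhs_nbhs.
by apply: filterI nU _; exact: (cf x Ux B nB).
Qed.

End NearEq.

Section CkTheory.
Context {R : realType} {V : normedModType R}.
Implicit Types (U : set V) (k : nat).

Lemma smooth_differentiable (W : normedModType R) U (f : V -> W) x :
  smooth_on U f -> U x -> differentiable f x.
Proof. by move=> /(_ 1%N)[+ _] Ux; apply. Qed.

Lemma smooth_derivable (W : normedModType R) U (f : V -> W) x v :
  smooth_on U f -> U x -> derivable f x v.
Proof.
by move=> sf Ux; apply: diff_derivable; apply: smooth_differentiable sf Ux.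
Qed.

Lemma smooth_continuous (W : normedModType R) U (f : V -> W) x :
  smooth_on U f -> U x -> {for x, continuous f}.
Proof. by move=> /(_ 0%N); apply. Qed.

Lemma smooth_derive (W : normedModType R) U (f : V -> W) v :
  smooth_on U f -> smooth_on U ('D_v f).
Proof. by move=> sf k; have [_] := sf k.+1; apply. Qed.

Lemma CkS (W : normedModType R) k U (f : V -> W) : Ck k.+1 U f -> Ck k U f.
Proof.
elim: k f => [|k IH] f [df Df].
  by move=> x Ux; apply: differentiable_continuous; exact: df.
by split=> // v; apply: IH; exact: Df.
Qed.

Lemma sub_Ck (W : normedModType R) k U U' (f : V -> W) : U' `<=` U ->
  Ck k U f -> Ck k U' f.
Proof.
move=> UU'; elim: k f => [|k IH] f.
  by move=> cf x /UU'; exact: cf.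
by move=> [df Df]; split=> [x /UU'|v]; [exact: df|exact/IH/Df].
Qed.

Lemma eq_Ck (W : normedModType R) k U (f g : V -> W) : open U ->
  (forall x, U x -> f x = g x) -> Ck k U f -> Ck k U g.
Proof.
move=> oU; elim: k f g => [|k IH] f g fg.
  move=> cf x Ux; rewrite /prop_for /continuous_at -(fg _ Ux).
  apply: cvg_trans (cf x Ux); apply: near_eq_cvg.
  exact: (open_near oU Ux).
move=> [df Df]; split=> [x Ux|v].
  apply: near_eq_differentiable (df x Ux); exact: (open_near oU Ux).
apply: IH (Df v) => x Ux.
by apply: near_eq_derive; exact: (open_near oU Ux).
Qed.

Lemma Ck_cst (W : normedModType R) k U (a : W) : Ck k U (fun _ : V => a).
Proof.
elim: k a => [|k IH] a; first by move=> x _; exact: cst_continuous.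
split=> [x _|v]; first exact: differentiable_cst.
suff -> : 'D_v (fun _ : V => a) = (fun _ => 0) by exact: IH.
by apply/funext => x; exact: derive_cst.
Qed.

Lemma CkD (W : normedModType R) k U (f g : V -> W) : open U ->
  Ck k U f -> Ck k U g -> Ck k U (fun x => f x + g x).
Proof.
move=> oU; elim: k f g => [|k IH] f g.
  by move=> cf cg x Ux; apply: continuousD; [exact: cf|exact: cg].
move=> [df Df] [dg Dg]; split=> [x Ux|v].
  by apply: differentiableD; [exact: df|exact: dg].
apply: eq_Ck (IH _ _ (Df v) (Dg v)) => // x Ux.
by rewrite -deriveD //; apply: diff_derivable; [exact: df|exact: dg].
Qed.

Lemma CkM k U (f g : V -> R) : open U ->
  Ck k U f -> Ck k U g -> Ck k U (fun x => f x * g x).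
Proof.
move=> oU; elim: k f g => [|k IH] f g.
  by move=> cf cg x Ux; apply: continuousM; [exact: cf|exact: cg].
move=> fC gC; have [df Df] := fC; have [dg Dg] := gC; split=> [x Ux|v].
  by apply: differentiableM; [exact: df|exact: dg].
have := CkD oU (IH _ _ (CkS fC) (Dg v)) (IH _ _ (CkS gC) (Df v)).
apply: eq_Ck => // x Ux.
have {}df : derivable f x v by apply: diff_derivable; exact: df.
have {}dg : derivable g x v by apply: diff_derivable; exact: dg.
exact/esym/(deriveM df dg).
Qed.

Lemma CkV k U (f : V -> R) : open U -> (forall x, U x -> f x != 0) ->
  Ck k U f -> Ck k U (fun x => (f x)^-1).
Proof.
move=> oU f0; elim: k => [|k IH].
  by move=> cf x Ux; apply: continuousV; [exact: f0|exact: cf].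
move=> fC; have [df Df] := fC; split=> [x Ux|v].
  by apply: differentiableV; [exact: df|exact: f0].
have Vf := IH (CkS fC).
have := CkM oU (Ck_cst k U (-1 : R)) (CkM oU (CkM oU Vf Vf) (Df v)).
apply: eq_Ck => // x Ux.
have {}df : derivable f x v by apply: diff_derivable; exact: df.
have -> := deriveV (f0 x Ux) df.
by rewrite mulN1r scaleNr /GRing.scale /= expr2 invfM.
Qed.

Lemma Ck_sum (W : normedModType R) k U (I : Type) (s : seq I) (f : I -> V -> W) :
  open U -> (forall i, Ck k U (f i)) -> Ck k U (fun x => \sum_(i <- s) f i x).
Proof.
move=> oU fC; elim: s => [|i s IH].
  by apply: eq_Ck (Ck_cst k U 0) => // x Ux; rewrite big_nil.
by apply: eq_Ck (CkD oU (fC i) IH) => // x Ux; rewrite big_cons.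
Qed.

Lemma differentiable_mxP m n (f : V -> 'M[R]_(m, n)) x :
  (forall i j, differentiable (fun x => f x i j) x) -> differentiable f x.
Proof.
move=> df.
have -> : f = \sum_(i < m) \sum_(j < n)
    (fun x => f x i j *: delta_mx i j : 'M[R]_(m, n)).
  apply/funext => y; rewrite fct_sumE [LHS]matrix_sum_delta.
  by apply: eq_bigr => i _; rewrite fct_sumE.
apply: differentiable_sum => i; apply: differentiable_sum => j.
exact: differentiableZl.
Qed.

Lemma differentiable_entry m n (f : V -> 'M[R]_(m, n)) x i j :
  differentiable f x -> differentiable (fun x => f x i j) x.
Proof.
move=> df; apply: (@differentiable_comp _ _ _ _ f (fun M => M i j)) => //.
exact: differentiable_coord.
Qed.

Lemma derive_entry m n (f : V -> 'M[R]_(m, n)) x v i j : derivable f x v ->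
  ('D_v f x) i j = 'D_v (fun x => f x i j) x.
Proof. by move=> df; rewrite derive_mx// mxE. Qed.

Lemma Ck_mx m n k U (f : V -> 'M[R]_(m, n)) : open U ->
  (forall i j, Ck k U (fun x => f x i j)) -> Ck k U f.
Proof.
move=> oU; elim: k f => [|k IH] f fC.
  move=> x Ux; apply/cvgrPdist_le => /= e e0; near=> y.
  rewrite /Num.Def.normr/= mx_normrE (bigmax_le _ (ltW e0))//= => i _.
  rewrite !mxE; move: i; near: y; apply: filter_forall => /= -[i j].
  by have /cvgrPdist_le := fC i j x Ux; apply.
have df x : U x -> differentiable f x.
  by move=> Ux; apply: differentiable_mxP => i j; have [df _] := fC i j; exact: df.
split=> // v; apply: IH => i j; have [_ Df] := fC i j.
apply: eq_Ck (Df v) => // x Ux; rewrite derive_entry //.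
by apply: diff_derivable; exact: df.
Unshelve. all: by end_near. Qed.

Lemma Ck_entry m n k U (f : V -> 'M[R]_(m, n)) i j : open U ->
  Ck k U f -> Ck k U (fun x => f x i j).
Proof.
move=> oU; elim: k f => [|k IH] f.
  move=> fC x Ux; apply: (@continuous_comp _ _ _ f (fun M => M i j)).
    exact: fC.
  exact: coord_continuous.
move=> [df Df]; split=> [x Ux|v]; first by apply: differentiable_entry; exact: df.
apply: eq_Ck (IH _ (Df v)) => // x Ux; rewrite derive_entry //.
by apply: diff_derivable; exact: df.
Qed.

End CkTheory.

Section CkComp.
Context {R : realType} {V : normedModType R} {m : nat}.

Lemma diff_rowE (W : normedModType R) (f : 'rV[R]_m -> W) x v :
  'd f x v = \sum_(b < m) v 0 b *: 'd f x (delta_mx 0 b).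
Proof.
rewrite {1}[v]row_sum_delta linear_sum.
by apply: eq_bigr => b _; rewrite linearZ.
Qed.

Lemma derive_rowE (W : normedModType R) (f : 'rV[R]_m -> W) x v :
  differentiable f x -> 'D_v f x = \sum_(b < m) v 0 b *: 'D_(delta_mx 0 b) f x.
Proof.
move=> df; rewrite deriveE// diff_rowE.
by apply: eq_bigr => b _; rewrite deriveE.
Qed.

Lemma derive_comp (W : normedModType R) (Z : normedModType R)
    (f : V -> W) (g : W -> Z) x v :
  differentiable f x -> differentiable g (f x) ->
  'D_v (g \o f) x = 'D_('D_v f x) g (f x).
Proof.
move=> df dg; rewrite (deriveE _ (differentiable_comp df dg)) (deriveE _ dg).
by rewrite (deriveE _ df) diff_comp.
Qed.

(** By induction on [k]: the derivative of [f \o g] along [v] combines the partial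
    derivatives of [f] at [g x], which are only [k] times differentiable, with the
    components of ['D_v g]. *)
Lemma Ck_scalar_comp k (U : set V) (U' : set 'rV[R]_m)
    (g : V -> 'rV[R]_m) (f : 'rV[R]_m -> R) : open U ->
  (forall x, U x -> U' (g x)) -> Ck k U' f -> Ck k U g -> Ck k U (f \o g).
Proof.
move=> oU gU; elim: k f => [|k IH] f.
  move=> cf cg x Ux; apply: continuous_comp; [exact: cg|exact/cf/gU].
move=> [df Df] gC; have [dg Dg] := gC; split=> [x Ux|v].
  by apply: differentiable_comp; [exact: dg|exact/df/gU].
have : Ck k U (fun x => \sum_(b < m)
    ('D_v g x) 0 b * ('D_(delta_mx 0 b) f \o g) x).
  apply: Ck_sum => // b; apply: CkM => //; first exact: Ck_entry oU (Dg v).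
  exact: IH (Df _) (CkS gC).
apply: eq_Ck => // x Ux.
have dfx := df _ (gU x Ux).
by rewrite (derive_comp v (dg x Ux) dfx) (derive_rowE _ dfx).
Qed.

End CkComp.

Section SmoothTheory.
Context {R : realType} {V : normedModType R}.
Implicit Types (U : set V).

Lemma sub_smooth (W : normedModType R) U U' (f : V -> W) : U' `<=` U ->
  smooth_on U f -> smooth_on U' f.
Proof. by move=> UU' sf k; apply: sub_Ck (sf k). Qed.

Lemma eq_smooth (W : normedModType R) U (f g : V -> W) : open U ->
  (forall x, U x -> f x = g x) -> smooth_on U f -> smooth_on U g.
Proof. by move=> oU fg sf k; exact: eq_Ck (sf k). Qed.

Lemma smooth_cst (W : normedModType R) U (a : W) : smooth_on U (fun _ : V => a).
Proof. by move=> k; exact: Ck_cst. Qed.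

Lemma smooth_mxP m n U (f : V -> 'M[R]_(m, n)) : open U ->
  smooth_on U f <-> forall i j, smooth_on U (fun x => f x i j).
Proof.
move=> oU; split=> [sf i j k|sf k]; first exact: Ck_entry.
by apply: Ck_mx => // i j; exact: sf.
Qed.

Lemma smoothD (W : normedModType R) U (f g : V -> W) : open U ->
  smooth_on U f -> smooth_on U g -> smooth_on U (fun x => f x + g x).
Proof. by move=> oU sf sg k; exact: CkD. Qed.

Lemma smooth_sum (W : normedModType R) U (I : Type) (s : seq I)
    (f : I -> V -> W) : open U ->
  (forall i, smooth_on U (f i)) -> smooth_on U (fun x => \sum_(i <- s) f i x).
Proof. by move=> oU sf k; apply: Ck_sum => // i; exact: sf. Qed.

Lemma smoothM U (f g : V -> R) : open U ->
  smooth_on U f -> smooth_on U g -> smooth_on U (fun x => f x * g x).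
Proof. by move=> oU sf sg k; exact: CkM. Qed.

Lemma smoothN U (f : V -> R) : open U ->
  smooth_on U f -> smooth_on U (fun x => - f x).
Proof.
move=> oU sf; apply: eq_smooth (smoothM oU (smooth_cst U (-1 : R)) sf) => // x _.
by rewrite mulN1r.
Qed.

Lemma smooth_prod U (I : Type) (s : seq I) (f : I -> V -> R) : open U ->
  (forall i, smooth_on U (f i)) -> smooth_on U (fun x => \prod_(i <- s) f i x).
Proof.
move=> oU sf; elim: s => [|i s IH].
  by apply: eq_smooth (smooth_cst U (1 : R)) => // x Ux; rewrite big_nil.
by apply: eq_smooth (smoothM oU (sf i) IH) => // x Ux; rewrite big_cons.
Qed.

Lemma smoothV U (f : V -> R) : open U -> (forall x, U x -> f x != 0) ->
  smooth_on U f -> smooth_on U (fun x => (f x)^-1).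
Proof. by move=> oU f0 sf k; exact: CkV. Qed.

Lemma smooth_mulmx m n p U (f : V -> 'M[R]_(m, n)) (g : V -> 'M[R]_(n, p)) :
  open U -> smooth_on U f -> smooth_on U g ->
  smooth_on U (fun x => f x *m g x).
Proof.
move=> oU /(smooth_mxP _ oU) sf /(smooth_mxP _ oU) sg; apply/smooth_mxP => // i j.
apply: (@eq_smooth _ _ (fun x => \sum_k f x i k * g x k j)) => // [x _|].
  by rewrite mxE.
by apply: smooth_sum => // k; exact: smoothM.
Qed.

Lemma smooth_trmx m n U (f : V -> 'M[R]_(m, n)) : open U -> smooth_on U f ->
  smooth_on U (fun x => (f x)^T).
Proof.
move=> oU /(smooth_mxP _ oU) sf; apply/smooth_mxP => // i j.
by apply: eq_smooth (sf j i) => // x _; rewrite mxE.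
Qed.

Lemma smooth_row_mx m n1 n2 U (f : V -> 'M[R]_(m, n1)) (g : V -> 'M[R]_(m, n2)) :
  open U -> smooth_on U f -> smooth_on U g ->
  smooth_on U (fun x => row_mx (f x) (g x)).
Proof.
move=> oU /(smooth_mxP _ oU) sf /(smooth_mxP _ oU) sg; apply/smooth_mxP => // i j.
case: (split_ordP j) => b ->{j}.
  by apply: eq_smooth (sf i b) => // x _; rewrite row_mxEl.
by apply: eq_smooth (sg i b) => // x _; rewrite row_mxEr.
Qed.

Lemma smooth_lsubmx m n1 n2 U (f : V -> 'M[R]_(m, n1 + n2)) : open U ->
  smooth_on U f -> smooth_on U (fun x => lsubmx (f x)).
Proof.
move=> oU /(smooth_mxP _ oU) sf; apply/smooth_mxP => // i j.
by apply: eq_smooth (sf i (lshift n2 j)) => // x _; rewrite mxE.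
Qed.

Lemma smooth_rsubmx m n1 n2 U (f : V -> 'M[R]_(m, n1 + n2)) : open U ->
  smooth_on U f -> smooth_on U (fun x => rsubmx (f x)).
Proof.
move=> oU /(smooth_mxP _ oU) sf; apply/smooth_mxP => // i j.
by apply: eq_smooth (sf i (rshift n1 j)) => // x _; rewrite mxE.
Qed.

Lemma smooth_det n U (f : V -> 'M[R]_n) : open U -> smooth_on U f ->
  smooth_on U (fun x => \det (f x)).
Proof.
move=> oU /(smooth_mxP _ oU) sf; rewrite /determinant.
apply: smooth_sum => // s; apply: smoothM => //; first exact: smooth_cst.
by apply: smooth_prod.
Qed.

(** Cramer's rule makes the entries of the inverse rational in those of [f]. *)
Lemma smooth_invmx n U (f : V -> 'M[R]_n) : open U ->
  (forall x, U x -> f x \in unitmx) -> smooth_on U f ->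
  smooth_on U (fun x => invmx (f x)).
Proof.
move=> oU fU sf; have /(smooth_mxP _ oU) sf' := sf; apply/smooth_mxP => // i j.
apply: (@eq_smooth _ _ (fun x => (\det (f x))^-1 *
    ((-1) ^+ (j + i) * \det (row' j (col' i (f x)))))) => // [x Ux|].
  by rewrite /invmx (fU x Ux) !mxE.
apply: smoothM => //.
  apply: smoothV => //; last exact: smooth_det.
  by move=> x /fU; rewrite unitmxE unitfE.
apply: smoothM => //; first exact: smooth_cst.
apply: smooth_det => //; apply/smooth_mxP => // a b.
by apply: eq_smooth (sf' (lift j a) (lift i b)) => // x _; rewrite !mxE.
Qed.

Lemma smooth_id m (U : set 'rV[R]_m) : smooth_on U id.
Proof.
case=> [|k]; first by move=> x _; exact: cvg_id.
split=> [x _|v]; first by [].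
suff -> : 'D_v id = (fun _ : 'rV[R]_m => v) by exact: Ck_cst.
by apply/funext => x; exact: derive_id.
Qed.

End SmoothTheory.

Section SmoothComp.
Context {R : realType} {V : normedModType R}.
Implicit Types (U : set V).

Lemma smooth_comp m p q U (U' : set 'rV[R]_m)
    (g : V -> 'rV[R]_m) (f : 'rV[R]_m -> 'M[R]_(p, q)) : open U -> open U' ->
  (forall x, U x -> U' (g x)) -> smooth_on U' f -> smooth_on U g ->
  smooth_on U (f \o g).
Proof.
move=> oU oU' gU /(smooth_mxP _ oU') sf sg; apply/smooth_mxP => // i j k.
exact: Ck_scalar_comp gU (sf i j k) (sg k).
Qed.

Lemma smooth_scalar_comp m U (U' : set 'rV[R]_m)
    (g : V -> 'rV[R]_m) (f : 'rV[R]_m -> R) : open U ->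
  (forall x, U x -> U' (g x)) -> smooth_on U' f -> smooth_on U g ->
  smooth_on U (f \o g).
Proof. by move=> oU gU sf sg k; exact: Ck_scalar_comp gU (sf k) (sg k). Qed.

End SmoothComp.

(** * Derivatives of matrix-valued maps *)

Section DeriveMx.
Context {R : realType} {V : normedModType R}.
Implicit Types (x v : V).

Lemma is_derive_mxP m n (f : V -> 'M[R]_(m, n)) x v (df : 'M[R]_(m, n)) :
  (forall i j, is_derive x v (fun x => f x i j) (df i j)) -> is_derive x v f df.
Proof.
move=> fd; have fder : derivable f x v.
  by apply/derivable_mxP => i j; have [] := fd i j.
apply: DeriveDef => //; rewrite derive_mx//; apply/matrixP => i j.
by rewrite mxE; have [] := fd i j.
Qed.

Lemma is_derive_entry m n (f : V -> 'M[R]_(m, n)) x v df i j :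
  is_derive x v f df -> is_derive x v (fun x => f x i j) (df i j).
Proof.
move=> [fd <-]; apply: DeriveDef; last by rewrite derive_entry.
by move/derivable_mxP : fd; apply.
Qed.

Lemma is_derive_fsum (W : normedModType R) n (h : 'I_n -> V -> W) x v
    (dh : 'I_n -> W) :
  (forall i, is_derive x v (h i) (dh i)) ->
  is_derive x v (fun x => \sum_i h i x) (\sum_i dh i).
Proof.
move=> hd; suff -> : (fun x => \sum_i h i x) = \sum_i h i.
  exact: is_derive_sum.
by apply/funext => y; rewrite fct_sumE.
Qed.

Lemma is_derive_mul (f g : V -> R) x v df dg :
  is_derive x v f df -> is_derive x v g dg ->
  is_derive x v (fun x => f x * g x) (df * g x + f x * dg).
Proof.
move=> fd gd; apply: (is_derive_eq (is_deriveM fd gd)).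
by rewrite addrC /GRing.scale /= [g x * df]mulrC.
Qed.

Lemma is_derive_mulmx m n p (f : V -> 'M[R]_(m, n)) (g : V -> 'M[R]_(n, p))
    x v df dg :
  is_derive x v f df -> is_derive x v g dg ->
  is_derive x v (fun x => f x *m g x) (df *m g x + f x *m dg).
Proof.
move=> fd gd; apply: is_derive_mxP => i j.
have -> : (fun x => (f x *m g x) i j) = (fun x => \sum_k f x i k * g x k j).
  by apply/funext => y; rewrite mxE.
rewrite !mxE -big_split /=; apply: is_derive_fsum => k.
by apply: is_derive_mul; exact: is_derive_entry.
Qed.

Lemma is_derive_scale m n (f : V -> R) (g : V -> 'M[R]_(m, n)) x v df dg :
  is_derive x v f df -> is_derive x v g dg ->
  is_derive x v (fun x => f x *: g x) (df *: g x + f x *: dg).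
Proof.
move=> fd gd; apply: is_derive_mxP => i j.
have -> : (fun x => (f x *: g x) i j) = (fun x => f x * g x i j).
  by apply/funext => y; rewrite mxE.
by rewrite !mxE; apply: is_derive_mul => //; exact: is_derive_entry.
Qed.

Lemma is_derive_trmx m n (f : V -> 'M[R]_(m, n)) x v df :
  is_derive x v f df -> is_derive x v (fun x => (f x)^T) df^T.
Proof.
move=> fd; apply: is_derive_mxP => i j; rewrite mxE.
have -> : (fun x => (f x)^T i j) = (fun x => f x j i).
  by apply/funext => y; rewrite mxE.
exact: is_derive_entry.
Qed.

Lemma is_derive_lsubmx m n1 n2 (f : V -> 'M[R]_(m, n1 + n2)) x v df :
  is_derive x v f df -> is_derive x v (fun x => lsubmx (f x)) (lsubmx df).
Proof.
move=> fd; apply: is_derive_mxP => i j; rewrite mxE.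
have -> : (fun x => lsubmx (f x) i j) = (fun x => f x i (lshift n2 j)).
  by apply/funext => y; rewrite mxE.
exact: is_derive_entry.
Qed.

Lemma is_derive_rsubmx m n1 n2 (f : V -> 'M[R]_(m, n1 + n2)) x v df :
  is_derive x v f df -> is_derive x v (fun x => rsubmx (f x)) (rsubmx df).
Proof.
move=> fd; apply: is_derive_mxP => i j; rewrite mxE.
have -> : (fun x => rsubmx (f x) i j) = (fun x => f x i (rshift n1 j)).
  by apply/funext => y; rewrite mxE.
exact: is_derive_entry.
Qed.

Lemma is_derive_row_mx m n1 n2 (f : V -> 'M[R]_(m, n1)) (g : V -> 'M[R]_(m, n2))
    x v df dg :
  is_derive x v f df -> is_derive x v g dg ->
  is_derive x v (fun x => row_mx (f x) (g x)) (row_mx df dg).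
Proof.
move=> fd gd; apply: is_derive_mxP => i j.
case: (split_ordP j) => b ->{j}; rewrite ?row_mxEl ?row_mxEr.
  have -> : (fun x => row_mx (f x) (g x) i (lshift n2 b)) = (fun x => f x i b).
    by apply/funext => y; rewrite row_mxEl.
  exact: is_derive_entry.
have -> : (fun x => row_mx (f x) (g x) i (rshift n1 b)) = (fun x => g x i b).
  by apply/funext => y; rewrite row_mxEr.
exact: is_derive_entry.
Qed.

Lemma differentiable_is_derive (W : normedModType R) (f : V -> W) x v :
  differentiable f x -> is_derive x v f ('d f x v).
Proof.
by move=> df; apply: DeriveDef; [exact: diff_derivable|exact: deriveE].
Qed.

Lemma is_derive_val (W : normedModType R) (f : V -> W) x v df :
  is_derive x v f df -> 'D_v f x = df.
Proof. by case. Qed.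

Lemma is_derive_compose (W Z : normedModType R) (f : V -> W) (g : W -> Z) x v :
  differentiable f x -> differentiable g (f x) ->
  is_derive x v (g \o f) ('d g (f x) ('d f x v)).
Proof.
move=> df dg; have := differentiable_is_derive v (differentiable_comp df dg).
by rewrite diff_comp.
Qed.

(** The composite is only known near [x], as for transition maps. *)
Lemma chain_rule (W Z : normedModType R) (f : V -> W) (g : W -> Z) (h : V -> Z)
    x y v :
  f x = y -> differentiable f x -> differentiable g y ->
  (\forall x \near x, g (f x) = h x) -> 'd h x v = 'd g y ('d f x v).
Proof.
move=> <- df dg gfh; have dgf := differentiable_comp df dg.
by rewrite (near_eq_diff gfh dgf) (diff_comp df dg).
Qed.

Lemma smooth_is_derive (W : normedModType R) (U : set V) (f : V -> W) x v :
  smooth_on U f -> U x -> is_derive x v f ('D_v f x).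
Proof.
by move=> sf Ux; apply: DeriveDef => //; exact: smooth_derivable sf Ux.
Qed.

End DeriveMx.

(** * Symmetry of second derivatives *)

Section Line.
Context {R : realType} {V : normedModType R}.

Lemma is_derive_line (W : normedModType R) (f : V -> W) (c v : V) (s : R) :
  differentiable f (s *: v + c) ->
  is_derive s 1 (fun s => f (s *: v + c)) ('D_v f (s *: v + c)).
Proof.
move=> df; set l := fun s : R => s *: v + c.
have dl : differentiable l s by apply: differentiableD => //.
rewrite -[X in is_derive _ _ X _]/(f \o l).
apply: (is_derive_eq (is_derive_compose (1 : R) dl df)).
rewrite deriveE//; congr ('d f _ _).
have ml : is_diff s (fun r : R => r *: v) (fun r : R => r *: v).
  by have := is_diff_scalel s v.
have [_ dlE] : is_diff s l ((fun r : R => r *: v) + 0).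
  exact: is_diffD.
rewrite dlE; change (1 *: v + 0 = v).
by rewrite scale1r addr0.
Qed.

Lemma itvoo_le (a b t : R) : t \in `]a, b[ -> a <= t <= b.
Proof. by rewrite in_itv/= => /andP[? ?]; rewrite !ltW. Qed.

(** The mean value theorem in the direction [v], then in the direction [w],
    evaluates the second difference of [f] at a point of the parallelogram. *)
Lemma second_difference (U : set V) (f : V -> R) (x v w : V) (h : R) :
  smooth_on U f -> 0 < h ->
  (forall s t : R, 0 <= s <= h -> 0 <= t <= h -> U (s *: v + (t *: w + x))) ->
  exists s t : R, [/\ 0 <= s <= h, 0 <= t <= h &
    f (h *: v + (h *: w + x)) - f (h *: v + x) - f (h *: w + x) + f x
      = h ^+ 2 * 'D_w ('D_v f) (s *: v + (t *: w + x))].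
Proof.
move=> sf h0 hU.
have hh : 0 <= h <= h by rewrite lexx ltW.
have zh : (0 : R) <= 0 <= h by rewrite lexx ltW.
have xU s : 0 <= s <= h -> U (s *: v + x).
  by move=> sh; have := hU s 0 sh zh; rewrite scale0r add0r.
pose dif s := f (s *: v + (h *: w + x)) - f (s *: v + x).
have ddif s : 0 <= s <= h -> is_derive s 1 dif
    ('D_v f (s *: v + (h *: w + x)) - 'D_v f (s *: v + x)).
  move=> sI; have d1 := is_derive_line (smooth_differentiable sf (hU s h sI hh)).
  have d2 := is_derive_line (smooth_differentiable sf (xU s sI)).
  exact: is_deriveB.
have cdif : {within `[0, h], continuous dif}.
  by apply: derivable_within_continuous => s /[!in_itv]/= /ddif[].
have [s] := MVT h0 (fun s sI => ddif s (itvoo_le sI)) cdif.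
rewrite in_itv/= => /andP[s0 sh] eq1; have sI : 0 <= s <= h by rewrite !ltW.
have line t : s *: v + (t *: w + x) = t *: w + (s *: v + x).
  by rewrite addrCA.
have dW t : 0 <= t <= h -> is_derive t 1 (fun t => 'D_v f (t *: w + (s *: v + x)))
    ('D_w ('D_v f) (t *: w + (s *: v + x))).
  move=> tI; apply: is_derive_line; rewrite -line.
  by apply: smooth_differentiable (smooth_derive v sf) _; exact: hU.
have cW : {within `[0, h], continuous (fun t : R => 'D_v f (t *: w + (s *: v + x)))}.
  by apply: derivable_within_continuous => t /[!in_itv]/= /dW[].
have [t] := MVT h0 (fun t tI => dW t (itvoo_le tI)) cW.
rewrite in_itv/= => /andP[t0 th] eq2; exists s, t; split=> //.
  by rewrite !ltW.
rewrite line; transitivity (dif h - dif 0).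
  by rewrite /dif scale0r !add0r; ring.
move: eq2; rewrite eq1 line scale0r add0r => ->.
by rewrite !subr0 expr2 -mulrA mulrC.
Qed.

(** Schwarz's theorem: both iterated derivatives are limits of the same second
    difference, which is symmetric in the two directions. *)
Lemma derive_commute (U : set V) (f : V -> R) (x v w : V) :
  open U -> smooth_on U f -> U x -> 'D_w ('D_v f) x = 'D_v ('D_w f) x.
Proof.
move=> oU sf Ux; apply/eqP; rewrite -subr_eq0 -normr_le0.
apply/ler_addgt0Pl => e e0; rewrite addr0.
have e20 : 0 < e / 2 by rewrite divr_gt0.
have close a b : \forall y \near x, `|'D_b ('D_a f) x - 'D_b ('D_a f) y| < e / 2.
  have := smooth_continuous (smooth_derive b (smooth_derive a sf)) Ux.
  by move=> /cvgrPdist_lt; apply.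
have : \forall y \near x, [/\ U y, `|'D_w ('D_v f) x - 'D_w ('D_v f) y| < e / 2 &
    `|'D_v ('D_w f) x - 'D_v ('D_w f) y| < e / 2].
  have nU : \forall y \near x, U y by exact: open_near oU Ux _.
  by apply: filterS3 nU (close v w) (close w v).
move=> /nbhs_ballP[d /= d0 dP].
(* This choice of [h] keeps both parallelograms inside the ball of radius [d]. *)
pose c := `|v| + `|w| + 1; have c0 : 0 < c by rewrite ltr_wpDl.
pose h := d / c / 2; have h0 : 0 < h by rewrite !divr_gt0.
have hP (a b : V) s t : `|a| + `|b| < c -> 0 <= s <= h -> 0 <= t <= h ->
    ball x d (s *: a + (t *: b + x)).
  move=> abc /andP[s0 sh] /andP[t0 th].
  rewrite -ball_normE /ball_/= distrC addrA addrK.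
  apply: le_lt_trans (ler_normD _ _) _; rewrite !normrZ !ger0_norm //.
  apply: (@le_lt_trans _ _ (h * c)); last first.
    by rewrite /h mulrAC divfK ?gt_eqF// ltr_pdivrMr// ltr_pMr// ltr1n.
  apply: (@le_trans _ _ (h * (`|a| + `|b|))).
    by rewrite mulrDr lerD// ler_wpM2r.
  by rewrite ler_wpM2l ?ltW.
have vwc : `|v| + `|w| < c by rewrite ltrDl.
have wvc : `|w| + `|v| < c by rewrite addrC.
have Uvw s t : 0 <= s <= h -> 0 <= t <= h -> U (s *: v + (t *: w + x)).
  by move=> sh th; have [] := dP _ (hP _ _ _ _ vwc sh th).
have Uwv s t : 0 <= s <= h -> 0 <= t <= h -> U (s *: w + (t *: v + x)).
  by move=> sh th; have [] := dP _ (hP _ _ _ _ wvc sh th).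
have [s [t [sI tI e1]]] := second_difference sf h0 Uvw.
have [s' [t' [sI' tI' e2]]] := second_difference sf h0 Uwv.
rewrite [in f (h *: v + _)]addrCA in e1.
have [_ + _] := dP _ (hP _ _ _ _ vwc sI tI).
have [_ _ +] := dP _ (hP _ _ _ _ wvc sI' tI').
move: e1 e2; move: (f _) (f _) (f _) (f _) => f1 f2 f3 f4.
move: ('D_w _ _) ('D_w _ _) ('D_v _ _) ('D_v _ _) => A A' B B' e1 e2 BB AA.
have AB : A' = B'.
  have h2 : h ^+ 2 != 0 by rewrite expf_neq0// gt_eqF.
  by apply: (mulfI h2); rewrite -e1 -e2; ring.
rewrite -(subrKA A') {2}AB; apply: le_trans (ler_normD _ _) _.
by rewrite (splitr e) lerD// ltW// distrC.
Qed.

End Line.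

(** * Homogeneous linear differential equations *)

Section LinearODE.
Context {R : realType}.

(** A property that is transported between any two nearby times is transported
    along the whole interval, which is connected. *)
Lemma locally_invariant (a b : R) (P : R -> Prop) :
  let J := [set t : R | a < t < b] in
  (forall t0, J t0 -> exists2 B : set R, nbhs t0 B &
     forall s t, B s -> B t -> J s -> J t -> P s -> P t) ->
  forall s t, J s -> J t -> P s -> P t.
Proof.
move=> J loc s t Js Jt Ps.
have JE : J = `]a, b[%classic by apply/seteqP; split=> x /=; rewrite in_itv.
have oJ : open J by rewrite JE; exact: interval_open.
have oP Q : (forall t0, J t0 -> exists2 B : set R, nbhs t0 B &
    forall s t, B s -> B t -> J s -> J t -> Q s -> Q t) -> open (J `&` Q).
  move=> locQ; rewrite openE => t0 [Jt0 Qt0]; rewrite /interior.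
  have [B nB BQ] := locQ t0 Jt0; have Bt0 := nbhs_singleton nB.
  have nJ : nbhs t0 J by exact: open_nbhs_nbhs.
  apply: filterS2 nB nJ => u Bu Ju; split=> //.
  exact: BQ Bt0 Bu Jt0 Ju Qt0.
have cJ : connected J.
  by rewrite JE; apply/connected_intervalP; exact: interval_is_interval.
have : J `&` P = J.
  apply: cJ; first by exists s.
    exists (J `&` P); first exact: oP.
    by rewrite setIA setIid.
  exists (~` (J `&` ~` P)).
    apply: open_closedC; apply: oP => t0 /loc[B nB BP].
    by exists B => // u v Bu Bv Ju Jv nPu Pv; apply: nPu; exact: BP Pv.
  apply/seteqP; split=> u [Ju Pu]; split=> //; first by case.
  by apply: contrapT => nPu; apply: Pu.
by move=> JP; have : (J `&` P) t by [rewrite JP]; case.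
Qed.

Section Gronwall.
Variables (n : nat) (K a b : R) (X : R -> 'rV[R]_n) (A : R -> 'M[R]_n).
Hypothesis dX : forall t, a < t < b -> is_derive t 1 X (X t *m A t).
Hypothesis AK : forall t i j, a < t < b -> `|A t i j| <= K.

Let E t : R := \sum_i X t 0 i ^+ 2.
Let dE t : R := \sum_i \sum_j (X t 0 j * A t j i * X t 0 i) *+ 2.
Let C : R := K * n%:R *+ 2.

Let is_derive_E t : a < t < b -> is_derive t 1 E (dE t).
Proof.
move=> tI; apply: is_derive_fsum => i.
have := is_derive_entry 0 i (dX tI); rewrite mxE => di.
have -> : (fun x => X x 0 i ^+ 2) = (fun x => X x 0 i * X x 0 i).
  by apply/funext => x; rewrite expr2.
apply: (is_derive_eq (is_derive_mul di di)).
by rewrite mulrC -mulr2n mulr_sumr -sumrMnl; apply: eq_bigr => j _; rewrite mulrC.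
Qed.

Let dE_bound t : a < t < b -> `|dE t| <= C * E t.
Proof.
move=> tI.
(* Each term is bounded using [2 |x y| <= x^2 + y^2]. *)
apply: (@le_trans _ _ (\sum_i \sum_j K * (X t 0 j ^+ 2 + X t 0 i ^+ 2))).
  apply: le_trans (ler_norm_sum _ _ _) _; apply: ler_sum => i _.
  apply: le_trans (ler_norm_sum _ _ _) _; apply: ler_sum => j _.
  have -> : (X t 0 j * A t j i * X t 0 i) *+ 2 =
    A t j i * (X t 0 j * X t 0 i *+ 2) by ring.
  rewrite normrM; apply: ler_pM; rewrite ?AK//.
  have := sqr_ge0 (X t 0 j + X t 0 i); have := sqr_ge0 (X t 0 j - X t 0 i).
  by rewrite sqrrB sqrrD ler_norml; lra.
rewrite le_eqVlt; apply/orP; left; apply/eqP.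
under eq_bigr do rewrite -mulr_sumr big_split /=.
rewrite -mulr_sumr big_split /= sumr_const card_ord.
under [X in _ + X]eq_bigr do rewrite sumr_const card_ord.
rewrite sumrMnl -/(E t) /C; ring.
Qed.

(** The squared norm [E] of a solution satisfies [`|E'| <= C * E], so that
    [E * expR (- C t)] is nonincreasing and [E * expR (C t)] is nondecreasing: [E]
    can leave [0] neither forwards nor backwards. *)
Lemma linear_ode_zero s t : a < s < b -> a < t < b -> X s = 0 -> X t = 0.
Proof.
move=> sI tI Xs.
have E0 u : 0 <= E u by apply: sumr_ge0 => i _; exact: sqr_ge0.
have Es : E s = 0 by apply: big1 => i _; rewrite Xs mxE expr0n.
suff : E t <= 0.
  move=> Et; have {Et} : E t = 0 by apply: le_anti; rewrite Et E0.
  move=> /eqP; rewrite psumr_eq0 => [/allP Xt|i _]; last exact: sqr_ge0.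
  apply/rowP => i; rewrite mxE; apply/eqP.
  by have := Xt i (mem_index_enum i); rewrite /= sqrf_eq0.
pose F c u := E u * expR (c * u).
have dF c u : a < u < b -> is_derive u 1 (F c) ((dE u + c * E u) * expR (c * u)).
  move=> uI.
  have de : is_derive u 1 (fun u : R => expR (c * u)) (c * expR (c * u)).
    have dl : is_derive u 1 (fun u : R => c * u) c.
      by apply: (is_derive_eq (is_deriveZ c (is_derive_id u 1))); exact: mulr1.
    have := @is_derive1_comp R expR (fun u => c * u) u _ _ (is_derive_expR _) dl.
    by rewrite mulrC.
  by apply: (is_derive_eq (is_derive_mul (is_derive_E uI) de)); ring.
have derF c u : u \in `]a, b[ -> derivable (F c) u 1.
  by rewrite in_itv/= => /(dF c)[].
have cF c : {in `]a, b[%classic, continuous (F c)}.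
  by move=> u; rewrite inE => /(derF c) /derivable1_diffP; exact: differentiable_continuous.
have FE c u : (F c u <= 0) = (E u <= 0) by rewrite pmulr_lle0// expR_gt0.
have sI' : s \in `]a, b[ by rewrite in_itv.
have tI' : t \in `]a, b[ by rewrite in_itv.
have FsE c : F c s = 0 by rewrite /F Es mul0r.
have [st|/ltW ts] := leP s t.
  suff Fts : F (- C) t <= F (- C) s by rewrite -(FE (- C)) (le_trans Fts) ?FsE.
  apply: (ler0_derive1_le_oo (derF (- C)) _ (cF (- C)) tI' sI' st) => u uI.
  rewrite derive1E; move: uI; rewrite in_itv/= => uI.
  rewrite (is_derive_val (dF _ u uI)) pmulr_lle0 ?expR_gt0// mulNr subr_le0.
  by apply: le_trans (dE_bound uI); exact: ler_norm.
suff Fts : F C t <= F C s by rewrite -(FE C) (le_trans Fts) ?FsE.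
apply: (ger0_derive1_le_oo (derF C) _ (cF C) tI' sI' ts) => u uI.
rewrite derive1E; move: uI; rewrite in_itv/= => uI.
rewrite (is_derive_val (dF _ u uI)) pmulr_lge0 ?expR_gt0//.
have := dE_bound uI; rewrite ler_norml => /andP[+ _].
by rewrite -subr_ge0 opprK.
Qed.
End Gronwall.

End LinearODE.

(** * Christoffel symbols over a field *)

Section Christoffel.
Context {F : numFieldType} {n : nat}.
Implicit Types (g P : 'M[F]_n) (dg Gam B : 'I_n -> 'M[F]_n) (i j k : 'I_n).

(** [christoffel g dg k j a] is the symbol [\Gamma^a_{jk}] of the metric [g],
    whose derivatives along the frame are [dg]. *)
Definition christoffel g dg k : 'M[F]_n := \matrix_(j, a)
  (2^-1 * \sum_r invmx g a r * (dg k j r + dg j k r - dg r j k)).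

Lemma christoffel_lower g dg k : g \in unitmx -> g^T = g ->
  christoffel g dg k *m g =
    \matrix_(j, b) (2^-1 * (dg k j b + dg j k b - dg b j k)).
Proof.
move=> gU gT; set T := RHS.
have -> : christoffel g dg k = T *m (invmx g)^T.
  apply/matrixP => j a; rewrite !mxE mulr_sumr; apply: eq_bigr => r _.
  by rewrite !mxE mulrCA mulrC.
by rewrite trmx_inv gT mulmxKV.
Qed.

Lemma christoffel_metric g dg k : g \in unitmx -> g^T = g ->
  (forall k, (dg k)^T = dg k) ->
  christoffel g dg k *m g + (christoffel g dg k *m g)^T = dg k.
Proof.
move=> gU gT dgT; rewrite christoffel_lower//.
apply/matrixP => j b; rewrite !mxE.
have dgE i a c : dg i a c = dg i c a by rewrite -{1}dgT mxE.
by rewrite (dgE k b j) (dgE b k j) (dgE j b k); field.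
Qed.

(** Koszul's argument: with the symmetry of [Gam], the alternating sum of three
    compatibility relations isolates a single lowered symbol. *)
Lemma christoffel_unique g dg Gam : g \in unitmx -> g^T = g ->
  (forall k, Gam k *m g + (Gam k *m g)^T = dg k) ->
  (forall k j a, Gam k j a = Gam j k a) ->
  forall k, Gam k = christoffel g dg k.
Proof.
move=> gU gT Gg Gsym k; apply: (can_inj (mulmxK gU)).
rewrite christoffel_lower//; apply/matrixP => j b.
have Tsym i j' a : (Gam i *m g) j' a = (Gam j' *m g) i a.
  by rewrite !mxE; apply: eq_bigr => c _; rewrite Gsym.
have dgE i a c : dg i a c = (Gam i *m g) a c + (Gam i *m g) c a.
  by rewrite -Gg 2!mxE; congr (_ + _); rewrite mxE.
by rewrite [in RHS]mxE !dgE (Tsym j k b) (Tsym b j k) (Tsym b k j); field.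
Qed.

(** The symbols of [g'] transported to another frame, with the inhomogeneous term
    [B] coming from the derivative of the change of frame [P], are again
    torsion free and compatible with the metric [g], hence are the symbols of
    [g]. *)
Lemma christoffel_change g g' P dg dg' B :
  g = P *m g' *m P^T -> P \in unitmx -> g' \in unitmx -> g'^T = g' ->
  (forall k, (dg' k)^T = dg' k) ->
  (forall k j a, B k j a = B j k a) ->
  (forall k, dg k = B k *m g' *m P^T
     + P *m (\sum_c P k c *: dg' c) *m P^T + P *m g' *m (B k)^T) ->
  forall k, B k + P *m (\sum_c P k c *: christoffel g' dg' c) =
            christoffel g dg k *m P.
Proof.
move=> gE PU g'U g'T dg'T Bsym dgE.
have gU : g \in unitmx by rewrite gE !unitmx_mul PU g'U unitmx_tr.
have gT : g^T = g by rewrite gE !trmx_mul g'T trmxK mulmxA.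
pose S k := \sum_c P k c *: christoffel g' dg' c.
pose Gam k := (B k + P *m S k) *m invmx P.
have GamP k : Gam k *m P = B k + P *m S k by rewrite /Gam mulmxKV.
have Ssum k : S k *m g' + (S k *m g')^T = \sum_c P k c *: dg' c.
  rewrite /S mulmx_suml linear_sum -big_split /=; apply: eq_bigr => c _.
  by rewrite -scalemxAl linearZ /= -scalerDr christoffel_metric.
have GU k : Gam k *m g = B k *m g' *m P^T + P *m (S k *m g') *m P^T.
  by rewrite gE !mulmxA GamP !mulmxDl.
have H k : Gam k *m g + (Gam k *m g)^T = dg k.
  rewrite GU dgE -Ssum linearD /= mulmxDr mulmxDl !trmx_mul !trmxK g'T.
  rewrite addrACA -!addrA; congr (_ + _); rewrite addrCA; congr (_ + _).
  by rewrite addrC !mulmxA.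
move=> k; rewrite -/(S k) -GamP; congr (_ *m _).
apply: christoffel_unique => // {}k j a.
suff sym k' j' : (B k' + P *m S k') j' =1 (B j' + P *m S j') k'.
  have RowE (M N : 'M[F]_n) i j' : M i =1 N j' -> (M *m invmx P) i =1 (N *m invmx P) j'.
    by move=> MN c; rewrite !mxE; apply: eq_bigr => d _; rewrite MN.
  exact: RowE.
move=> b; rewrite !mxE Bsym; congr (_ + _).
have E i l : \sum_d P i d * S l d b =
    \sum_d \sum_c P i d * P l c * christoffel g' dg' c d b.
  apply: eq_bigr => d _; rewrite /S summxE mulr_sumr.
  by apply: eq_bigr => c _; rewrite mxE mulrA.
rewrite !E exchange_big /=; apply: eq_bigr => c _; apply: eq_bigr => d _.
rewrite [P j' _ * _]mulrC; congr (_ * _).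
rewrite !mxE; congr (_ * _); apply: eq_bigr => r _; congr (_ * _).
rewrite [dg' c d r + _]addrC; congr (_ - _).
by rewrite -{1}dg'T mxE.
Qed.

End Christoffel.

(** * The canonical objects in one chart *)

Section Coordinates.
Context {R : realType} {n : nat}.
Implicit Types (l f : 'rV[R]_(n + n) -> R) (z w : 'rV[R]_(n + n)) (k : 'I_n).

Lemma row_mx_sum (u v : 'rV[R]_n) : row_mx u v =
  \sum_k u 0 k *: row_mx (delta_mx 0 k) 0 + \sum_k v 0 k *: vframe k.
Proof.
transitivity (row_mx u 0 + row_mx 0 v); first by rewrite add_row_mx addr0 add0r.
rewrite {1}[u]row_sum_delta {1}[v]row_sum_delta; congr (_ + _).
  elim/big_rec2: _ => [|k a b _ <-]; first by rewrite row_mx0.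
  by rewrite scale_row_mx scaler0 add_row_mx addr0.
elim/big_rec2: _ => [|k a b _ <-]; first by rewrite row_mx0.
by rewrite /vframe scale_row_mx scaler0 add_row_mx addr0.
Qed.

Lemma row_mx0_sum (c : 'I_n -> R) (r : 'I_n -> 'rV[R]_n) :
  row_mx 0 (\sum_k c k *: r k) = \sum_k c k *: row_mx 0 (r k) :> 'rV[R]_(n + n).
Proof.
apply/rowP => j; rewrite summxE; case: (split_ordP j) => i ->{j}.
  by rewrite row_mxEl mxE big1 // => k _; rewrite mxE row_mxEl mxE mulr0.
by rewrite row_mxEr summxE; apply: eq_bigr => k _; rewrite mxE [RHS]mxE row_mxEr.
Qed.

Lemma diff_sum_dir (W : normedModType R) (f : 'rV[R]_(n + n) -> W) z
    (c : 'I_n -> R) (e : 'I_n -> 'rV[R]_(n + n)) : differentiable f z ->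
  'D_(\sum_k c k *: e k) f z = \sum_k c k *: 'D_(e k) f z.
Proof.
move=> df; rewrite deriveE// linear_sum; apply: eq_bigr => k _.
by rewrite linearZ /= -deriveE.
Qed.

Lemma diff_add_dir (W : normedModType R) (f : 'rV[R]_(n + n) -> W) z u v :
  differentiable f z -> 'D_(u + v) f z = 'D_u f z + 'D_v f z.
Proof. by move=> df; rewrite deriveE// linearD /= -!deriveE. Qed.

Lemma diff_row_mx f z (u v : 'rV[R]_n) : differentiable f z ->
  'D_(row_mx u v) f z = \sum_k u 0 k * dx k f z + \sum_k v 0 k * dy k f z.
Proof.
by move=> df; rewrite row_mx_sum diff_add_dir // !diff_sum_dir.
Qed.

Lemma diff_row_mxl f z (u : 'rV[R]_n) : differentiable f z ->
  'D_(row_mx u 0) f z = \sum_k u 0 k * dx k f z.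
Proof.
move=> df; rewrite diff_row_mx // [X in _ + X]big1 ?addr0 // => k _.
by rewrite mxE mul0r.
Qed.

Lemma diff_row_mxr f z (v : 'rV[R]_n) : differentiable f z ->
  'D_(row_mx 0 v) f z = \sum_k v 0 k * dy k f z.
Proof.
move=> df; rewrite diff_row_mx // [X in X + _]big1 ?add0r // => k _.
by rewrite mxE mul0r.
Qed.

(** The matrix [N_k^r] of the nonlinear connection, [k] indexing the rows. *)
Definition Nmx l z : 'M[R]_n := \matrix_(k, r) Ncoef l r k z.

(** The vertical part of [w], in the coframe dual to the adapted frame. *)
Definition vpart l z w : 'rV[R]_n := rsubmx w + lsubmx w *m Nmx l z.

Definition spray_row l z : 'rV[R]_n := \row_i spray l i z.

(** [\hat L] and [\hat C] are Christoffel symbols of the same matrix [Lg], which is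
    differentiated along the horizontal or along the vertical half of the frame. *)
Definition hsymbol l z k : 'M[R]_n :=
  christoffel (Lg l z) (fun k => 'D_(hframe l k z) (Lg l) z) k.
Definition vsymbol l z k : 'M[R]_n :=
  christoffel (Lg l z) (fun k => 'D_(vframe k) (Lg l) z) k.

(** The connection form, evaluated at [w].  The same matrix acts on horizontal and
    on vertical components. *)
Definition conn_form l z w : 'M[R]_n :=
  \sum_k lsubmx w 0 k *: hsymbol l z k + \sum_k vpart l z w 0 k *: vsymbol l z k.

Lemma vpart_linear l z a u w : vpart l z (a *: u + w) = a *: vpart l z u + vpart l z w.
Proof.
by rewrite /vpart !linearP /= mulmxDl -scalemxAl scalerDr addrACA.
Qed.

Lemma vpartD l z u w : vpart l z (u + w) = vpart l z u + vpart l z w.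
Proof. by rewrite -[u]scale1r vpart_linear !scale1r. Qed.

Lemma vpart0 l z : vpart l z 0 = 0.
Proof. by rewrite /vpart !linear0 mul0mx addr0. Qed.

Lemma vpartZ l z a w : vpart l z (a *: w) = a *: vpart l z w.
Proof. by rewrite -[a *: w]addr0 vpart_linear vpart0 !addr0. Qed.

Lemma conn_form_linear l z a u w :
  conn_form l z (a *: u + w) = a *: conn_form l z u + conn_form l z w.
Proof.
have comb (p q : 'rV[R]_n) (M : 'I_n -> 'M[R]_n) :
    \sum_k (a *: p + q) 0 k *: M k = a *: (\sum_k p 0 k *: M k) + \sum_k q 0 k *: M k.
  rewrite scaler_sumr -big_split /=; apply: eq_bigr => k _.
  by rewrite !mxE scalerA -scalerDl.
rewrite /conn_form vpart_linear.
have -> : lsubmx (a *: u + w) = a *: lsubmx u + lsubmx w by rewrite linearP.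
move: (hsymbol l z) (vsymbol l z) (vpart l z u) (vpart l z w) => G C p q.
by rewrite !comb scalerDr addrACA.
Qed.

Lemma hframeE l k z : hframe l k z = row_mx (delta_mx 0 k) (- row k (Nmx l z)).
Proof. by rewrite /hframe; congr row_mx; apply/rowP => r; rewrite !mxE. Qed.

Lemma vpart_hframe l k z : vpart l z (hframe l k z) = 0.
Proof. by rewrite hframeE /vpart row_mxKr row_mxKl -rowE addNr. Qed.

Lemma vpart_vframe l k z : vpart l z (vframe k) = delta_mx 0 k.
Proof. by rewrite /vpart row_mxKr row_mxKl mul0mx addr0. Qed.

(** Removing from [w] the combination of the [hframe l k z] with the same base part
    leaves a vertical vector, with components [vpart l z w]. *)
Lemma frame_decomp l z w :
  w = \sum_k lsubmx w 0 k *: hframe l k z + \sum_k vpart l z w 0 k *: vframe k.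
Proof.
rewrite -{1}[w]hsubmxK row_mx_sum; set v := vpart _ _ _.
have -> : rsubmx w = v - lsubmx w *m Nmx l z by rewrite addrK.
have -> : \sum_k (v - lsubmx w *m Nmx l z) 0 k *: vframe k =
    \sum_k v 0 k *: vframe k - \sum_k (lsubmx w *m Nmx l z) 0 k *: vframe k :> 'rV[R]__.
  by rewrite -sumrB; apply: eq_bigr => k _; rewrite !mxE -scalerBl.
rewrite addrA addrAC; congr (_ + _).
have -> : \sum_k (lsubmx w *m Nmx l z) 0 k *: vframe k =
    row_mx 0 (lsubmx w *m Nmx l z) :> 'rV[R]__.
  rewrite [RHS]row_mx_sum [X in _ = X + _]big1 ?add0r // => k _.
  by rewrite mxE scale0r.
rewrite mulmx_sum_row row_mx0_sum.
rewrite -sumrB; apply: eq_bigr => k _; rewrite -scalerBr hframeE.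
by rewrite opp_row_mx add_row_mx subr0 add0r.
Qed.

Lemma sum_delta_row (G : 'I_n -> 'M[R]_n) k :
  \sum_i (delta_mx 0 k : 'rV[R]_n) 0 i *: G i = G k.
Proof.
rewrite (bigD1 k) //= mxE !eqxx scale1r big1 ?addr0 // => i /negPf ik.
by rewrite mxE ik andbF scale0r.
Qed.

Lemma sum_zero_row (G : 'I_n -> 'M[R]_n) : \sum_i (0 : 'rV[R]_n) 0 i *: G i = 0.
Proof. by apply: big1 => i _; rewrite mxE scale0r. Qed.

Lemma conn_form_hframe l k z : conn_form l z (hframe l k z) = hsymbol l z k.
Proof.
rewrite /conn_form vpart_hframe hframeE row_mxKl.
move: (hsymbol l z) (vsymbol l z) => G C.
by rewrite sum_delta_row sum_zero_row addr0.
Qed.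

Lemma conn_form_vframe l k z : conn_form l z (vframe k) = vsymbol l z k.
Proof.
rewrite /conn_form vpart_vframe row_mxKl.
move: (hsymbol l z) (vsymbol l z) => G C.
by rewrite sum_delta_row sum_zero_row add0r.
Qed.

Section OneChart.
Variables (O : set 'rV[R]_(n + n)) (l : 'rV[R]_(n + n) -> R).
Hypotheses (oO : open O) (sl : smooth_on O l).
Hypothesis gU : forall z, O z -> Lg l z \in unitmx.

Let sdx k f : smooth_on O f -> smooth_on O (dx k f).
Proof. exact: smooth_derive. Qed.

Let sdy k f : smooth_on O f -> smooth_on O (dy k f).
Proof. exact: smooth_derive. Qed.

Lemma smooth_Lg : smooth_on O (Lg l).
Proof.
apply/smooth_mxP => // i j.
apply: (@eq_smooth _ _ _ _ (fun z => 2^-1 * dy i (dy j l) z)) => // [z _|].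
  by rewrite mxE.
by apply: smoothM => //; [exact: smooth_cst|exact/sdy/sdy].
Qed.

Lemma Lg_sym z : O z -> (Lg l z)^T = Lg l z.
Proof.
move=> Oz; apply/matrixP => i j; rewrite 3!mxE.
exact: (congr1 (fun x => 2^-1 * x) (derive_commute _ _ oO sl Oz)).
Qed.

Lemma smooth_spray_row : smooth_on O (spray_row l).
Proof.
have sLi := smooth_invmx oO gU smooth_Lg.
apply/smooth_mxP => // a i; rewrite ord1.
apply: (@eq_smooth _ _ _ _ (spray l i)) => // [z _|]; first by rewrite mxE.
apply: smoothM => //; first exact: smooth_cst.
apply: smoothM => //; first exact: smooth_cst.
apply: smooth_sum => // j; apply: smoothM => //.
  by move/(smooth_mxP _ oO): sLi; apply.
apply: smoothD => //; last by apply: smoothN => //; exact: sdx.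
apply: smooth_sum => // k; apply: smoothM => //; first exact/sdy/sdx.
by have /(smooth_mxP _ oO) := smooth_id O; apply.
Qed.

Lemma Nmx_rowE z k : O z -> row k (Nmx l z) = 'D_(vframe k) (spray_row l) z.
Proof.
move=> Oz; rewrite derive_mx; last exact: smooth_derivable smooth_spray_row Oz.
apply/rowP => r; rewrite 2!mxE [RHS]mxE.
have -> : (fun y => spray_row l y 0 r) = spray l r.
  by apply/funext => y; rewrite mxE.
by [].
Qed.

Lemma smooth_Nmx : smooth_on O (Nmx l).
Proof.
apply/smooth_mxP => // k r; have sG := smooth_derive (vframe k) smooth_spray_row.
have /(smooth_mxP _ oO) /(_ 0 r) := sG; apply: eq_smooth => // z Oz.
by rewrite -Nmx_rowE // mxE.
Qed.

Lemma smooth_hframe k : smooth_on O (hframe l k).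
Proof.
apply: smooth_row_mx => //; first exact: smooth_cst.
apply/smooth_mxP => // a r; apply: (@eq_smooth _ _ _ _ (fun z => - Nmx l z k r)) => //.
  by move=> z _; rewrite !mxE.
by apply: smoothN => //; have /(smooth_mxP _ oO) := smooth_Nmx; apply.
Qed.

Lemma smooth_vpart (w : 'rV[R]_(n + n) -> 'rV[R]_(n + n)) : smooth_on O w -> smooth_on O (fun z => vpart l z (w z)).
Proof.
move=> sw; apply: smoothD => //; first exact: smooth_rsubmx.
by apply: smooth_mulmx => //; [exact: smooth_lsubmx|exact: smooth_Nmx].
Qed.

Lemma smooth_dir (m p : nat) (f : 'rV[R]_(n + n) -> 'M[R]_(m, p))
    (w : 'rV[R]_(n + n) -> 'rV[R]_(n + n)) :
  smooth_on O f -> smooth_on O w -> smooth_on O (fun z => 'D_(w z) f z).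
Proof.
move=> sf sw; apply: (@eq_smooth _ _ _ _ (fun z => \sum_b w z 0 b *: 'D_(delta_mx 0 b) f z)) => //.
  by move=> z Oz; rewrite derive_rowE//; exact: smooth_differentiable sf Oz.
apply: smooth_sum => // b; apply/smooth_mxP => // i j.
apply: (@eq_smooth _ _ _ _ (fun z => w z 0 b * ('D_(delta_mx 0 b) f z) i j)) => // [z _|].
  by rewrite mxE.
apply: smoothM => //; first by have /(smooth_mxP _ oO) := sw; apply.
by have /(smooth_mxP _ oO) := smooth_derive (delta_mx 0 b) sf; apply.
Qed.

Lemma smooth_christoffel (dg : 'rV[R]_(n + n) -> 'I_n -> 'M[R]_n) k :
  (forall k, smooth_on O (fun z => dg z k)) ->
  smooth_on O (fun z => christoffel (Lg l z) (dg z) k).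
Proof.
move=> sdg; have sE i j r : smooth_on O (fun z => dg z i j r).
  by have /(smooth_mxP _ oO) := sdg i; apply.
apply/smooth_mxP => // j a; apply: (@eq_smooth _ _ _ _ (fun z => 2^-1 * \sum_r
    invmx (Lg l z) a r * (dg z k j r + dg z j k r - dg z r j k))) => // [z _|].
  by rewrite mxE.
apply: smoothM => //; first exact: smooth_cst.
apply: smooth_sum => // r; apply: smoothM => //.
  by have /(smooth_mxP _ oO) := smooth_invmx oO gU smooth_Lg; apply.
by apply: smoothD => //; [exact: smoothD|exact: smoothN].
Qed.

Lemma smooth_conn_form (w : 'rV[R]_(n + n) -> 'rV[R]_(n + n)) : smooth_on O w ->
  smooth_on O (fun z => conn_form l z (w z)).
Proof.
have sZ (c : 'rV[R]_(n + n) -> R) (M : 'rV[R]_(n + n) -> 'M[R]_n) :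
    smooth_on O c -> smooth_on O M -> smooth_on O (fun z => c z *: M z).
  move=> sc /(smooth_mxP _ oO) sM; apply/smooth_mxP => // i j.
  apply: (@eq_smooth _ _ _ _ (fun z => c z * M z i j)) => // [z _|].
    by rewrite mxE.
  exact: smoothM.
move=> sw; apply: smoothD => //; apply: smooth_sum => // k; apply: sZ.
- by have /(smooth_mxP _ oO) := smooth_lsubmx oO sw; apply.
- by apply: smooth_christoffel => i; apply: smooth_dir smooth_Lg (smooth_hframe i).
- by have /(smooth_mxP _ oO) := smooth_vpart sw; apply.
- by apply: smooth_christoffel => i; exact: smooth_derive smooth_Lg.
Qed.

Lemma adxE f k z : differentiable f z -> adx l k f z = 'D_(hframe l k z) f z.
Proof.
move=> df; rewrite hframeE diff_row_mx // /adx; congr (_ + _).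
  rewrite (bigD1 k) //= mxE !eqxx mul1r big1 ?addr0 // => i /negPf ik.
  by rewrite mxE ik andbF mul0r.
by rewrite -sumrN; apply: eq_bigr => r _; rewrite !mxE mulNr.
Qed.

Lemma LhatE i j k z : O z -> Lhat l i j k z = hsymbol l z k j i.
Proof.
move=> Oz; have dg := smooth_differentiable smooth_Lg Oz.
have E a b c : adx l a (fun w => Lg l w b c) z = ('D_(hframe l a z) (Lg l) z) b c.
  rewrite adxE; last exact: differentiable_entry.
  by rewrite derive_entry//; exact: diff_derivable.
rewrite mxE /Lhat; congr (_ * _); apply: eq_bigr => r _.
by rewrite !E.
Qed.

Lemma ChatE i j k z : O z -> Chat l i j k z = vsymbol l z k j i.
Proof.
move=> Oz; have dg := smooth_differentiable smooth_Lg Oz.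
have E a b c : dy a (fun w => Lg l w b c) z = ('D_(vframe a) (Lg l) z) b c.
  by rewrite derive_entry//; exact: diff_derivable.
rewrite mxE /Chat; congr (_ * _); apply: eq_bigr => r _.
by rewrite !E.
Qed.

Lemma derive_Lg_sym z w : O z -> ('D_w (Lg l) z)^T = 'D_w (Lg l) z.
Proof.
move=> Oz; have gD : is_derive z w (Lg l) ('D_w (Lg l) z).
  exact: smooth_is_derive smooth_Lg Oz.
rewrite -(is_derive_val (is_derive_trmx gD)); apply: near_eq_derive.
exact: (open_near oO Oz) Lg_sym.
Qed.

(** Both families of symbols are compatible with the metric, and the
    derivative in the direction [w] is a combination of those along the adapted
    frame. *)
Lemma conn_form_metric z w : O z ->
  conn_form l z w *m Lg l z + (conn_form l z w *m Lg l z)^T = 'D_w (Lg l) z.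
Proof.
move=> Oz; have dg := smooth_differentiable smooth_Lg Oz.
have symD v := derive_Lg_sym v Oz.
have gT := Lg_sym Oz; have gu := gU Oz.
have mS (c : 'I_n -> R) (G D : 'I_n -> 'M[R]_n) :
    (forall k, G k *m Lg l z + (G k *m Lg l z)^T = D k) ->
    (\sum_k c k *: G k) *m Lg l z + ((\sum_k c k *: G k) *m Lg l z)^T =
    \sum_k c k *: D k.
  move=> GD; rewrite mulmx_suml linear_sum -big_split; apply: eq_bigr => k _ /=.
  by rewrite -scalemxAl linearZ /= -scalerDr GD.
rewrite /conn_form mulmxDl linearD /= addrACA.
have Hh := mS (lsubmx w 0) (hsymbol l z) (fun k => 'D_(hframe l k z) (Lg l) z)
  (fun k => christoffel_metric k gu gT (fun i => symD (hframe l i z))).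
have Hv := mS (vpart l z w 0) (vsymbol l z) (fun k => 'D_(vframe k) (Lg l) z)
  (fun k => christoffel_metric k gu gT (fun i => symD (vframe i))).
transitivity (\sum_k lsubmx w 0 k *: 'D_(hframe l k z) (Lg l) z +
    \sum_k vpart l z w 0 k *: 'D_(vframe k) (Lg l) z).
  exact: (congr2 +%R Hh Hv).
rewrite [in RHS](frame_decomp l z w).
rewrite (diff_add_dir _ _ dg); congr (_ + _); exact/esym/diff_sum_dir.
Qed.

End OneChart.
End Coordinates.

(** * Induced coordinate changes on the tangent bundle *)

Section TangentMap.
Context {R : realType} {n : nat}.
Variables (U : set 'rV[R]_n) (phi : 'rV[R]_n -> 'rV[R]_n).
Hypotheses (oU : open U) (sphi : smooth_on U phi).
Implicit Types (x u v : 'rV[R]_n) (z w : 'rV[R]_(n + n)).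

Lemma diff_jacobian x u : 'd phi x u = u *m jacobian phi x.
Proof. by rewrite mul_rV_lin1. Qed.

Lemma derive_jacobian x u : U x -> 'D_u phi x = u *m jacobian phi x.
Proof.
by move=> Ux; rewrite deriveEjacobian//; exact: smooth_differentiable sphi Ux.
Qed.

Lemma smooth_jacobian : smooth_on U (jacobian phi).
Proof.
apply/smooth_mxP => // k a.
have /(smooth_mxP _ oU) /(_ 0 a) := smooth_derive (delta_mx 0 k) sphi.
by apply: eq_smooth => // x Ux; rewrite derive_jacobian // -rowE mxE.
Qed.

(** Both sides are the second derivative of [phi] at [x], evaluated on [u] and [v]. *)
Lemma jacobian_sym x u v : U x ->
  u *m 'D_v (jacobian phi) x = v *m 'D_u (jacobian phi) x.
Proof.
have rowD a b y : U y -> (a *m 'D_b (jacobian phi) y) = 'D_b ('D_a phi) y.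
  move=> Uy; have dJ := smooth_is_derive b smooth_jacobian Uy.
  have := is_derive_mulmx (is_derive_cst a y b) dJ; rewrite mul0mx add0r => /is_derive_val <-.
  apply: near_eq_derive; apply: (open_near oU Uy) => t Ut.
  by rewrite derive_jacobian.
move=> Ux; rewrite (rowD u v x Ux) (rowD v u x Ux); apply/rowP => i.
have ent a b : ('D_b ('D_a phi) x) 0 i = 'D_b ('D_a (fun y => phi y 0 i)) x.
  rewrite derive_entry; last exact: smooth_derivable (smooth_derive a sphi) Ux.
  apply: near_eq_derive; apply: (open_near oU Ux) => t Ut.
  by rewrite derive_entry//; exact: smooth_derivable sphi Ut.
have si : smooth_on U (fun y => phi y 0 i).
  by move: sphi => /(smooth_mxP _ oU); apply.
have C := derive_commute u v oU si Ux.
exact: (etrans (ent u v) (etrans C (esym (ent v u)))).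
Qed.

(** The change of the induced coordinates [(x, y)] when [x] changes by [phi]. *)
Definition tangent_map z : 'rV[R]_(n + n) :=
  row_mx (phi (lsubmx z)) ('d phi (lsubmx z) (rsubmx z)).

(** The two diagonal blocks of the Jacobian matrix of [tangent_map]. *)
Definition tjac z : 'M[R]_n := jacobian phi (lsubmx z).

(** The block of that matrix that maps the base part of a vector to the fibre. *)
Definition tjac2 z : 'M[R]_n := 'D_(rsubmx z) (jacobian phi) (lsubmx z).

Definition push z w : 'rV[R]_(n + n) :=
  row_mx (lsubmx w *m tjac z) (rsubmx w *m tjac z + lsubmx w *m tjac2 z).

Lemma tangent_mapE z :
  tangent_map z = row_mx (phi (lsubmx z)) (rsubmx z *m tjac z).
Proof. by rewrite /tangent_map diff_jacobian. Qed.

Lemma rsubmx_tangent_map z : rsubmx (tangent_map z) = rsubmx z *m tjac z.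
Proof. by rewrite tangent_mapE row_mxKr. Qed.

Lemma is_derive_base (m p : nat) (f : 'rV[R]_n -> 'M[R]_(m, p)) z w :
  differentiable f (lsubmx z) ->
  is_derive z w (fun z => f (lsubmx z)) ('D_(lsubmx w) f (lsubmx z)).
Proof.
move=> df; have dl := @differentiable_lsubmx R 1 n n z.
have -> : 'D_(lsubmx w) f (lsubmx z) = 'D_w (f \o lsubmx) z.
  rewrite (derive_comp w dl df); congr ('D_ _ f _).
  exact/esym/(is_derive_val (is_derive_lsubmx (is_derive_id z w))).
apply: DeriveDef => //; apply: diff_derivable.
exact: differentiable_comp.
Qed.

Lemma is_derive_tjac z w : U (lsubmx z) ->
  is_derive z w tjac ('D_(lsubmx w) (jacobian phi) (lsubmx z)).
Proof.
by move=> Uz; apply: is_derive_base; exact: smooth_differentiable smooth_jacobian Uz.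
Qed.

(** Differentiating [y *m jacobian phi x] in [x] gives the second derivative of
    [phi] on [y] and on the base part of [w]; its symmetry lets [tjac2], which
    depends on [z] only, act on [w]. *)
Lemma is_derive_tangent_map z w : U (lsubmx z) ->
  is_derive z w tangent_map (push z w).
Proof.
move=> Uz; have -> : tangent_map =
    (fun z => row_mx (phi (lsubmx z)) (rsubmx z *m tjac z)).
  by apply/funext => y; rewrite tangent_mapE.
apply: is_derive_row_mx.
  have := is_derive_base w (smooth_differentiable sphi Uz).
  by rewrite derive_jacobian.
have := is_derive_mulmx (is_derive_rsubmx (is_derive_id z w)) (is_derive_tjac w Uz).
by rewrite (jacobian_sym _ _ Uz).
Qed.

Lemma smooth_tangent_map (O : set 'rV[R]_(n + n)) : open O ->
  (forall z, O z -> U (lsubmx z)) -> smooth_on O tangent_map.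
Proof.
move=> oO OU; have sl := smooth_lsubmx oO (smooth_id O).
have sr := smooth_rsubmx oO (smooth_id O).
apply: (@eq_smooth _ _ _ _ (fun z => row_mx (phi (lsubmx z)) (rsubmx z *m tjac z))) => //.
  by move=> z _; rewrite tangent_mapE.
apply: smooth_row_mx => //; first exact: smooth_comp oO oU OU sphi sl.
apply: smooth_mulmx => //.
exact: smooth_comp oO oU OU smooth_jacobian sl.
Qed.

Lemma near_base z : U (lsubmx z) -> \forall y \near z, U (lsubmx y).
Proof.
move=> Uz; have := differentiable_continuous (@differentiable_lsubmx R 1 n n z).
by move=> /(_ U); apply; exact: open_nbhs_nbhs.
Qed.

Lemma is_derive_fiber_tjac2 z v : U (lsubmx z) ->
  is_derive z (row_mx 0 v) tjac2 ('D_v (jacobian phi) (lsubmx z)).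
Proof.
move=> Uz; pose e k : 'rV[R]_n := delta_mx 0 k.
pose f y := \sum_k rsubmx y 0 k *: 'D_(e k) (jacobian phi) (lsubmx y).
have rowE y u : U (lsubmx y) -> 'D_u (jacobian phi) (lsubmx y) =
    \sum_k u 0 k *: 'D_(e k) (jacobian phi) (lsubmx y).
  by move=> Uy; apply: derive_rowE; exact: smooth_differentiable smooth_jacobian Uy.
apply: (@near_eq_is_derive _ _ _ f).
  by apply: filterS (near_base Uz) => y Uy; rewrite /f /tjac2 rowE.
rewrite rowE //; apply: is_derive_fsum => k.
have dr : is_derive z (row_mx 0 v) (fun y => rsubmx y 0 k) (v 0 k).
  have := is_derive_entry 0 k (is_derive_rsubmx (is_derive_id z (row_mx 0 v))).
  by rewrite row_mxKr.
have dD := smooth_differentiable (smooth_derive (e k) smooth_jacobian) Uz.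
have := is_derive_scale dr (is_derive_base (row_mx 0 v) dD).
by rewrite row_mxKl derive0 scaler0 addr0.
Qed.

End TangentMap.

(** * Transformation laws of the spray, of N and of the symbols *)

Section FiberGradient.
Context {R : realType} {n : nat}.
Variables (O : set 'rV[R]_(n + n)) (l : 'rV[R]_(n + n) -> R).
Hypotheses (oO : open O) (sl : smooth_on O l).

Definition base_grad z : 'rV[R]_n := \row_j dx j l z.
Definition fiber_grad z : 'rV[R]_n := \row_j dy j l z.

Lemma smooth_fiber_grad : smooth_on O fiber_grad.
Proof.
apply/smooth_mxP => // a j; apply: (@eq_smooth _ _ _ _ (dy j l)) => // [z _|].
  by rewrite mxE.
exact: smooth_derive.
Qed.

Lemma derive_grad z u v : O z -> 'D_(row_mx u v) l z =
  \sum_k u 0 k * base_grad z 0 k + \sum_k v 0 k * fiber_grad z 0 k.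
Proof.
move=> Oz; rewrite diff_row_mx; last exact: smooth_differentiable sl Oz.
by congr (_ + _); apply: eq_bigr => k _; rewrite mxE.
Qed.

Lemma fiber_grad_entry z w j : O z ->
  ('D_w fiber_grad z) 0 j = 'D_w (dy j l) z.
Proof.
move=> Oz; rewrite derive_entry; last exact: smooth_derivable smooth_fiber_grad Oz.
have -> : (fun z => fiber_grad z 0 j) = dy j l by apply/funext => y; rewrite mxE.
by [].
Qed.

Lemma derive_fiber_grad z v : O z ->
  'D_(row_mx 0 v) fiber_grad z = 2 *: (v *m Lg l z).
Proof.
move=> Oz; apply/rowP => j; rewrite fiber_grad_entry//.
have dl := smooth_differentiable (smooth_derive (vframe j) sl) Oz.
rewrite (diff_row_mxr v dl) mxE [in RHS]mxE mulr_sumr; apply: eq_bigr => k _.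
by rewrite mxE; field.
Qed.

(** The components of the Euler-Lagrange covector, without acceleration. *)
Definition euler_lagrange z : 'rV[R]_n :=
  'D_(row_mx (rsubmx z) 0) fiber_grad z - base_grad z.

(** The inverse metric is cleared from the definition of the spray, and the mixed
    derivatives are exchanged so that [y^k \partial_k] acts on the fibre gradient. *)
Lemma spray_rowE z : O z -> Lg l z \in unitmx ->
  spray_row l z *m Lg l z = 4^-1 *: euler_lagrange z.
Proof.
move=> Oz gU.
suff -> : spray_row l z = 4^-1 *: (euler_lagrange z *m (invmx (Lg l z))^T).
  by rewrite trmx_inv (Lg_sym oO sl Oz) -scalemxAl mulmxKV.
have elE j : euler_lagrange z 0 j =
    \sum_k dy j (dx k l) z * z 0 (rshift n k) - dx j l z.
  have dl := smooth_differentiable (smooth_derive (vframe j) sl) Oz.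
  rewrite /euler_lagrange mxE fiber_grad_entry // (diff_row_mxl _ dl); congr (_ + _).
    apply: eq_bigr => k _; rewrite mulrC mxE.
    have C := derive_commute (vframe j) (row_mx (delta_mx 0 k) 0) oO sl Oz.
    exact: (congr1 (fun x => x * z 0 (rshift n k)) C).
  by rewrite mxE; congr (- _); rewrite mxE.
apply/rowP => i; rewrite mxE [RHS]mxE /spray mulrA.
have -> : 2^-1 * 2^-1 = 4^-1 :> R by field.
congr (_ * _); rewrite [RHS]mxE; apply: eq_bigr => j _.
by rewrite -elE mulrC; congr (_ * _); rewrite mxE.
Qed.

End FiberGradient.

Section LagrangianChange.
Context {R : realType} {n : nat}.
Variables (U : set 'rV[R]_n) (phi : 'rV[R]_n -> 'rV[R]_n).
Variables (O O' : set 'rV[R]_(n + n)) (l l' : 'rV[R]_(n + n) -> R).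
Hypotheses (oU : open U) (sphi : smooth_on U phi).
Hypotheses (oO : open O) (oO' : open O').
Hypotheses (sl : smooth_on O l) (sl' : smooth_on O' l').
Hypothesis OU : forall z, O z -> U (lsubmx z).
Hypothesis OO' : forall z, O z -> O' (tangent_map phi z).
Hypothesis lE : forall z, O z -> l z = l' (tangent_map phi z).
Hypothesis PU : forall z, O z -> tjac phi z \in unitmx.
Hypothesis g'U : forall z, O' z -> Lg l' z \in unitmx.
Implicit Types (z w : 'rV[R]_(n + n)).

Local Notation T := (tangent_map phi).
Local Notation P := (tjac phi).
Local Notation Q := (tjac2 phi).

Lemma differentiable_tangent_map z : O z -> differentiable T z.
Proof.
by move=> Oz; apply: smooth_differentiable (smooth_tangent_map oU sphi oO OU) Oz.
Qed.

Lemma is_derive_pull (W : normedModType R) (f : 'rV[R]_(n + n) -> W) z w : O z ->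
  differentiable f (T z) ->
  is_derive z w (fun z => f (T z)) ('D_(push phi z w) f (T z)).
Proof.
move=> Oz df; have dT := differentiable_tangent_map Oz.
apply: DeriveDef.
  by apply: diff_derivable; exact: differentiable_comp dT df.
rewrite (derive_comp w dT df); congr ('D_ _ f _).
exact/is_derive_val/(is_derive_tangent_map oU sphi _ (OU Oz)).
Qed.

Let derive_l z w : O z -> 'D_w l z = 'D_(push phi z w) l' (T z).
Proof.
move=> Oz; have dl' := smooth_differentiable sl' (OO' Oz).
apply: (etrans (near_eq_derive w (open_near oO Oz lE))).
exact: is_derive_val (is_derive_pull w Oz dl').
Qed.

Lemma push_row_mx z u v :
  push phi z (row_mx u v) = row_mx (u *m P z) (v *m P z + u *m Q z).
Proof. by rewrite /push row_mxKl row_mxKr. Qed.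

Lemma push_row_mxr z v : push phi z (row_mx 0 v) = row_mx 0 (v *m P z).
Proof. by rewrite push_row_mx !mul0mx addr0. Qed.

Lemma fiber_grad_change z : O z ->
  fiber_grad l z = fiber_grad l' (T z) *m (P z)^T.
Proof.
move=> Oz; apply/rowP => j; rewrite mxE {1}/dy derive_l // push_row_mxr.
rewrite (derive_grad sl' _ _ (OO' Oz)).
rewrite [X in X + _]big1 ?add0r => [|k _]; last by rewrite mxE mul0r.
rewrite [RHS]mxE; apply: eq_bigr => k _.
by rewrite -rowE mulrC; congr (_ * _); rewrite mxE [RHS]mxE.
Qed.

Lemma base_grad_change z : O z ->
  base_grad l z = base_grad l' (T z) *m (P z)^T + fiber_grad l' (T z) *m (Q z)^T.
Proof.
move=> Oz; apply/rowP => j; rewrite mxE {1}/dx derive_l // push_row_mx.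
rewrite mul0mx add0r (derive_grad sl' _ _ (OO' Oz)) -!rowE [RHS]mxE.
by congr (_ + _); rewrite [RHS]mxE; apply: eq_bigr => k _; rewrite mulrC;
  congr (_ * _); rewrite mxE [RHS]mxE.
Qed.

Let derive_fiber_grad_change z w : O z -> 'D_w (fiber_grad l) z =
  'D_(push phi z w) (fiber_grad l') (T z) *m (P z)^T +
  fiber_grad l' (T z) *m ('D_(lsubmx w) (jacobian phi) (lsubmx z))^T.
Proof.
move=> Oz; have dg' := smooth_differentiable (smooth_fiber_grad oO' sl') (OO' Oz).
have dP := is_derive_trmx (is_derive_tjac oU sphi w (OU Oz)).
rewrite -(is_derive_val (is_derive_mulmx (is_derive_pull w Oz dg') dP)).
exact: near_eq_derive (open_near oO Oz fiber_grad_change).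
Qed.

(** [tjac] is constant along the fibres, so the fibre Hessian is tensorial. *)
Lemma Lg_change z : O z -> Lg l z = P z *m Lg l' (T z) *m (P z)^T.
Proof.
move=> Oz; have two : (2 : R) != 0 by rewrite pnatr_eq0.
apply: (scalerI two); apply/row_matrixP => i.
have H v : 'D_(row_mx 0 v) (fiber_grad l) z =
    2 *: (v *m P z *m Lg l' (T z)) *m (P z)^T.
  rewrite derive_fiber_grad_change // push_row_mxr row_mxKl derive0.
  by rewrite trmx0 mulmx0 addr0 (derive_fiber_grad oO' sl' _ (OO' Oz)).
have := H (delta_mx 0 i); rewrite (derive_fiber_grad oO sl _ Oz) => E.
by rewrite !rowE -!scalemxAr E -!scalemxAl !mulmxA.
Qed.

Lemma Lg_unit z : O z -> Lg l z \in unitmx.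
Proof.
by move=> Oz; rewrite Lg_change // !unitmx_mul unitmx_tr PU // g'U //; exact: OO'.
Qed.

(** The fibre gradient enters both terms of [euler_lagrange] through [tjac2], with
    opposite signs. What survives is the second derivative of [phi] on [(y, y)],
    contracted with twice the metric. *)
Lemma euler_lagrange_change z : O z -> euler_lagrange l z =
  (euler_lagrange l' (T z) + 2 *: (rsubmx z *m Q z *m Lg l' (T z))) *m (P z)^T.
Proof.
move=> Oz; have dg' := smooth_differentiable (smooth_fiber_grad oO' sl') (OO' Oz).
rewrite /euler_lagrange derive_fiber_grad_change // base_grad_change //.
rewrite push_row_mx mul0mx add0r row_mxKl -/(Q z) rsubmx_tangent_map opprD.
rewrite addrACA subrr addr0 -mulmxBl; congr (_ *m _).
have -> : row_mx (rsubmx z *m P z) (rsubmx z *m Q z) =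
    row_mx (rsubmx z *m P z) 0 + row_mx 0 (rsubmx z *m Q z).
  by rewrite add_row_mx addr0 add0r.
rewrite diff_add_dir // (derive_fiber_grad oO' sl' _ (OO' Oz)).
by rewrite addrAC.
Qed.

Lemma spray_change z : O z ->
  spray_row l z *m P z = spray_row l' (T z) + 2^-1 *: (rsubmx z *m Q z).
Proof.
move=> Oz; have g'u := g'U (OO' Oz).
have PTu : (P z)^T \in unitmx by rewrite unitmx_tr PU.
apply: (can_inj (mulmxK g'u)).
transitivity (4^-1 *: (euler_lagrange l' (T z) + 2 *: (rsubmx z *m Q z *m Lg l' (T z)))).
  apply: (can_inj (mulmxK PTu)); rewrite -scalemxAl -euler_lagrange_change //.
  by rewrite -(spray_rowE oO sl Oz (Lg_unit Oz)) Lg_change // !mulmxA.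
rewrite mulmxDl (spray_rowE oO' sl' (OO' Oz) g'u) scalerDr -scalemxAl scalerA.
by congr (_ + _ *: _); field.
Qed.

(** The defect in [spray_change] is half a quadratic form in [y], whose derivative
    along the fibre is [tjac2]. This is exactly what makes the adapted frames
    correspond. *)
Lemma Nmx_change z : O z -> Nmx l z *m P z = P z *m Nmx l' (T z) + Q z.
Proof.
move=> Oz; apply/row_matrixP => k; set v : 'rV[R]_n := delta_mx 0 k.
have dG := smooth_is_derive (vframe k) (smooth_spray_row oO sl Lg_unit) Oz.
have dP : is_derive z (vframe k) P 0.
  have := is_derive_tjac oU sphi (vframe k) (OU Oz).
  by rewrite row_mxKl derive0.
have dG' := smooth_differentiable (smooth_spray_row oO' sl' g'U) (OO' Oz).
have dy : is_derive z (vframe k) (fun y => rsubmx y) v.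
  have := is_derive_rsubmx (is_derive_id z (vframe k)).
  by rewrite row_mxKr.
have dQ : is_derive z (vframe k) Q ('D_v (jacobian phi) (lsubmx z)).
  exact: is_derive_fiber_tjac2 oU sphi _ _ (OU Oz).
have lhs := is_derive_mulmx dG dP.
have h2 : is_derive z (vframe k) (fun y => 2^-1 *: (rsubmx y *m Q y))
    (2^-1 *: (v *m Q z + rsubmx z *m 'D_v (jacobian phi) (lsubmx z))).
  exact: is_deriveZ (is_derive_mulmx dy dQ).
have rhs := is_deriveD (is_derive_pull (vframe k) Oz dG') h2.
have := near_eq_derive (vframe k) (open_near oO Oz spray_change).
rewrite (is_derive_val lhs) (is_derive_val rhs) mulmx0 addr0.
rewrite -(Nmx_rowE oO sl Lg_unit k Oz) -row_mul => ->.
have -> : v *m Q z + rsubmx z *m 'D_v (jacobian phi) (lsubmx z) = 2 *: (v *m Q z).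
  by rewrite (jacobian_sym oU sphi _ _ (OU Oz)) scaler_nat mulr2n.
rewrite scalerA mulVf ?pnatr_eq0 // scale1r linearD /= rowE -/v [in RHS]rowE -/v.
congr (_ + _); rewrite push_row_mxr.
have -> : row_mx 0 (v *m P z) = \sum_c (v *m P z) 0 c *: vframe c.
  rewrite [LHS]row_mx_sum [X in X + _]big1 ?add0r // => c _.
  by rewrite mxE scale0r.
rewrite diff_sum_dir // mulmxA [RHS]mulmx_sum_row; apply: eq_bigr => c _.
by rewrite (Nmx_rowE oO' sl' g'U c (OO' Oz)).
Qed.

(** The term of [push] in [tjac2] is absorbed by the one of [Nmx_change]. *)
Lemma vpart_change z w : O z ->
  vpart l' (T z) (push phi z w) = vpart l z w *m P z.
Proof.
move=> Oz; rewrite /vpart /push row_mxKl row_mxKr mulmxDl.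
by rewrite -(mulmxA _ (Nmx l z)) Nmx_change // mulmxDr mulmxA addrAC addrA.
Qed.

Lemma push_hframe z k : O z ->
  push phi z (hframe l k z) = \sum_c P z k c *: hframe l' c (T z).
Proof.
move=> Oz; rewrite [LHS](frame_decomp l' (T z)) vpart_change // vpart_hframe mul0mx.
rewrite [X in _ + X]big1 ?addr0 => [|c _]; last by rewrite mxE scale0r.
apply: eq_bigr => c _; congr (_ *: _).
by rewrite /push row_mxKl hframeE row_mxKl -rowE mxE.
Qed.

Lemma push_vframe z k : push phi z (vframe k) = \sum_c P z k c *: vframe c.
Proof.
rewrite push_row_mxr row_mx_sum [X in X + _]big1 ?add0r => [|c _].
  by apply: eq_bigr => c _; rewrite -rowE mxE.
by rewrite mxE scale0r.
Qed.

Let derive_Lg_change z w (e : 'I_n -> 'rV[R]_(n + n)) c0 : O z ->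
  push phi z w = \sum_c P z c0 c *: e c ->
  let B := 'D_(lsubmx w) (jacobian phi) (lsubmx z) in
  'D_w (Lg l) z = B *m Lg l' (T z) *m (P z)^T +
    P z *m (\sum_c P z c0 c *: 'D_(e c) (Lg l') (T z)) *m (P z)^T +
    P z *m Lg l' (T z) *m B^T.
Proof.
move=> Oz pw B; have dg' := smooth_differentiable (smooth_Lg oO' sl') (OO' Oz).
have dP := is_derive_tjac oU sphi w (OU Oz).
have D := is_derive_mulmx (is_derive_mulmx dP (is_derive_pull w Oz dg'))
  (is_derive_trmx dP).
apply: (etrans (near_eq_derive w (open_near oO Oz Lg_change))).
apply: (etrans (is_derive_val D)).
by rewrite pw (diff_sum_dir _ _ dg') -/B mulmxDl.
Qed.

(** By [push_hframe], differentiating [Lg_change] along the horizontal frame gives the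
    hypothesis of [christoffel_change], the inhomogeneous term being a second
    derivative of [phi]. *)
Lemma hsymbol_change z k : O z ->
  'D_(delta_mx 0 k) (jacobian phi) (lsubmx z) +
    P z *m (\sum_c P z k c *: hsymbol l' (T z) c) = hsymbol l z k *m P z.
Proof.
move=> Oz; have O'z := OO' Oz.
pose B k : 'M[R]_n := 'D_(delta_mx 0 k) (jacobian phi) (lsubmx z).
have := @christoffel_change _ _ (Lg l z) (Lg l' (T z)) (P z)
  (fun k => 'D_(hframe l k z) (Lg l) z)
  (fun c => 'D_(hframe l' c (T z)) (Lg l') (T z)) B
  (Lg_change Oz) (PU Oz) (g'U O'z) (Lg_sym oO' sl' O'z).
apply.
- move=> c; exact: derive_Lg_sym oO' sl' _ _ O'z.
- move=> i j a; have rE (A : 'M[R]_n) b : (delta_mx 0 b *m A : 'rV_n) 0 a = A b a.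
    by rewrite -rowE mxE.
  have E := congr1 (fun M : 'rV[R]_n => M 0 a)
    (jacobian_sym oU sphi (delta_mx 0 j) (delta_mx 0 i) (OU Oz)).
  exact: (etrans (esym (rE _ j)) (etrans E (rE _ i))).
- move=> i; have := derive_Lg_change Oz (push_hframe i Oz).
  by rewrite /= hframeE row_mxKl.
Qed.

(** Along the fibres [tjac] is constant, so there is no inhomogeneous term. *)
Lemma vsymbol_change z k : O z ->
  P z *m (\sum_c P z k c *: vsymbol l' (T z) c) = vsymbol l z k *m P z.
Proof.
move=> Oz; have O'z := OO' Oz.
have := @christoffel_change _ _ (Lg l z) (Lg l' (T z)) (P z)
  (fun k => 'D_(vframe k) (Lg l) z)
  (fun c => 'D_(vframe c) (Lg l') (T z)) (fun _ => 0)
  (Lg_change Oz) (PU Oz) (g'U O'z) (Lg_sym oO' sl' O'z).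
move=> H; rewrite -[LHS]add0r; apply: H => //.
- move=> c; exact: derive_Lg_sym oO' sl' _ _ O'z.
- by move=> i j a; rewrite !mxE.
- move=> i; apply: (etrans (derive_Lg_change Oz (push_vframe z i))).
  by rewrite /= row_mxKl derive0.
Qed.

Lemma conn_form_change z w : O z ->
  'D_(lsubmx w) (jacobian phi) (lsubmx z) +
    P z *m conn_form l' (T z) (push phi z w) = conn_form l z w *m P z.
Proof.
move=> Oz; rewrite /conn_form vpart_change //.
have -> : lsubmx (push phi z w) = lsubmx w *m P z by rewrite row_mxKl.
have comb (u : 'rV[R]_n) (G : 'I_n -> 'M[R]_n) : P z *m (\sum_c (u *m P z) 0 c *: G c) =
    \sum_k u 0 k *: (P z *m \sum_c P z k c *: G c).
  rewrite mulmx_sumr; under [RHS]eq_bigr do rewrite mulmx_sumr scaler_sumr.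
  rewrite exchange_big /=; apply: eq_bigr => c _.
  rewrite -scalemxAr mxE scaler_suml; apply: eq_bigr => k _.
  by rewrite -scalemxAr scalerA.
have dJ := smooth_differentiable (smooth_jacobian oU sphi) (OU Oz).
have H1 := comb (lsubmx w) (hsymbol l' (T z)).
have H2 := comb (vpart l z w) (vsymbol l' (T z)).
have K1 : 'D_(lsubmx w) (jacobian phi) (lsubmx z) +
    \sum_k lsubmx w 0 k *: (P z *m \sum_c P z k c *: hsymbol l' (T z) c) =
    (\sum_k lsubmx w 0 k *: hsymbol l z k) *m P z.
  rewrite derive_rowE // -big_split mulmx_suml; apply: eq_bigr => k _ /=.
  by rewrite -scalerDr hsymbol_change // -scalemxAl.
have K2 : \sum_k vpart l z w 0 k *: (P z *m \sum_c P z k c *: vsymbol l' (T z) c) =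
    (\sum_k vpart l z w 0 k *: vsymbol l z k) *m P z.
  rewrite mulmx_suml; apply: eq_bigr => k _.
  by rewrite vsymbol_change // -scalemxAl.
apply: (etrans (congr1 (+%R _) (etrans (mulmxDr _ _ _) (congr2 +%R H1 H2)))).
exact: (etrans (addrA _ _ _) (etrans (congr2 +%R K1 K2) (esym (mulmxDl _ _ _)))).
Qed.

End LagrangianChange.

(** * Charts, vector fields and open sets of a manifold *)

Section Manifold.
Context {R : realType} {m : nat} (A : atlas R m).
Hypothesis mA : smooth_manifold A.
Implicit Types (i j k : idx A) (p q : pt A) (O : set (pt A)) (x v : 'rV[R]_m).

Definition transition i j : 'rV[R]_m -> 'rV[R]_m := chart A j \o inv A i.
Definition overlap i j : set 'rV[R]_m := chart A i @` (dom A i `&` dom A j).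
Definition image i O : set 'rV[R]_m := chart A i @` (O `&` dom A i).

Definition coords i (X : vfield A) : 'rV[R]_m -> 'rV[R]_m :=
  fun x => tcoord (inv A i x) i (X (inv A i x)).

Lemma invK i p : dom A i p -> inv A i (chart A i p) = p.
Proof. exact: chartK. Qed.

Lemma dom_chart_at p : pts A p -> dom A (chart_at A p) p.
Proof. exact: chart_atP. Qed.

Lemma dom_sub_pts i p : dom A i p -> pts A p.
Proof. exact: dom_pts. Qed.

Lemma transitionE i j p : dom A i p -> transition i j (chart A i p) = chart A j p.
Proof. by move=> ip; rewrite /transition /= invK. Qed.

Lemma overlap_chart i j p : dom A i p -> dom A j p -> overlap i j (chart A i p).
Proof. by exists p. Qed.

Lemma open_overlap i j : open (overlap i j).
Proof. exact: overlap_open. Qed.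

Lemma smooth_transition i j : smooth_on (overlap i j) (transition i j).
Proof. exact: transition_smooth. Qed.

Lemma differentiable_transition i j p : dom A i p -> dom A j p ->
  differentiable (transition i j) (chart A i p).
Proof.
move=> ip jp; apply: smooth_differentiable (smooth_transition i j) _.
exact: overlap_chart.
Qed.

Lemma transition_comp_near i j k p : dom A i p -> dom A j p -> dom A k p ->
  \forall x \near chart A i p,
    transition j k (transition i j x) = transition i k x.
Proof.
move=> ip jp kp. apply: (open_near (@open_overlap i j)); first exact: overlap_chart.
by move=> _ [q [iq jq] <-]; rewrite /= !transitionE.
Qed.

Lemma diff_transition_comp i j k p v : dom A i p -> dom A j p -> dom A k p ->
  'd (transition j k) (chart A j p) ('d (transition i j) (chart A i p) v) =
  'd (transition i k) (chart A i p) v.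
Proof.
move=> ip jp kp; have dij := differentiable_transition ip jp.
have djk := differentiable_transition jp kp.
exact: (esym (chain_rule v (transitionE j ip) dij djk (transition_comp_near ip jp kp))).
Qed.

Lemma diff_transition_id i p v : dom A i p ->
  'd (transition i i) (chart A i p) v = v.
Proof.
move=> ip; have idn : \forall x \near chart A i p, id x = transition i i x.
  apply: (open_near (@open_overlap i i)); first exact: overlap_chart.
  by move=> _ [q [iq _] <-]; rewrite transitionE.
by rewrite (near_eq_diff idn) // diff_val.
Qed.

Lemma tcoordE p i v :
  tcoord p i v = 'd (transition (chart_at A p) i) (chart A (chart_at A p) p) v.
Proof. by []. Qed.

Lemma tvecE p i v :
  tvec p i v = 'd (transition i (chart_at A p)) (chart A i p) v.
Proof. by []. Qed.

Lemma tcoordK p i v : dom A i p -> tvec p i (tcoord p i v) = v.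
Proof.
move=> ip; have cp := dom_chart_at (dom_sub_pts ip).
by rewrite tcoordE tvecE diff_transition_comp // diff_transition_id.
Qed.

Lemma tvecK p i v : dom A i p -> tcoord p i (tvec p i v) = v.
Proof.
move=> ip; have cp := dom_chart_at (dom_sub_pts ip).
by rewrite tcoordE tvecE diff_transition_comp // diff_transition_id.
Qed.

Lemma tcoord_change p i j v : dom A i p -> dom A j p ->
  tcoord p j v = 'd (transition i j) (chart A i p) (tcoord p i v).
Proof.
move=> ip jp; have cp := dom_chart_at (dom_sub_pts ip).
exact: (esym (diff_transition_comp v cp ip jp)).
Qed.

Lemma tvec_change p i j v : dom A i p -> dom A j p ->
  tcoord p j (tvec p i v) = 'd (transition i j) (chart A i p) v.
Proof.
move=> ip jp.
exact: (etrans (tcoord_change _ ip jp) (congr1 ('d _ _) (tvecK v ip))).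
Qed.

Lemma tcoord_inj p i u v : dom A i p -> tcoord p i u = tcoord p i v -> u = v.
Proof. by move=> ip E; rewrite -(tcoordK u ip) E tcoordK. Qed.

Lemma tcoord_linear p i a u v :
  tcoord p i (a *: u + v) = a *: tcoord p i u + tcoord p i v.
Proof. by rewrite !tcoordE linearP. Qed.

Lemma tcoord0 p i : tcoord p i 0 = 0.
Proof. by rewrite tcoordE linear0. Qed.

Lemma tcoordD p i u v : tcoord p i (u + v) = tcoord p i u + tcoord p i v.
Proof. by rewrite !tcoordE linearD. Qed.

Lemma tcoordZ p i a v : tcoord p i (a *: v) = a *: tcoord p i v.
Proof. by rewrite !tcoordE linearZ. Qed.

Lemma tcoord_sum p i (I : Type) (s : seq I) (F : I -> 'rV[R]_m) :
  tcoord p i (\sum_(a <- s) F a) = \sum_(a <- s) tcoord p i (F a).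
Proof. by rewrite tcoordE linear_sum. Qed.

Lemma tvec_linear p i a u v :
  tvec p i (a *: u + v) = a *: tvec p i u + tvec p i v.
Proof. by rewrite !tvecE linearP. Qed.

Lemma jacobian_transitionK i j p : dom A i p -> dom A j p ->
  jacobian (transition i j) (chart A i p) *m jacobian (transition j i) (chart A j p)
  = 1%:M.
Proof.
move=> ip jp; apply/row_matrixP => a; rewrite row1 rowE mulmxA.
have E := diff_transition_comp (delta_mx 0 a) ip jp ip.
have J1 := diff_jacobian (transition i j) (chart A i p) (delta_mx 0 a).
have J2 u := diff_jacobian (transition j i) (chart A j p) u.
apply: (etrans (congr1 (fun u => u *m _) (esym J1))).
exact: (etrans (esym (J2 _)) (etrans E (diff_transition_id _ ip))).
Qed.

Lemma jacobian_transition_unit i j p : dom A i p -> dom A j p ->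
  jacobian (transition i j) (chart A i p) \in unitmx.
Proof.
by move=> ip jp; exact: (proj1 (mulmx1_unit (jacobian_transitionK ip jp))).
Qed.

Lemma imageP i O p : O p -> dom A i p -> image i O (chart A i p).
Proof. by exists p. Qed.

Lemma open_image i O : mopen O -> open (image i O).
Proof. by case=> _; apply. Qed.

Lemma image_inv i O x : image i O x ->
  [/\ O (inv A i x), dom A i (inv A i x) & chart A i (inv A i x) = x].
Proof. by case=> p [Op ip] <-; rewrite invK. Qed.

Lemma mopen_dom i : mopen (dom A i).
Proof. by split=> [|j]; [exact: dom_pts|rewrite setIC; exact: open_overlap]. Qed.

Lemma mopenI O O' : mopen O -> mopen O' -> mopen (O `&` O').
Proof.
move=> [Os oO] [_ oO']; split=> [p [Op _]|i]; first exact: Os.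
suff -> : chart A i @` (O `&` O' `&` dom A i) = image i O `&` image i O'.
  by apply: openI; [exact: oO|exact: oO'].
apply/seteqP; split=> [_ [p [[Op Op'] ip] <-]|x [Ox Ox']].
  by split; exists p.
have [Oq iq qx] := image_inv Ox; have [Oq' _ _] := image_inv Ox'.
by exists (inv A i x).
Qed.

Lemma smooth_fun_chart i O (f : pt A -> R) : mopen O -> O `<=` dom A i ->
  smooth_on (image i O) (f \o inv A i) -> smooth_fun O f.
Proof.
move=> oO Oi sf j; rewrite -/(image j O).
have oj : open (image j O) by exact: open_image.
have sub : image j O `<=` overlap j i.
  by move=> _ [q [Oq jq] <-]; apply: overlap_chart => //; exact: Oi.
have st : smooth_on (image j O) (transition j i).
  exact: sub_smooth sub (smooth_transition j i).
have maps x : image j O x -> image i O (transition j i x).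
  by case=> q [Oq jq] <-; rewrite transitionE //; apply: imageP => //; exact: Oi.
apply: eq_smooth (smooth_scalar_comp oj maps sf st) => // _ [q [Oq jq] <-] /=.
by rewrite transitionE // !invK //; exact: Oi.
Qed.

(** Smoothness in one chart containing [O] passes to every other chart through the
    transition map and its Jacobian matrix. *)
Lemma smooth_vf_chart i O (X : vfield A) : mopen O -> O `<=` dom A i ->
  smooth_on (image i O) (coords i X) -> smooth_vf O X.
Proof.
move=> oO Oi sX j; have oj : open (image j O) by exact: open_image.
have oi : open (image i O) by exact: open_image.
rewrite -/(image j O).
have sub : image j O `<=` overlap j i.
  by move=> _ [q [Oq jq] <-]; apply: overlap_chart => //; exact: Oi.
have st : smooth_on (image j O) (transition j i).
  exact: sub_smooth sub (smooth_transition j i).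
have maps x : image j O x -> image i O (transition j i x).
  by case=> q [Oq jq] <-; rewrite transitionE //; apply: imageP => //; exact: Oi.
have maps' x : image j O x -> overlap i j (transition j i x).
  by case=> q [Oq jq] <-; rewrite transitionE //; apply: overlap_chart => //; exact: Oi.
have sJ := smooth_jacobian (@open_overlap i j) (smooth_transition i j).
have := smooth_mulmx oj (smooth_comp oj oi maps sX st)
  (smooth_comp oj (@open_overlap i j) maps' sJ st).
apply: eq_smooth => // _ [q [Oq jq] <-] /=; have iq := Oi q Oq.
by rewrite /coords transitionE // !invK // -diff_jacobian -tcoord_change.
Qed.

Lemma sub_smooth_vf O O' X : O' `<=` O -> smooth_vf O X -> smooth_vf O' X.
Proof.
move=> OO' sX i; apply: sub_smooth (sX i) => _ [q [/OO' Oq iq] <-].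
by exists q.
Qed.

Lemma coordsE i X p : dom A i p -> coords i X (chart A i p) = tcoord p i (X p).
Proof. by move=> ip; rewrite /coords invK. Qed.

Lemma smooth_vfD O X Y : mopen O -> smooth_vf O X -> smooth_vf O Y ->
  smooth_vf O (fun p => X p + Y p).
Proof.
move=> oO sX sY i; rewrite -/(image i O).
have oi : open (image i O) by exact: open_image.
by apply: eq_smooth (smoothD oi (sX i) (sY i)) => // x _; rewrite tcoordD.
Qed.

Lemma smooth_vfZ O (f : pt A -> R) X : mopen O -> smooth_fun O f -> smooth_vf O X ->
  smooth_vf O (fun p => f p *: X p).
Proof.
move=> oO sf sX i; rewrite -/(image i O).
have oi : open (image i O) by exact: open_image.
apply/smooth_mxP => // a b; have /(smooth_mxP _ oi) /(_ a b) sXab := sX i.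
apply: eq_smooth (smoothM oi (sf i) sXab) => // x _.
by rewrite tcoordZ mxE.
Qed.

Lemma smooth_vf_sum O (I : Type) (s : seq I) (F : I -> vfield A) : mopen O ->
  (forall a, smooth_vf O (F a)) -> smooth_vf O (fun p => \sum_(a <- s) F a p).
Proof.
move=> oO sF i; rewrite -/(image i O).
have oi : open (image i O) by exact: open_image.
apply: (eq_smooth oi _ (smooth_sum s oi (fun a => sF a i))) => x _.
by rewrite tcoord_sum.
Qed.

Lemma dirder_chart p i v (f : pt A -> R) : dom A i p ->
  differentiable (f \o inv A i) (chart A i p) ->
  dirder p v f = 'D_(tcoord p i v) (f \o inv A i) (chart A i p).
Proof.
move=> ip df; set c := chart_at A p.
have cp : dom A c p := dom_chart_at (dom_sub_pts ip).
have dci := differentiable_transition cp ip.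
have near_eq : \forall x \near chart A c p,
    (f \o inv A i) (transition c i x) = (f \o inv A c) x.
  apply: (open_near (@open_overlap c i)); first exact: overlap_chart.
  by move=> _ [q [cq iq] <-]; rewrite /= !invK.
rewrite (deriveE _ df).
exact: (chain_rule v (transitionE i cp) dci df near_eq).
Qed.

Lemma velocity_chart (J : set R) (c : R -> pt A) (t : R) i :
  smooth_curve J c -> J t -> dom A i (c t) ->
  derivable (chart A i \o c) t 1 /\
  tcoord (c t) i (velocity c t) = 'D_1 (chart A i \o c) t.
Proof.
move=> [Jc sc] Jt it; set a := chart_at A (c t).
have at_ : dom A a (c t) := dom_chart_at (Jc t Jt).
have [oi si] := sc i; have [oa sa] := sc a.
have da : differentiable (chart A a \o c) t by apply: smooth_differentiable sa _.
have di : differentiable (chart A i \o c) t by apply: smooth_differentiable si _.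
split; first exact: diff_derivable.
have dT := differentiable_transition at_ it.
have near_eq : \forall s \near t,
    transition a i ((chart A a \o c) s) = (chart A i \o c) s.
  by apply: (open_near oa) => // s [_ as_]; exact: transitionE.
rewrite /velocity tcoordE (deriveE _ di) (deriveE _ da).
exact: (esym (chain_rule (1 : R) erefl da dT near_eq)).
Qed.

End Manifold.

(** * The slit tangent bundle *)

Section SlitTangentBundle.
Context {R : realType} {n : nat} (M : atlas R n).
Hypothesis mM : smooth_manifold M.
Implicit Types (i j k : idx M) (p q : pt M) (z w : 'rV[R]_(n + n)).

Local Notation S := (slitTM M).

Lemma slit_chartK i (u : pt S) : dom M i u.1 -> inv S i (chart S i u) = u.
Proof.
case: u => p y /= ip; rewrite /= row_mxKl row_mxKr (invK mM ip).
by rewrite (tcoordK mM _ ip).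
Qed.

Lemma slit_transitionE i j z : overlap i j (lsubmx z) ->
  transition (A := S) i j z = tangent_map (transition (A := M) i j) z.
Proof.
case=> p [ip jp] pz; rewrite /tangent_map -pz.
have E : inv M i (lsubmx z) = p by rewrite -pz (invK mM ip).
rewrite /transition /= E; congr row_mx; first by rewrite (invK mM ip).
exact: tvec_change.
Qed.

Lemma slit_image i (B : set (pt M)) :
  chart S i @` ([set u | B u.1 /\ u.2 != 0] `&` dom S i) =
  [set z | image i B (lsubmx z) /\ rsubmx z != 0].
Proof.
apply/seteqP; split=> [_ [[p y] [[/= Bp y0] [/= ip _]] <-]|z [[p [Bp ip] pz] z0]] /=.
  rewrite row_mxKl row_mxKr; split; first by exists p.
  by apply: contra y0 => /eqP t0; apply/eqP; apply: (tcoord_inj mM ip); rewrite t0 tcoord0.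
have K := tvecK mM (rsubmx z) ip.
have t0 : tvec p i (rsubmx z) != 0.
  by apply: contra z0 => /eqP t0; rewrite -K t0 tcoord0.
exists (p, tvec p i (rsubmx z)) => //=.
by rewrite K pz hsubmxK.
Qed.

Lemma slit_overlap i j :
  overlap (A := S) i j = [set z | overlap i j (lsubmx z) /\ rsubmx z != 0].
Proof.
rewrite /overlap -[RHS](_ : chart S i @` (dom S j `&` dom S i) = _).
  by rewrite setIC.
by rewrite [LHS](slit_image i (dom M j)) /image setIC.
Qed.

Lemma open_slit (W : set 'rV[R]_n) : open W ->
  open [set z : 'rV[R]_(n + n) | W (lsubmx z) /\ rsubmx z != 0].
Proof.
move=> oW; have -> : [set z : 'rV[R]_(n + n) | W (lsubmx z) /\ rsubmx z != 0] =
    (lsubmx @^-1` W) `&` (rsubmx @^-1` (~` [set 0])).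
  by apply/seteqP; split=> z [Wz z0]; split=> //=; apply/eqP.
apply: openI.
  apply: open_comp => // z _.
  exact: differentiable_continuous (@differentiable_lsubmx R 1 n n z).
apply: open_comp.
  by move=> z _; exact: differentiable_continuous (@differentiable_rsubmx R 1 n n z).
apply: closed_openC; apply: accessible_closed_set1.
exact: hausdorff_accessible (@norm_hausdorff _ _).
Qed.

Lemma open_slit_overlap i j : open (overlap (A := S) i j).
Proof. by rewrite slit_overlap; apply: open_slit; exact: open_overlap. Qed.

Lemma smooth_tangent_transition i j :
  smooth_on (overlap (A := S) i j) (tangent_map (transition (A := M) i j)).
Proof.
apply: smooth_tangent_map (@open_overlap _ _ _ mM i j) (@smooth_transition _ _ _ mM i j) _ _ _.
  exact: open_slit_overlap.
by move=> z; rewrite slit_overlap => -[].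
Qed.

Lemma slit_mopen (B : set (pt M)) : mopen B ->
  mopen (A := S) [set u | B u.1 /\ u.2 != 0].
Proof.
move=> [Bs oB]; split=> [u [/Bs Bu u0]//|i].
by rewrite slit_image; apply: open_slit; exact: oB.
Qed.

(** These sets separate two tangent vectors at the same point. *)
Lemma slit_mopen_fiber i (W : set 'rV[R]_n) : open W ->
  mopen (A := S) [set u | dom S i u /\ W (tcoord u.1 i u.2)].
Proof.
move=> oW; split=> [u [[iu u0] _]|j].
  by split=> //; exact: (dom_sub_pts mM iu).
suff -> : chart S j @` ([set u | dom S i u /\ W (tcoord u.1 i u.2)] `&` dom S j) =
    overlap (A := S) j i `&`
    (fun z => rsubmx (tangent_map (transition (A := M) j i) z)) @^-1` W.
  apply: open_preimage_on oW; first exact: open_slit_overlap.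
  move=> z; apply: smooth_continuous; apply: smooth_rsubmx.
    exact: open_slit_overlap.
  exact: smooth_tangent_transition.
have key (u : pt S) : dom S i u -> dom S j u ->
    rsubmx (tangent_map (transition (A := M) j i) (chart S j u)) = tcoord u.1 i u.2.
  move=> [iu _] [ju _]; rewrite -slit_transitionE; last first.
    by rewrite row_mxKl; exact: overlap_chart.
  by rewrite /transition /comp slit_chartK // row_mxKr.
apply/seteqP; split=> [_ [u [[iu Wu] ju] <-]|_ [[u [ju iu] <-]]].
  by split; [exists u|rewrite /= key].
by rewrite /= key // => Wu; exists u.
Qed.

Lemma slit_manifold : smooth_manifold S.
Proof.
split.
- by move=> i u [iu u0]; split=> //; exact: (dom_sub_pts mM iu).
- by move=> u [pu u0]; split=> //; exact: (dom_chart_at mM).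
- by move=> i u [iu _]; exact: slit_chartK.
- exact: open_slit_overlap.
- move=> i j; apply: eq_smooth (@smooth_tangent_transition i j).
    exact: open_slit_overlap.
  by move=> z; rewrite slit_overlap => -[ijz _]; rewrite -slit_transitionE.
- move=> [p y] [p' y'] [/= pp y0] [/= pp' y0'] neq.
  have [E|pN] := pselect (p = p'); last first.
    have [B [B' [oB oB' Bp Bp' BB]]] := manifold_hausdorff mM pp pp' pN.
    exists [set u | B u.1 /\ u.2 != 0], [set u | B' u.1 /\ u.2 != 0].
    split=> //; [exact: slit_mopen|exact: slit_mopen|].
    apply/seteqP; split=> // u [[Bu _] [B'u _]].
    by have : (B `&` B') u.1 by []; rewrite BB.
  subst p'; pose i := chart_at M p; have ip : dom M i p by exact: (dom_chart_at mM).
  have tN : tcoord p i y != tcoord p i y'.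
    by apply/eqP => /(tcoord_inj mM ip) E; apply: neq; rewrite E.
  have := @norm_hausdorff R 'rV[R]_n; rewrite open_hausdorff => /(_ _ _ tN).
  move=> [[W W'] /= [/set_mem Wy /set_mem Wy'] [oW oW' /eqP WW]].
  exists [set u | dom S i u /\ W (tcoord u.1 i u.2)],
         [set u | dom S i u /\ W' (tcoord u.1 i u.2)].
  split=> //; [exact: slit_mopen_fiber|exact: slit_mopen_fiber|].
  apply/seteqP; split=> // u [[_ Wu] [_ W'u]].
  by have : (W `&` W') (tcoord u.1 i u.2) by []; rewrite WW.
- have [J [cJ coverJ]] := manifold_countable mM.
  exists J; split=> // u [/coverJ[i Ji iu] u0]; by exists i.
Qed.

Lemma diff_slit_transition i j (u : pt S) v : dom S i u -> dom S j u ->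
  'd (transition (A := S) i j) (chart S i u) v =
  push (transition (A := M) i j) (chart S i u) v.
Proof.
move=> iu ju; have uo : overlap (A := S) i j (chart S i u) by exists u.
have dT := smooth_differentiable (@smooth_tangent_transition i j) uo.
have near_eq : \forall z \near chart S i u,
    tangent_map (transition (A := M) i j) z = transition (A := S) i j z.
  apply: (open_near (@open_slit_overlap i j)) => // z.
  by rewrite slit_overlap => -[ijz _]; rewrite -slit_transitionE.
have E : 'd (transition (A := S) i j) (chart S i u) v =
    'd (tangent_map (transition (A := M) i j)) (chart S i u) v.
  exact: (congr1 (fun f => f v) (near_eq_diff near_eq dT)).
apply: (etrans E); apply: (etrans (esym (deriveE v dT))).
have Uz : overlap (A := M) i j (lsubmx (chart S i u)).
  by move: uo; rewrite slit_overlap => -[].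
exact: (is_derive_val (is_derive_tangent_map (@open_overlap _ _ _ mM i j)
  (@smooth_transition _ _ _ mM i j) v Uz)).
Qed.

Lemma tcoord_slit_change i j (u : pt S) v : dom S i u -> dom S j u ->
  tcoord (A := S) u j v =
  push (transition (A := M) i j) (chart S i u) (tcoord (A := S) u i v).
Proof.
move=> iu ju; apply: (etrans (tcoord_change slit_manifold v iu ju)).
exact: diff_slit_transition.
Qed.

Lemma tjac_unit i j (u : pt S) : dom S i u -> dom S j u ->
  tjac (transition (A := M) i j) (chart S i u) \in unitmx.
Proof.
move=> [iu _] [ju _]; rewrite /tjac [lsubmx _]row_mxKl.
exact: jacobian_transition_unit.
Qed.

Lemma tcoord_chart_at (u : pt S) v : pts S u ->
  tcoord (A := S) u (chart_at S u) v = v.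
Proof.
move=> pu; apply: (diff_transition_id slit_manifold v).
exact: (dom_chart_at slit_manifold pu).
Qed.

(** In charts, the projection to [M] is [lsubmx]. *)
Lemma verticalE i (u : pt S) v : dom S i u ->
  vertical (M := M) u v <-> lsubmx (tcoord (A := S) u i v) = 0.
Proof.
move=> iu; have pu := dom_sub_pts slit_manifold iu.
pose c := chart_at S u; have cu : dom S c u by exact: (dom_chart_at slit_manifold pu).
have near_eq : \forall z \near chart S c u,
    lsubmx z = (chart M c \o fst \o inv S c) z.
  have uo : overlap (A := S) c c (chart S c u) by exists u.
  apply: (open_near (@open_slit_overlap c c) uo) => z.
  rewrite slit_overlap => -[[p [cp _] pz] _] /=.
  by rewrite -pz (invK mM cp).
have dl := @differentiable_lsubmx R 1 n n (chart S c u).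
have vE : dmap (A := S) (B := M) fst u v = lsubmx v.
  apply: (etrans (congr1 (fun f => f v) (near_eq_diff near_eq dl))).
  apply: (etrans (esym (deriveE v dl))).
  exact: is_derive_val (is_derive_lsubmx (is_derive_id _ v)).
rewrite /vertical /= vE (tcoord_slit_change v cu iu) tcoord_chart_at //.
rewrite /push row_mxKl; split=> [->|E]; first by rewrite mul0mx.
by rewrite -[LHS](mulmxK (tjac_unit cu iu)) E mul0mx.
Qed.

End SlitTangentBundle.

(** * Covariant derivatives in one chart *)

Section ChartConnection.
Context {R : realType} {n : nat}.
Implicit Types (l : 'rV[R]_(n + n) -> R) (z w : 'rV[R]_(n + n)) (h v : 'rV[R]_n).
Implicit Types (y : 'rV[R]_(n + n) -> 'rV[R]_(n + n)).

(** The inverse of [w |-> (lsubmx w, vpart l z w)]; see [assembleK]. *)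
Definition assemble l z h v : 'rV[R]_(n + n) := row_mx h (v - h *m Nmx l z).

Lemma lsubmx_assemble l z h v : lsubmx (assemble l z h v) = h.
Proof. by rewrite row_mxKl. Qed.

Lemma vpart_assemble l z h v : vpart l z (assemble l z h v) = v.
Proof. by rewrite /vpart row_mxKl row_mxKr subrK. Qed.

Lemma assembleK l z w : assemble l z (lsubmx w) (vpart l z w) = w.
Proof. by rewrite /assemble /vpart addrK hsubmxK. Qed.

Lemma parts_inj l z w w' : lsubmx w = lsubmx w' -> vpart l z w = vpart l z w' ->
  w = w'.
Proof. by move=> E E'; rewrite -(assembleK l z w) E E' assembleK. Qed.

Lemma assemble_linear l z a h v h' v' :
  assemble l z (a *: h + h') (a *: v + v') = a *: assemble l z h v + assemble l z h' v'.
Proof.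
apply: (@parts_inj l z); first by rewrite lsubmx_assemble linearP /= !lsubmx_assemble.
by rewrite vpart_linear !vpart_assemble.
Qed.

Lemma assemble_split l z h v : assemble l z h 0 + assemble l z 0 v = assemble l z h v.
Proof.
by have := assemble_linear l z 1 h 0 0 v; rewrite !scale1r addr0 add0r => ->.
Qed.

Lemma assemble_hor l z h : assemble l z h 0 = \sum_k h 0 k *: hframe l k z.
Proof.
rewrite [LHS](frame_decomp l z) lsubmx_assemble vpart_assemble.
by rewrite [X in _ + X]big1 ?addr0 // => k _; rewrite mxE scale0r.
Qed.

Lemma assemble_ver l z v : assemble l z 0 v = \sum_k v 0 k *: vframe k.
Proof.
rewrite [LHS](frame_decomp l z) lsubmx_assemble vpart_assemble.
by rewrite [X in X + _]big1 ?add0r // => k _; rewrite mxE scale0r.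
Qed.

(** Covariant derivative of components in the direction [w]; the horizontal and
    the vertical components of a vector field both behave as sections of the
    pullback of [TM]. *)
Definition cov l z w (f : 'rV[R]_(n + n) -> 'rV[R]_n) : 'rV[R]_n :=
  'D_w f z + f z *m conn_form l z w.

Definition covD l z w y : 'rV[R]_(n + n) :=
  assemble l z (cov l z w (fun x => lsubmx (y x))) (cov l z w (fun x => vpart l x (y x))).

Lemma near_eq_cov l z w f f' : (\forall x \near z, f x = f' x) ->
  cov l z w f = cov l z w f'.
Proof. by move=> E; rewrite /cov (near_eq_derive w E) (nbhs_singleton E). Qed.

Lemma eq_cov l z w f f' : f =1 f' -> cov l z w f = cov l z w f'.
Proof. by move=> /funext ->. Qed.

Lemma near_eq_covD l z w y y' : (\forall x \near z, y x = y' x) ->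
  covD l z w y = covD l z w y'.
Proof.
by move=> E; congr assemble; apply: near_eq_cov; apply: filterS E => x ->.
Qed.

Lemma cov_dir l z a w w' f : differentiable f z ->
  cov l z (a *: w + w') f = a *: cov l z w f + cov l z w' f.
Proof.
move=> df; have E : 'D_(a *: w + w') f z = a *: 'D_w f z + 'D_w' f z.
  by rewrite !(deriveE _ df) linearP.
by rewrite /cov conn_form_linear mulmxDr -scalemxAr scalerDr addrACA; congr (_ + _).
Qed.

Lemma cov_cst l z w h : cov l z w (fun=> h) = h *m conn_form l z w.
Proof. by rewrite /cov (is_derive_val (is_derive_cst h z w)) add0r. Qed.

Lemma cov_add l z w f f' : differentiable f z -> differentiable f' z ->
  cov l z w (fun x => f x + f' x) = cov l z w f + cov l z w f'.
Proof.
move=> df df'; have d := differentiable_is_derive w df.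
have d' := differentiable_is_derive w df'.
rewrite /cov mulmxDl (is_derive_val d) (is_derive_val d').
by rewrite (is_derive_val (is_deriveD d d')) addrACA.
Qed.

Lemma cov_scale l z w (a : 'rV[R]_(n + n) -> R) f :
  differentiable a z -> differentiable f z ->
  cov l z w (fun x => a x *: f x) = 'D_w a z *: f z + a z *: cov l z w f.
Proof.
move=> da df; have d := differentiable_is_derive w da.
have d' := differentiable_is_derive w df.
rewrite /cov (is_derive_val d) (is_derive_val d').
by rewrite (is_derive_val (is_derive_scale d d')) scalerDr addrA scalemxAl.
Qed.

Lemma mform_leibniz (W G D : 'M[R]_n) (d1 d2 u1 u2 : 'rV[R]_n) :
  G^T = G -> W *m G + (W *m G)^T = D ->
  (d1 *m G + u1 *m D) *m u2^T + u1 *m G *m d2^T =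
  (d1 + u1 *m W) *m G *m u2^T + u1 *m G *m (d2 + u2 *m W)^T.
Proof.
move=> GT <-; have -> : (d2 + u2 *m W)^T = d2^T + W^T *m u2^T.
  by rewrite -trmx_mul; apply/matrixP => i j; rewrite !mxE.
rewrite trmx_mul GT !mulmxDl !mulmxDr !mulmxDl !mulmxA -!addrA.
by congr (_ + (_ + _)); rewrite addrC.
Qed.

Section Smooth.
Variables (O : set 'rV[R]_(n + n)) (l : 'rV[R]_(n + n) -> R).
Hypotheses (oO : open O) (sl : smooth_on O l).
Hypothesis gU : forall z, O z -> Lg l z \in unitmx.

Lemma smooth_assemble (h v : 'rV[R]_(n + n) -> 'rV[R]_n) :
  smooth_on O h -> smooth_on O v -> smooth_on O (fun z => assemble l z (h z) (v z)).
Proof.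
move=> sh sv; apply: smooth_row_mx => //; apply: smoothD => //.
apply/smooth_mxP => // i j.
have /(smooth_mxP _ oO) /(_ i j) /(smoothN oO) :=
  smooth_mulmx oO sh (smooth_Nmx oO sl gU).
by apply: eq_smooth => // z _; rewrite [RHS]mxE.
Qed.

Lemma smooth_cov (w : 'rV[R]_(n + n) -> 'rV[R]_(n + n)) f :
  smooth_on O w -> smooth_on O f -> smooth_on O (fun z => cov l z (w z) f).
Proof.
move=> sw sf; apply: smoothD => //; first exact: smooth_dir.
by apply: smooth_mulmx => //; exact: smooth_conn_form.
Qed.

Lemma smooth_covD (w y : 'rV[R]_(n + n) -> 'rV[R]_(n + n)) :
  smooth_on O w -> smooth_on O y -> smooth_on O (fun z => covD l z (w z) y).
Proof.
move=> sw sy; apply: smooth_assemble; apply: smooth_cov => //.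
  exact: smooth_lsubmx.
exact: smooth_vpart.
Qed.

Lemma differentiable_lpart y z : O z -> smooth_on O y ->
  differentiable (fun x => lsubmx (y x)) z.
Proof. by move=> Oz sy; apply: smooth_differentiable (smooth_lsubmx oO sy) Oz. Qed.

Lemma differentiable_vpart y z : O z -> smooth_on O y ->
  differentiable (fun x => vpart l x (y x)) z.
Proof. by move=> Oz sy; apply: smooth_differentiable (smooth_vpart oO sl gU sy) Oz. Qed.

Lemma covD_dir z a w w' y : O z -> smooth_on O y ->
  covD l z (a *: w + w') y = a *: covD l z w y + covD l z w' y.
Proof.
move=> Oz sy; rewrite /covD (cov_dir _ _ _ _ (differentiable_lpart Oz sy)).
by rewrite (cov_dir _ _ _ _ (differentiable_vpart Oz sy)) assemble_linear.
Qed.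

Lemma covD_add z w y y' : O z -> smooth_on O y -> smooth_on O y' ->
  covD l z w (fun x => y x + y' x) = covD l z w y + covD l z w y'.
Proof.
move=> Oz sy sy'; rewrite -[X in X + _]scale1r -assemble_linear !scale1r.
rewrite /covD; congr assemble.
  rewrite -cov_add; [|exact: differentiable_lpart|exact: differentiable_lpart].
  by apply: eq_cov => x; rewrite linearD.
rewrite -cov_add; [|exact: differentiable_vpart|exact: differentiable_vpart].
apply: eq_cov => x.
by rewrite vpartD.
Qed.

Lemma covD_scale z w (a : 'rV[R]_(n + n) -> R) y :
  O z -> smooth_on O a -> smooth_on O y ->
  covD l z w (fun x => a x *: y x) = 'D_w a z *: y z + a z *: covD l z w y.
Proof.
move=> Oz sa sy; have da := smooth_differentiable sa Oz.
rewrite -[y z](assembleK l z).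
have -> : a z *: covD l z w y = assemble l z
    (a z *: cov l z w (fun x => lsubmx (y x))) (a z *: cov l z w (fun x => vpart l x (y x))).
  have := assemble_linear l z (a z) (cov l z w (fun x => lsubmx (y x)))
    (cov l z w (fun x => vpart l x (y x))) 0 0.
  by rewrite !addr0 => ->; rewrite assemble_hor big1 ?addr0 // => k _; rewrite mxE scale0r.
rewrite -assemble_linear /covD; congr assemble.
  apply: (etrans _ (cov_scale _ _ da (differentiable_lpart Oz sy))).
  by apply: eq_cov => x; rewrite linearZ.
apply: (etrans _ (cov_scale _ _ da (differentiable_vpart Oz sy))).
apply: eq_cov => x.
by rewrite vpartZ.
Qed.

(** The metric is the sum of this form on base parts and on vertical parts. *)
Definition mform z h h' : R := (h *m Lg l z *m h'^T) 0 0.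

Lemma smooth_mform (f f' : 'rV[R]_(n + n) -> 'rV[R]_n) :
  smooth_on O f -> smooth_on O f' -> smooth_on O (fun z => mform z (f z) (f' z)).
Proof.
move=> sf sf'; have sG := smooth_mulmx oO sf (smooth_Lg oO sl).
have := smooth_mulmx oO sG (smooth_trmx oO sf').
by move=> /(smooth_mxP _ oO); apply.
Qed.

Lemma cov_mform z w (f f' : 'rV[R]_(n + n) -> 'rV[R]_n) :
  O z -> differentiable f z -> differentiable f' z ->
  'D_w (fun x => mform x (f x) (f' x)) z =
    mform z (cov l z w f) (f' z) + mform z (f z) (cov l z w f').
Proof.
move=> Oz df df'; have d := differentiable_is_derive w df.
have d' := differentiable_is_derive w df'.
have dg := smooth_is_derive w (smooth_Lg oO sl) Oz.
have D := is_derive_entry 0 0 (is_derive_mulmx (is_derive_mulmx d dg) (is_derive_trmx d')).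
apply: (etrans (is_derive_val D)).
rewrite /mform /cov (is_derive_val d) (is_derive_val d').
have addE (A B : 'M[R]_1) : A 0 0 + B 0 0 = (A + B) 0 0 by rewrite mxE.
apply: (etrans _ (esym (addE _ _))).
exact: (congr1 (fun A : 'M[R]_1 => A 0 0) (mform_leibniz _ _ _ _ (Lg_sym oO sl Oz)
  (conn_form_metric oO sl gU w Oz))).
Qed.

End Smooth.
Lemma mform_linear l z a h h' k :
  mform l z (a *: h + h') k = a * mform l z h k + mform l z h' k.
Proof.
rewrite /mform; move: (Lg l z) => G.
by rewrite !mulmxDl -!scalemxAl mxE; congr (_ + _); rewrite mxE.
Qed.

Lemma mform0r l z h : mform l z h 0 = 0.
Proof. by rewrite /mform linear0 mulmx0 mxE. Qed.

Lemma mform_sym l z h k : (Lg l z)^T = Lg l z -> mform l z h k = mform l z k h.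
Proof.
rewrite /mform; move: (Lg l z) => G GT.
rewrite -[RHS](_ : ((k *m G *m h^T)^T) 0 0 = _); last by rewrite mxE.
by rewrite !trmx_mul trmxK GT mulmxA.
Qed.

Lemma mform_nondegenerate l z h : Lg l z \in unitmx ->
  (forall k, mform l z h k = 0) -> h = 0.
Proof.
rewrite /mform; move: (Lg l z) => G GU h0.
rewrite -[h](mulmxK GU); suff -> : h *m G = 0 by rewrite mul0mx.
apply/rowP => j; rewrite [RHS]mxE -(h0 (delta_mx 0 j)) trmx_delta.
by rewrite -colE [RHS]mxE.
Qed.

Lemma mform_change l l' z z' (P : 'M[R]_n) (h k h' k' : 'rV[R]_n) :
  Lg l z = P *m Lg l' z' *m P^T -> h' = h *m P -> k' = k *m P ->
  mform l z h k = mform l' z' h' k'.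
Proof.
rewrite /mform => -> -> ->; move: (Lg l' z') => G.
by rewrite trmx_mul !mulmxA.
Qed.

End ChartConnection.

Section CovChange.
Context {R : realType} {n : nat}.
Variables (U : set 'rV[R]_n) (phi : 'rV[R]_n -> 'rV[R]_n).
Variables (O O' : set 'rV[R]_(n + n)) (l l' : 'rV[R]_(n + n) -> R).
Hypotheses (oU : open U) (sphi : smooth_on U phi).
Hypotheses (oO : open O) (oO' : open O').
Hypotheses (sl : smooth_on O l) (sl' : smooth_on O' l').
Hypothesis OU : forall z, O z -> U (lsubmx z).
Hypothesis OO' : forall z, O z -> O' (tangent_map phi z).
Hypothesis lE : forall z, O z -> l z = l' (tangent_map phi z).
Hypothesis PU : forall z, O z -> tjac phi z \in unitmx.
Hypothesis g'U : forall z, O' z -> Lg l' z \in unitmx.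
Implicit Types (z w : 'rV[R]_(n + n)).

(** The derivative of the Jacobian matrix of [phi], coming from the components,
    cancels the inhomogeneous term of [conn_form_change]. *)
Lemma cov_change z w f f' : O z -> differentiable f z ->
  differentiable f' (tangent_map phi z) ->
  (forall x, O x -> f' (tangent_map phi x) = f x *m tjac phi x) ->
  cov l' (tangent_map phi z) (push phi z w) f' = cov l z w f *m tjac phi z.
Proof.
move=> Oz df df' ff'.
have dl := is_derive_pull oU sphi oO OU w Oz df'.
have dr := is_derive_mulmx (differentiable_is_derive w df)
  (is_derive_tjac oU sphi w (OU Oz)).
have E := near_eq_derive w (open_near oO Oz ff').
rewrite (is_derive_val dl) (is_derive_val dr) in E.
rewrite /cov E (ff' _ Oz) mulmxDl -(mulmxA _ (conn_form l z w)).
rewrite -(conn_form_change oU sphi oO oO' sl sl' OU OO' lE PU g'U w Oz).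
by rewrite (is_derive_val (differentiable_is_derive w df)) (mulmxDr (f z)) mulmxA addrA.
Qed.

Lemma covD_change z w y y' : O z -> smooth_on O y -> smooth_on O' y' ->
  (forall x, O x -> y' (tangent_map phi x) = push phi x (y x)) ->
  covD l' (tangent_map phi z) (push phi z w) y' = push phi z (covD l z w y).
Proof.
move=> Oz sy sy' yy'; have O'z := OO' Oz.
have gU := Lg_unit oU sphi oO oO' sl sl' OU OO' lE PU g'U.
have vc := vpart_change oU sphi oO oO' sl sl' OU OO' lE PU g'U.
apply: (@parts_inj _ _ l' (tangent_map phi z)).
  rewrite lsubmx_assemble [RHS]row_mxKl lsubmx_assemble.
  apply: cov_change; [exact: Oz|exact: differentiable_lpart sy|
    exact: differentiable_lpart sy'|].
  by move=> x Ox; rewrite yy' // row_mxKl.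
apply: (etrans (vpart_assemble _ _ _ _)); apply: (etrans _ (esym (vc _ _ Oz))).
apply: (etrans _ (congr1 (fun v => v *m tjac phi z) (esym (vpart_assemble _ _ _ _)))).
apply: cov_change; first exact: Oz.
- exact: differentiable_vpart sy.
- exact: differentiable_vpart sy'.
- by move=> x Ox; rewrite yy' // vc.
Qed.

End CovChange.

(** * Chart independence of the canonical structures *)

Section CanonicalStructures.
Context {R : realType} {n : nat} (M : atlas R n).
Hypothesis mM : smooth_manifold M.
Variable L : pt (TM M) -> R.
Hypothesis regL : regular_lagrangian L.
Implicit Types (i j : idx M) (z w : 'rV[R]_(n + n)).

Local Notation S := (slitTM M).
Implicit Types (u : pt S) (B : set (pt S)) (X Y Z : vfield S).
Let mS : smooth_manifold S := slit_manifold mM.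

Lemma open_slit_image i B : mopen (A := S) B -> open (image (A := S) i B).
Proof. exact: open_image. Qed.

Lemma smooth_loc i B : smooth_on (image (A := S) i B) (loc L i).
Proof.
apply: sub_smooth (lagrangian_smooth regL i) => _ [u [_ iu] <-]; exists u => //.
by split=> //; exact: (dom_sub_pts mS iu).
Qed.

Lemma Lg_loc_unit i B z : image (A := S) i B z -> Lg (loc L i) z \in unitmx.
Proof.
case=> u [_ iu] <-; rewrite -row_free_unit /row_free.
by apply/eqP; exact: lagrangian_rank regL i u iu.
Qed.

Section ChangeOfChart.
Variables (B : set (pt S)) (i j : idx M).
Hypothesis oB : mopen (A := S) B.

Local Notation W := (image (A := S) i (B `&` dom S j)).
Local Notation W' := (image (A := S) j (B `&` dom S i)).
Local Notation T := (transition (A := M) i j).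

Lemma open_change_source : open W.
Proof. by apply: open_slit_image; apply: mopenI => //; exact: mopen_dom. Qed.

Lemma open_change_target : open W'.
Proof. by apply: open_slit_image; apply: mopenI => //; exact: mopen_dom. Qed.

Lemma change_source_base z : W z -> overlap (A := M) i j (lsubmx z).
Proof.
by case=> u [[_ [ju _]] [iu _]] <-; rewrite [lsubmx _]row_mxKl; exists u.1.
Qed.

Lemma tangent_map_chart u : dom S i u -> dom S j u ->
  tangent_map T (chart S i u) = chart S j u.
Proof.
move=> iu ju; have [iu1 _] := iu; have [ju1 _] := ju.
rewrite -slit_transitionE //; last by rewrite [lsubmx _]row_mxKl; exists u.1.
by apply: transitionE iu; exact: mS.
Qed.

Lemma change_source_target z : W z -> W' (tangent_map T z).
Proof.
by case=> u [[Bu ju] iu] <-; rewrite tangent_map_chart //; exists u.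
Qed.

Lemma loc_change z : W z -> loc L i z = loc L j (tangent_map T z).
Proof.
case=> u [[Bu ju] iu] <-; rewrite (tangent_map_chart iu ju).
have [iu1 _] := iu; have [ju1 _] := ju.
have Ei : inv S i (chart S i u) = u := slit_chartK mM iu1.
have Ej : inv S j (chart S j u) = u := slit_chartK mM ju1.
exact: (etrans (congr1 L Ei) (esym (congr1 L Ej))).
Qed.

Lemma change_source_unit z : W z -> tjac T z \in unitmx.
Proof. by case=> u [[Bu ju] iu] <-; exact: tjac_unit. Qed.

Let oU := @open_overlap _ _ _ mM i j.
Let sT := @smooth_transition _ _ _ mM i j.
Let sli := @smooth_loc i (B `&` dom S j).
Let slj := @smooth_loc j (B `&` dom S i).
Let gU := @Lg_loc_unit j (B `&` dom S i).

Lemma Lg_chart u : B u -> dom S i u -> dom S j u ->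
  Lg (loc L i) (chart S i u) =
  tjac T (chart S i u) *m Lg (loc L j) (chart S j u) *m (tjac T (chart S i u))^T.
Proof.
move=> Bu iu ju; rewrite -(tangent_map_chart iu ju).
have Wu : W (chart S i u) by exists u.
exact: (Lg_change oU sT open_change_source open_change_target sli slj change_source_base change_source_target loc_change Wu).
Qed.

Lemma vpart_chart u v : B u -> dom S i u -> dom S j u ->
  vpart (loc L j) (chart S j u) (tcoord (A := S) u j v) =
  vpart (loc L i) (chart S i u) (tcoord (A := S) u i v) *m tjac T (chart S i u).
Proof.
move=> Bu iu ju; rewrite -(tangent_map_chart iu ju).
rewrite (tcoord_slit_change mM v iu ju).
have Wu : W (chart S i u) by exists u.
exact: (vpart_change oU sT open_change_source open_change_target sli slj change_source_base change_source_target loc_change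
  change_source_unit gU _ Wu).
Qed.

Lemma lpart_chart u v : dom S i u -> dom S j u ->
  lsubmx (tcoord (A := S) u j v) =
  lsubmx (tcoord (A := S) u i v) *m tjac T (chart S i u).
Proof. by move=> iu ju; rewrite (tcoord_slit_change mM v iu ju) row_mxKl. Qed.

Lemma covD_chart u v Y : B u -> dom S i u -> dom S j u ->
  smooth_vf (A := S) B Y ->
  covD (loc L j) (chart S j u) (tcoord (A := S) u j v) (coords (A := S) j Y) =
  push T (chart S i u)
    (covD (loc L i) (chart S i u) (tcoord (A := S) u i v) (coords (A := S) i Y)).
Proof.
move=> Bu iu ju sY; rewrite -(tangent_map_chart iu ju).
rewrite (tcoord_slit_change mM v iu ju).
have Wu : W (chart S i u) by exists u.
have sub (k : idx M) (C : set (pt S)) :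
    smooth_on (image (A := S) k (B `&` C)) (coords (A := S) k Y).
  by apply: sub_smooth (sY k) => _ [q [[Bq _] kq] <-]; exists q.
apply: (covD_change oU sT open_change_source open_change_target sli slj change_source_base change_source_target loc_change
  change_source_unit gU _ Wu (sub _ _) (sub _ _)).
move=> _ [q [[Bq jq] iq] <-]; rewrite (tangent_map_chart iq jq).
by rewrite (coordsE mS _ iq) (coordsE mS _ jq) (tcoord_slit_change mM _ iq jq).
Qed.

End ChangeOfChart.

Definition chart_metric i u (v v' : 'rV[R]_(n + n)) : R :=
  let l := loc L i in let z := chart S i u in
  let x := tcoord (A := S) u i v in let y := tcoord (A := S) u i v' in
  mform l z (lsubmx x) (lsubmx y) + mform l z (vpart l z x) (vpart l z y).

Definition chart_conn i u (v : 'rV[R]_(n + n)) Y : 'rV[R]_(n + n) :=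
  tvec (A := S) u i (covD (loc L i) (chart S i u) (tcoord (A := S) u i v)
    (coords (A := S) i Y)).

(** The structures are defined through the preferred chart at each point; the lemmas
    [canon_horE], [canon_metricE] and [canon_connE] allow any other one. *)
Definition canon_hor u : set 'rV[R]_(n + n) :=
  let c := chart_at S u in
  [set v | vpart (loc L c) (chart S c u) (tcoord (A := S) u c v) = 0].

Definition canon_metric u := chart_metric (chart_at S u) u.

Definition canon_conn u := chart_conn (chart_at S u) u.

Lemma slit_chart_at u : pts S u -> dom S (chart_at S u) u.
Proof. by move=> pu; exact: (dom_chart_at mS pu). Qed.

Lemma canon_horE i u v : dom S i u ->
  canon_hor u v <-> vpart (loc L i) (chart S i u) (tcoord (A := S) u i v) = 0.
Proof.
move=> iu; have cu := slit_chart_at (dom_sub_pts mS iu).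
have E := vpart_chart (mopen_dom mS _) v cu cu iu.
have cancel (a b : 'rV[R]_n) P : P \in unitmx -> b = a *m P -> (a = 0 <-> b = 0).
  move=> Pu ->; split=> [->|b0]; first by rewrite mul0mx.
  by rewrite -[a](mulmxK Pu) b0 mul0mx.
exact: (cancel _ _ _ (tjac_unit mM cu iu) E).
Qed.

Lemma canon_metricE i u v v' : dom S i u ->
  canon_metric u v v' = chart_metric i u v v'.
Proof.
move=> iu; have cu := slit_chart_at (dom_sub_pts mS iu).
have oB := mopen_dom mS (chart_at S u).
have G := Lg_chart oB cu cu iu.
have hl w := lpart_chart w cu iu.
have hv w := vpart_chart oB w cu cu iu.
exact: (congr2 +%R (mform_change G (hl v) (hl v')) (mform_change G (hv v) (hv v'))).
Qed.

Lemma canon_connE B i u v Y : mopen (A := S) B -> B u -> dom S i u ->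
  smooth_vf (A := S) B Y -> canon_conn u v Y = chart_conn i u v Y.
Proof.
move=> oB Bu iu sY; have cu := slit_chart_at (dom_sub_pts mS iu).
apply: (tcoord_inj mS iu); rewrite /canon_conn /chart_conn.
set c := chart_at _ u in cu *.
apply: (etrans (tvec_change mS _ cu iu)); apply: (etrans (diff_slit_transition mM _ cu iu)).
by apply: (etrans (esym (covD_chart oB v Bu cu iu sY))); exact: (esym (tvecK mS _ iu)).
Qed.

End CanonicalStructures.

(** * Adapted frames and the N-connection *)

Section RiemannCartan.
Context {R : realType} {n : nat} (M : atlas R n).
Hypothesis mM : smooth_manifold M.
Variable L : pt (TM M) -> R.
Hypothesis regL : regular_lagrangian L.
Implicit Types (i j : idx M) (z w : 'rV[R]_(n + n)).

Local Notation S := (slitTM M).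
Implicit Types (u : pt S) (B : set (pt S)) (X Y Z : vfield S).
Let mS : smooth_manifold S := slit_manifold mM.

Let oI i B (oB : mopen (A := S) B) : open (image (A := S) i B) := open_slit_image oB.
Let sL i B := @smooth_loc R n M mM L regL i B.
Let gU i B := @Lg_loc_unit R n M L regL i B.

Lemma coords_eh i k u : dom S i u ->
  coords (A := S) i (eh L i k) (chart S i u) = hframe (loc L i) k (chart S i u).
Proof. by move=> iu; rewrite (coordsE mS _ iu) /eh (tvecK mS _ iu). Qed.

Lemma coords_ev i k u : dom S i u ->
  coords (A := S) i (ev i k) (chart S i u) = vframe k.
Proof. by move=> iu; rewrite (coordsE mS _ iu) /ev (tvecK mS _ iu). Qed.

Lemma smooth_eh i k : smooth_vf (A := S) (dom S i) (eh L i k).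
Proof.
have oD := mopen_dom mS i; apply: (@smooth_vf_chart _ _ _ mS i _ _ oD) => //.
have H := smooth_hframe (@oI i _ oD) (@sL i (dom S i)) (@gU i (dom S i)) k.
refine (eq_smooth (@oI i _ oD) _ H).
by move=> _ [u [_ iu] <-]; rewrite coords_eh.
Qed.

Lemma smooth_ev i k : smooth_vf (A := S) (dom S i) (ev i k).
Proof.
have oD := mopen_dom mS i; apply: (@smooth_vf_chart _ _ _ mS i _ _ oD) => //.
apply: eq_smooth (smooth_cst (image (A := S) i (dom S i)) (vframe k)).
  exact: (@oI i _ oD).
by move=> _ [u [_ iu] <-]; rewrite coords_ev.
Qed.

Lemma tcoord_eh_comb i u (a : 'I_n -> R) : dom S i u ->
  tcoord (A := S) u i (\sum_k a k *: eh L i k u) =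
  assemble (loc L i) (chart S i u) (\row_k a k) 0.
Proof.
move=> iu; rewrite assemble_hor (tcoord_sum (A := S)).
apply: eq_bigr => k _; rewrite (tcoordZ (A := S)) /eh (tvecK mS _ iu).
by rewrite mxE.
Qed.

Lemma tcoord_ev_comb i u (a : 'I_n -> R) : dom S i u ->
  tcoord (A := S) u i (\sum_k a k *: ev i k u) =
  assemble (loc L i) (chart S i u) 0 (\row_k a k).
Proof.
move=> iu; rewrite assemble_ver (tcoord_sum (A := S)).
apply: eq_bigr => k _; rewrite (tcoordZ (A := S)) /ev (tvecK mS _ iu).
by rewrite mxE.
Qed.

Lemma frame_expansion i u v : dom S i u ->
  v = \sum_k lsubmx (tcoord (A := S) u i v) 0 k *: eh L i k u +
      \sum_k vpart (loc L i) (chart S i u) (tcoord (A := S) u i v) 0 k *: ev i k u.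
Proof.
move=> iu; apply: (tcoord_inj mS iu); rewrite (tcoordD (A := S)).
rewrite tcoord_eh_comb // tcoord_ev_comb //.
have rowE (a : 'rV[R]_n) : \row_k a 0 k = a by apply/rowP => k; rewrite mxE.
by rewrite !rowE assemble_split assembleK.
Qed.

Lemma canon_hor_span i u : dom S i u ->
  canon_hor L u = [set v | exists a : 'I_n -> R, v = \sum_k a k *: eh L i k u].
Proof.
move=> iu; apply/seteqP; split=> v.
  move/(canon_horE mM regL v iu) => v0.
  exists (fun k => lsubmx (tcoord (A := S) u i v) 0 k).
  rewrite [LHS](frame_expansion v iu) v0 [X in _ + X]big1 ?addr0 // => k _.
  by rewrite mxE scale0r.
case=> a ->; apply/(canon_horE mM regL _ iu).
by rewrite tcoord_eh_comb // vpart_assemble.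
Qed.

Lemma vertical_span i u : dom S i u ->
  vertical (M := M) u = [set v | exists a : 'I_n -> R, v = \sum_k a k *: ev i k u].
Proof.
move=> iu; apply/seteqP; split=> v.
  move/(verticalE mM v iu) => v0.
  exists (fun k => vpart (loc L i) (chart S i u) (tcoord (A := S) u i v) 0 k).
  rewrite [LHS](frame_expansion v iu) v0 [X in X + _]big1 ?add0r // => k _.
  by rewrite mxE scale0r.
case=> a ->; apply/(verticalE mM _ iu).
by rewrite tcoord_ev_comb // lsubmx_assemble.
Qed.

Lemma subbundle_of_frame (H : pt S -> set 'rV[R]_(n + n))
    (e : idx M -> 'I_n -> vfield S) :
  (forall i k, smooth_vf (A := S) (dom S i) (e i k)) ->
  (forall i u, dom S i u ->
     H u = [set v | exists a : 'I_n -> R, v = \sum_k a k *: e i k u]) ->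
  (forall i u (a : 'I_n -> R), dom S i u -> \sum_k a k *: e i k u = 0 ->
     forall k, a k = 0) ->
  subbundle (A := S) H.
Proof.
move=> se He fe u pu; pose i : idx M := chart_at S u.
have iu : dom S i u := slit_chart_at mM pu.
exists n, (dom S i), (fun q => \matrix_k e i k q).
split=> //; first exact: mopen_dom mS i.
  move=> k; suff -> : (fun q => row k (\matrix_k e i k q)) = e i k by exact: se.
  by apply/funext => q; rewrite rowK.
move=> q iq; have comb (a : 'rV[R]_n) :
    a *m (\matrix_k e i k q) = \sum_k a 0 k *: e i k q.
  by rewrite mulmx_sum_row; apply: eq_bigr => k _; rewrite rowK.
split.
  rewrite -kermx_eq0; apply/rowV0P => a /sub_kermxP; rewrite comb => a0.
  by apply/rowP => k; rewrite mxE (fe _ _ _ iq a0).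
move=> v; rewrite (He i q iq); split=> [[a ->]|/submxP[a ->]].
  apply/submxP; exists (\row_k a k); rewrite comb.
  by apply: eq_bigr => k _; rewrite mxE.
by exists (a 0); rewrite comb.
Qed.

Lemma canon_hor_subbundle : subbundle (A := S) (canon_hor L).
Proof.
apply: (subbundle_of_frame smooth_eh canon_hor_span) => i u a iu a0 k.
have := tcoord_eh_comb a iu; rewrite a0 (tcoord0 (A := S)).
by move=> /(congr1 (@lsubmx R 1 n n)); rewrite lsubmx_assemble linear0 => /rowP /(_ k);
  rewrite !mxE.
Qed.

Lemma vertical_subbundle : subbundle (A := S) (vertical (M := M)).
Proof.
apply: (subbundle_of_frame smooth_ev vertical_span) => i u a iu a0 k.
have := tcoord_ev_comb a iu; rewrite a0 (tcoord0 (A := S)).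
move=> /(congr1 (vpart (loc L i) (chart S i u))).
by rewrite vpart_assemble vpart0 => /rowP /(_ k); rewrite !mxE.
Qed.

(** The two summands are the halves of [frame_expansion]. *)
Lemma canon_split u v : pts S u ->
  exists! hv : 'rV[R]_(n + n) * 'rV[R]_(n + n),
    [/\ canon_hor L u hv.1, vertical (M := M) u hv.2 & v = hv.1 + hv.2].
Proof.
move=> pu; pose i : idx M := chart_at S u.
have iu : dom S i u := slit_chart_at mM pu.
exists (\sum_k lsubmx (tcoord (A := S) u i v) 0 k *: eh L i k u,
  \sum_k vpart (loc L i) (chart S i u) (tcoord (A := S) u i v) 0 k *: ev i k u).
split=> [/=|[h w] /= []].
  split; last exact: frame_expansion.
    by rewrite (canon_hor_span iu) /=; eexists.
  by rewrite (vertical_span iu) /=; eexists.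
rewrite (canon_hor_span iu) (vertical_span iu) => -[a ->] [b ->] ->.
have E : tcoord (A := S) u i (\sum_k a k *: eh L i k u + \sum_k b k *: ev i k u) =
    assemble (loc L i) (chart S i u) (\row_k a k) (\row_k b k).
  by rewrite (tcoordD (A := S)) tcoord_eh_comb // tcoord_ev_comb // assemble_split.
rewrite E lsubmx_assemble vpart_assemble; congr pair; apply: eq_bigr => k _;
  by rewrite mxE.
Qed.

Lemma canon_N_connection : N_connection (A := S) (vertical (M := M)) (canon_hor L).
Proof.
split; [exact: vertical_subbundle|exact: canon_hor_subbundle|].
by move=> u v pu; exact: canon_split.
Qed.

End RiemannCartan.

(** * The d-metric and the linear connection *)

Section MetricConnection.
Context {R : realType} {n : nat} (M : atlas R n).
Hypothesis mM : smooth_manifold M.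
Variable L : pt (TM M) -> R.
Hypothesis regL : regular_lagrangian L.
Implicit Types (i j : idx M) (z w : 'rV[R]_(n + n)).

Local Notation S := (slitTM M).
Implicit Types (u p : pt S) (O : set (pt S)) (X Y Z : vfield S).
Let mS : smooth_manifold S := slit_manifold mM.

Let oI i O (oO : mopen (A := S) O) : open (image (A := S) i O) := open_slit_image oO.
Let sL i O := @smooth_loc R n M mM L regL i O.
Let gU i O := @Lg_loc_unit R n M L regL i O.

Let metric_coords i u X Y : dom S i u ->
  let l := loc L i in let z := chart S i u in
  let x := coords (A := S) i X in let y := coords (A := S) i Y in
  canon_metric L u (X u) (Y u) =
  mform l z (lsubmx (x z)) (lsubmx (y z)) + mform l z (vpart l z (x z)) (vpart l z (y z)).
Proof. by move=> iu; rewrite /= !(coordsE mS _ iu); exact: canon_metricE. Qed.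

Let conn_coords i u v O Y : mopen (A := S) O -> O u -> dom S i u ->
  smooth_vf (A := S) O Y ->
  tcoord (A := S) u i (canon_conn L u v Y) =
  covD (loc L i) (chart S i u) (tcoord (A := S) u i v) (coords (A := S) i Y).
Proof.
move=> oO Ou iu sY; apply: (etrans (congr1 _ (canon_connE mM regL v oO Ou iu sY))).
exact: (tvecK mS _ iu).
Qed.

Lemma canon_metric_metric : metric (A := S) (canon_metric L).
Proof.
have unit_at u : pts S u -> Lg (loc L (chart_at S u)) (chart S (chart_at S u) u) \in unitmx.
  move=> pu; have iu := slit_chart_at mM pu.
  by apply: (@gU _ (dom S (chart_at S u))); exists u.
have sym_at u : pts S u -> let g := Lg (loc L (chart_at S u)) (chart S (chart_at S u) u) in
    g^T = g.
  move=> pu; have iu := slit_chart_at mM pu; have oD := mopen_dom mS (chart_at S u).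
  apply: (Lg_sym (@oI (chart_at S u) _ oD) (@sL _ _)).
  by exists u.
split.
- move=> u v w pu; rewrite /canon_metric /chart_metric.
  by congr (_ + _); apply: mform_sym; exact: sym_at.
- move=> u a v w x pu; rewrite /canon_metric /chart_metric.
  rewrite (tcoord_linear (A := S)) vpart_linear linearP /= !mform_linear.
  by rewrite mulrDr addrACA.
- move=> u v pu v0; have iu := slit_chart_at mM pu.
  pose i : idx M := chart_at S u; pose l := loc L i; pose z := chart S i u.
  pose x := tcoord (A := S) u i v; have lu := unit_at u pu.
  have test h k : mform l z (lsubmx x) h + mform l z (vpart l z x) k = 0.
    have := v0 (tvec (A := S) u i (assemble l z h k)).
    rewrite /canon_metric /chart_metric (tvecK mS _ iu).
    by rewrite lsubmx_assemble vpart_assemble.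
  apply: (tcoord_inj mS iu); rewrite (tcoord0 (A := S)).
  apply: (@parts_inj _ _ l z); rewrite ?vpart0 ?linear0.
    apply: (mform_nondegenerate lu) => h.
    by have := test h 0; rewrite mform0r addr0.
  apply: (mform_nondegenerate lu) => k.
  by have := test 0 k; rewrite mform0r add0r.
- move=> O X Y oO sX sY i; rewrite -/(image (A := S) i O).
  have o := @oI i O oO; have s := @sL i O; have g := @gU i O.
  have H := smoothD o (smooth_mform o s (smooth_lsubmx o (sX i)) (smooth_lsubmx o (sY i)))
   (smooth_mform o s (smooth_vpart o s g (sX i)) (smooth_vpart o s g (sY i))).
  refine (eq_smooth o _ H) => _ [u [Ou iu] <-].
  exact: (etrans (esym (metric_coords X Y iu)) (esym (congr1
    (fun q => canon_metric L q (X q) (Y q)) (slit_chartK mM (proj1 iu))))).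
Qed.

Lemma canon_metric_orthogonal u v w : pts S u ->
  canon_hor L u v -> vertical (M := M) u w -> canon_metric L u v w = 0.
Proof.
move=> pu; have iu := slit_chart_at mM pu.
move=> /(canon_horE mM regL v iu) v0 /(verticalE mM w iu) w0.
apply: (etrans (canon_metricE mM regL v w iu)); rewrite /chart_metric v0 w0 mform0r.
by rewrite /mform !mul0mx mxE addr0.
Qed.

Lemma canon_d_metric : d_metric (A := S) (vertical (M := M)) (canon_hor L) (canon_metric L).
Proof.
split; first exact: canon_metric_metric.
by move=> u v w pu; exact: canon_metric_orthogonal.
Qed.

Lemma canon_conn_linear : linear_connection (A := S) (canon_conn L).
Proof.
split.
- move=> p v O Y Y' oO Op sY YY'; have [Os _] := oO.
  have ip := slit_chart_at mM (Os p Op).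
  rewrite /canon_conn /chart_conn; congr (tvec p _ _); apply: near_eq_covD.
  apply: (open_near (@oI (chart_at S p) _ oO)); first by exists p.
  move=> _ [q [Oq iq] <-]; rewrite !(coordsE mS _ iq).
  by rewrite YY'.
- move=> p a v w Y pp [B [oO Op sY]]; have ip := slit_chart_at mM pp.
  rewrite /canon_conn /chart_conn (tcoord_linear (A := S)).
  have o := @oI (chart_at S p) _ oO.
  have Wp : image (A := S) (chart_at S p) B (chart S (chart_at S p) p) by exists p.
  rewrite (covD_dir o (@sL _ B) (@gU _ B) _ _ _ Wp (sY _)).
  exact: (tvec_linear (A := S)).
- move=> p v Y Y' pp [B [oO Op sY]] [B' [oO' Op' sY']]; have ip := slit_chart_at mM pp.
  have oOO := mopenI mS oO oO'; have {}sY : smooth_vf (A := S) (B `&` B') Y.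
    by apply: (sub_smooth_vf _ sY) => q [].
  have {}sY' : smooth_vf (A := S) (B `&` B') Y'.
    by apply: (sub_smooth_vf _ sY') => q [].
  have o := @oI (chart_at S p) _ oOO; set i := chart_at S p in ip o *.
  have Wp : image (A := S) i (B `&` B') (chart S i p) by exists p.
  apply: (tcoord_inj mS ip); rewrite (tcoordD (A := S)).
  rewrite (conn_coords v oOO _ ip sY) // (conn_coords v oOO _ ip sY') //.
  rewrite (conn_coords v oOO _ ip (smooth_vfD oOO sY sY')) //.
  rewrite -(covD_add o (@sL i _) (@gU i _) _ Wp (sY i) (sY' i)).
  apply: near_eq_covD; apply: (open_near o Wp) => _ [q [_ iq] <-].
  apply: (etrans (coordsE mS _ iq)); rewrite (tcoordD (A := S)).
  exact: (esym (congr2 +%R (coordsE mS Y iq) (coordsE mS Y' iq))).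
- move=> p v f Y pp [B [oO Op sf]] [B' [oO' Op' sY]]; have ip := slit_chart_at mM pp.
  have oOO := mopenI mS oO oO'; have {}sY : smooth_vf (A := S) (B `&` B') Y.
    by apply: (sub_smooth_vf _ sY) => q [].
  have {}sf : smooth_fun (A := S) (B `&` B') f.
    by move=> i; apply: sub_smooth (sf i) => _ [q [[Oq _] iq] <-]; exists q.
  have o := @oI (chart_at S p) _ oOO; set i := chart_at S p in ip o *.
  have Wp : image (A := S) i (B `&` B') (chart S i p) by exists p.
  have df := smooth_differentiable (sf i) Wp.
  apply: (tcoord_inj mS ip); rewrite (tcoordD (A := S)) !(tcoordZ (A := S)).
  rewrite (conn_coords v oOO _ ip sY) //.
  rewrite (conn_coords v oOO _ ip (smooth_vfZ oOO sf sY)) //.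
  have fE : (f \o inv S i) (chart S i p) = f p.
    exact: (congr1 f (slit_chartK mM (proj1 ip))).
  rewrite (dirder_chart mS v ip df) -fE -(coordsE mS Y ip).
  rewrite -(covD_scale o (@sL i _) (@gU i _) _ Wp (sf i) (sY i)).
  apply: near_eq_covD; apply: (open_near o Wp) => _ [q [_ iq] <-].
  apply: (etrans (coordsE mS _ iq)); rewrite (tcoordZ (A := S)).
  exact: (esym (congr2 *:%R (congr1 f (slit_chartK mM (proj1 iq))) (coordsE mS Y iq))).
- move=> O X Y oO sX sY i; rewrite -/(image (A := S) i O).
  have o := @oI i O oO.
  have H := smooth_covD o (@sL i O) (@gU i O) (sX i) (sY i).
  refine (eq_smooth o _ H) => _ [u [Ou iu] <-].
  have E : inv S i (chart S i u) = u by exact: (slit_chartK mM (proj1 iu)).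
  by rewrite E (conn_coords _ oO Ou iu sY).
Qed.

(** On each of the two summands this is [cov_mform], which rests on the compatibility
    of the symbols with [Lg]. *)
Lemma canon_compatible : metric_compatible (A := S) (canon_conn L) (canon_metric L).
Proof.
move=> O X Y Z p oO Op sX sY sZ; have [Os _] := oO.
have ip := slit_chart_at mM (Os p Op); set i := chart_at S p in ip *.
have o := @oI i _ oO; have s := @sL i O; have g := @gU i O.
have Wp : image (A := S) i O (chart S i p) by exists p.
have sl := smooth_mform o s (smooth_lsubmx o (sY i)) (smooth_lsubmx o (sZ i)).
have sv := smooth_mform o s (smooth_vpart o s g (sY i)) (smooth_vpart o s g (sZ i)).
set F := fun q => canon_metric L q (Y q) (Z q).
have FE : \forall z \near chart S i p,
    mform (loc L i) z (lsubmx (coords (A := S) i Y z)) (lsubmx (coords (A := S) i Z z)) +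
    mform (loc L i) z (vpart (loc L i) z (coords (A := S) i Y z))
      (vpart (loc L i) z (coords (A := S) i Z z)) = (F \o inv S i) z.
  apply: (open_near o Wp) => _ [q [Oq iq] <-].
  rewrite -(metric_coords Y Z iq).
  exact: (esym (congr1 F (slit_chartK mM (proj1 iq)))).
have dF := near_eq_differentiable FE (smooth_differentiable (smoothD o sl sv) Wp).
have dsl := smooth_is_derive (tcoord (A := S) p i (X p)) sl Wp.
have dsv := smooth_is_derive (tcoord (A := S) p i (X p)) sv Wp.
have DF := near_eq_derive (tcoord (A := S) p i (X p)) FE.
have DS := is_derive_val (is_deriveD dsl dsv).
have E1 := cov_mform o s g (tcoord (A := S) p i (X p)) Wp
  (differentiable_lpart o Wp (sY i)) (differentiable_lpart o Wp (sZ i)).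
have E2 := cov_mform o s g (tcoord (A := S) p i (X p)) Wp
  (differentiable_vpart o s g Wp (sY i)) (differentiable_vpart o s g Wp (sZ i)).
have DE := etrans (dirder_chart mS (X p) ip dF) (etrans (esym DF) DS).
have G1 : canon_metric L p (canon_conn L p (X p) Y) (Z p) =
    mform (loc L i) (chart S i p) (cov (loc L i) (chart S i p) (tcoord (A := S) p i (X p))
      (fun x => lsubmx (coords (A := S) i Y x))) (lsubmx (coords (A := S) i Z (chart S i p))) +
    mform (loc L i) (chart S i p) (cov (loc L i) (chart S i p) (tcoord (A := S) p i (X p))
      (fun x => vpart (loc L i) x (coords (A := S) i Y x)))
      (vpart (loc L i) (chart S i p) (coords (A := S) i Z (chart S i p))).
  apply: (etrans (canon_metricE mM regL _ _ ip)).
  rewrite /chart_metric (conn_coords (X p) oO Op ip sY) -(coordsE mS Z ip).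
  by rewrite lsubmx_assemble vpart_assemble.
have G2 : canon_metric L p (Y p) (canon_conn L p (X p) Z) =
    mform (loc L i) (chart S i p) (lsubmx (coords (A := S) i Y (chart S i p)))
      (cov (loc L i) (chart S i p) (tcoord (A := S) p i (X p))
      (fun x => lsubmx (coords (A := S) i Z x))) +
    mform (loc L i) (chart S i p) (vpart (loc L i) (chart S i p) (coords (A := S) i Y (chart S i p)))
      (cov (loc L i) (chart S i p) (tcoord (A := S) p i (X p))
      (fun x => vpart (loc L i) x (coords (A := S) i Z x))).
  apply: (etrans (canon_metricE mM regL _ _ ip)).
  rewrite /chart_metric (conn_coords (X p) oO Op ip sZ) -(coordsE mS Y ip).
  by rewrite lsubmx_assemble vpart_assemble.
apply: (etrans (congr2 (fun a b => a - b) (congr2 (fun a b => a - b) DE G1) G2)).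
apply: (etrans (congr1 (fun a => a - _ - _) (congr2 +%R E1 E2))).
by move: (mform _ _ _ _) (mform _ _ _ _) (mform _ _ _ _) (mform _ _ _ _) => a b c d; ring.
Qed.

End MetricConnection.

(** * Parallel transport preserves the splitting *)

Section ConstantField.
Context {R : realType} {n : nat}.
Variables (O : set 'rV[R]_(n + n)) (l : 'rV[R]_(n + n) -> R).
Hypotheses (oO : open O) (sl : smooth_on O l).
Hypothesis gU : forall z, O z -> Lg l z \in unitmx.
Implicit Types (z w e : 'rV[R]_(n + n)).

Lemma covD_cst z w e : O z -> covD l z w (fun=> e) =
  assemble l z (lsubmx e *m conn_form l z w)
    (lsubmx e *m 'D_w (Nmx l) z + vpart l z e *m conn_form l z w).
Proof.
move=> Oz; rewrite /covD cov_cst /cov; congr (assemble _ _ _ (_ + _)).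
have dN := smooth_is_derive w (smooth_Nmx oO sl gU) Oz.
have dl := is_derive_mulmx (is_derive_cst (lsubmx e) z w) dN.
have := is_derive_val (is_deriveD (is_derive_cst (rsubmx e) z w) dl).
by rewrite mul0mx !add0r.
Qed.

Lemma covD_cst_sum z w e : O z ->
  \sum_b e 0 b *: covD l z w (fun=> delta_mx 0 b) = covD l z w (fun=> e).
Proof.
move=> Oz; pose F e := covD l z w (fun=> e).
have Flin a u v : F (a *: u + v) = a *: F u + F v.
  have lP : lsubmx (a *: u + v) = a *: lsubmx u + lsubmx v by rewrite linearP.
  rewrite /F !covD_cst // -assemble_linear vpart_linear lP.
  move: (lsubmx u) (lsubmx v) (vpart l z u) (vpart l z v) => u1 v1 u2 v2.
  move: (conn_form l z w) ('D_w (Nmx l) z) => W DN.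
  by congr assemble; rewrite !mulmxDl -!scalemxAl // scalerDr addrACA.
have F0 : F 0 = 0.
  have := Flin 1 0 0; rewrite scaler0 addr0 scale1r => E.
  by apply: (addrI (F 0)); rewrite addr0 -E.
rewrite -/(F e) {2}[e]row_sum_delta.
elim/big_rec2: _ => [|b x y _ ->]; first by rewrite F0.
by rewrite Flin.
Qed.

Section AlongCurve.
Variables (zt xi : R -> 'rV[R]_(n + n)) (t : R) (w : 'rV[R]_(n + n)).
Hypothesis Oz : O (zt t).
Hypothesis dz : is_derive t 1 zt w.
Hypothesis dxi : is_derive t 1 xi
  (- \sum_b xi t 0 b *: covD l (zt t) w (fun=> delta_mx 0 b)).

Let dxiE : is_derive t 1 xi (- covD l (zt t) w (fun=> xi t)).
Proof. by rewrite -covD_cst_sum. Qed.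

Lemma parallel_lpart :
  is_derive t 1 (fun s => lsubmx (xi s)) (lsubmx (xi t) *m - conn_form l (zt t) w).
Proof.
apply: (is_derive_eq (is_derive_lsubmx dxiE)).
by rewrite linearN /= covD_cst // lsubmx_assemble mulmxN.
Qed.

(** The derivative of [Nmx] along the curve cancels the one in [covD_cst], so the
    vertical part obeys the same equation as the base part. *)
Lemma parallel_vpart :
  is_derive t 1 (fun s => vpart l (zt s) (xi s))
    (vpart l (zt t) (xi t) *m - conn_form l (zt t) w).
Proof.
have dN := smooth_differentiable (smooth_Nmx oO sl gU) Oz.
have dzt : differentiable zt t by apply/derivable1_diffP; case: dz.
have dNz := is_derive_compose (1 : R) dzt dN.
have E : 'd (Nmx l) (zt t) ('d zt t 1) = 'D_w (Nmx l) (zt t).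
  by rewrite (deriveE _ dN) -(deriveE _ dzt) (is_derive_val dz).
rewrite E in dNz.
have D := is_deriveD (is_derive_rsubmx dxiE)
  (is_derive_mulmx (is_derive_lsubmx dxiE) dNz).
apply: (is_derive_eq D); rewrite covD_cst //.
set W := conn_form l (zt t) w; set DN := 'D_w _ _.
set h := lsubmx (xi t); set v := vpart l (zt t) (xi t).
rewrite /assemble opp_row_mx row_mxKl row_mxKr /= mulmxN !mulNmx /comp /=.
by rewrite opprB addrC addrACA addNr add0r opprD addrA subrr add0r.
Qed.

End AlongCurve.
End ConstantField.

Section Transport.
Context {R : realType} {n : nat} (M : atlas R n).
Hypothesis mM : smooth_manifold M.
Variable L : pt (TM M) -> R.
Hypothesis regL : regular_lagrangian L.
Implicit Types (i j : idx M) (z w : 'rV[R]_(n + n)).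

Local Notation S := (slitTM M).
Let mS : smooth_manifold S := slit_manifold mM.

Let oD i := mopen_dom mS i.
Let oW i : open (image (A := S) i (dom S i)) := open_slit_image (oD i).
Let sL i := @smooth_loc R n M mM L regL i (dom S i).
Let gU i := @Lg_loc_unit R n M L regL i (dom S i).

Lemma coords_coord_field i b u : dom S i u ->
  coords (A := S) i (coord_field (A := S) i b) (chart S i u) = delta_mx 0 b.
Proof. by move=> iu; rewrite (coordsE mS _ iu) /coord_field (tvecK mS _ iu). Qed.

Lemma smooth_coord_field i b : smooth_vf (A := S) (dom S i) (coord_field (A := S) i b).
Proof.
apply: (@smooth_vf_chart _ _ _ mS i _ _ (oD i)) => //.
refine (eq_smooth (@oW i) _ (smooth_cst _ (delta_mx 0 b))).
by move=> _ [u [_ iu] <-]; rewrite coords_coord_field.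
Qed.

Lemma conn_coord_field i b u v : dom S i u ->
  tcoord (A := S) u i (canon_conn L u v (coord_field (A := S) i b)) =
  covD (loc L i) (chart S i u) (tcoord (A := S) u i v) (fun=> delta_mx 0 b).
Proof.
move=> iu.
apply: (etrans (congr1 _ (canon_connE mM regL v (oD i) iu iu (@smooth_coord_field i b)))).
apply: (etrans (tvecK mS _ iu)); apply: near_eq_covD.
apply: (open_near (@oW i)); first by exists u.
by move=> _ [q [_ iq] <-]; rewrite coords_coord_field.
Qed.

Section Curve.
Variables (J : set R) (c : R -> pt S) (X : R -> 'rV[R]_(n + n)).
Hypothesis sc : smooth_curve (A := S) J c.
Hypothesis parX : parallel (A := S) (canon_conn L) J c X.

Let zt i := chart S i \o c.
Let xi i s := tcoord (A := S) (c s) i (X s).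

Let W_zt i t : dom S i (c t) -> image (A := S) i (dom S i) (zt i t).
Proof. by exists (c t). Qed.

Let dzt i t : J t -> dom S i (c t) ->
  is_derive t 1 (zt i) (tcoord (A := S) (c t) i (velocity c t)).
Proof.
move=> Jt it; have [dz ->] := velocity_chart mS sc Jt it.
by apply: DeriveDef.
Qed.

Let dxi i t : J t -> dom S i (c t) -> is_derive t 1 (xi i)
  (- \sum_b xi i t 0 b *: covD (loc L i) (zt i t)
     (tcoord (A := S) (c t) i (velocity c t)) (fun=> delta_mx 0 b)).
Proof.
move=> Jt it; have [dX E] := parX Jt it; apply: DeriveDef => //.
apply/eqP; rewrite -addr_eq0; apply/eqP; rewrite -[RHS]E; congr (_ + _).
by apply: eq_bigr => b _; rewrite conn_coord_field.
Qed.

Definition transport_matrix i t : 'M[R]_n :=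
  - conn_form (loc L i) (zt i t) (tcoord (A := S) (c t) i (velocity c t)).

Lemma transport_lpart i t : J t -> dom S i (c t) ->
  is_derive t 1 (fun s => lsubmx (xi i s)) (lsubmx (xi i t) *m transport_matrix i t).
Proof.
move=> Jt it.
exact: (parallel_lpart (@oW i) (@sL i) (@gU i) (W_zt it) (dxi Jt it)).
Qed.

Lemma transport_vpart i t : J t -> dom S i (c t) ->
  is_derive t 1 (fun s => vpart (loc L i) (zt i s) (xi i s))
    (vpart (loc L i) (zt i t) (xi i t) *m transport_matrix i t).
Proof.
move=> Jt it.
exact: (parallel_vpart (@oW i) (@sL i) (@gU i) (W_zt it) (dzt Jt it) (dxi Jt it)).
Qed.

Let conn_form_delta l z w : conn_form l z w =
  \sum_b w 0 b *: conn_form l z (delta_mx 0 b).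
Proof.
have F0 : conn_form l z 0 = 0.
  have := conn_form_linear l z 1 0 0; rewrite scaler0 addr0 scale1r => E.
  by apply: (addrI (conn_form l z 0)); rewrite addr0 -E.
rewrite {1}[w]row_sum_delta; elim/big_rec2: _ => [|b x y _ <-]; first exact: F0.
by rewrite conn_form_linear.
Qed.

Lemma transport_matrix_continuous i t : J t -> dom S i (c t) ->
  {for t, continuous (transport_matrix i)}.
Proof.
move=> Jt it; have [oK sK] := sc.2 i; set K := J `&` _ in oK sK.
have Kt : K t by [].
have sz' := smooth_derive (1 : R) sK.
have sG b : smooth_on K (fun s => conn_form (loc L i) (zt i s) (delta_mx 0 b)).
  have s := smooth_conn_form (@oW i) (@sL i) (@gU i)
    (smooth_cst (image (A := S) i (dom S i)) (delta_mx 0 b)).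
  refine (smooth_comp oK (@oW i) _ s sK).
  by move=> s' [_ is']; exact: W_zt.
have sA : smooth_on K (fun s =>
    \sum_b - ('D_1 (zt i) s) 0 b *: conn_form (loc L i) (zt i s) (delta_mx 0 b)).
  apply: smooth_sum => // b; apply/smooth_mxP => // a d.
  apply: (@eq_smooth _ _ _ _ (fun s => - ('D_1 (zt i) s) 0 b *
     conn_form (loc L i) (zt i s) (delta_mx 0 b) a d)) => // [s _|].
    by rewrite [RHS]mxE.
  apply: smoothM => //; first by apply: smoothN => //; move/(smooth_mxP _ oK): sz'; apply.
  by have /(smooth_mxP _ oK) := sG b; apply.
apply: smooth_continuous Kt; refine (eq_smooth oK _ sA) => s [Js is'].
rewrite /transport_matrix [in RHS]conn_form_delta -sumrN; apply: eq_bigr => b _.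
by rewrite (is_derive_val (dzt Js is')) scaleNr.
Qed.

(** Near each time the curve stays in one chart and the coefficients are bounded, so
    [linear_ode_zero] applies; [locally_invariant] extends this to all of [J]. *)
Lemma transport_zero (H : pt S -> set 'rV[R]_(n + n))
    (part : idx M -> 'rV[R]_(n + n) -> 'rV[R]_(n + n) -> 'rV[R]_n) (a b : R) :
  J = [set t : R | a < t < b] ->
  (forall i u v, dom S i u ->
     H u v <-> part i (chart S i u) (tcoord (A := S) u i v) = 0) ->
  (forall i t, J t -> dom S i (c t) ->
     is_derive t 1 (fun s => part i (zt i s) (xi i s))
       (part i (zt i t) (xi i t) *m transport_matrix i t)) ->
  forall s t, J s -> J t -> H (c s) (X s) -> H (c t) (X t).
Proof.
move=> JE HE dP s t Js Jt.
suff loc t0 : J t0 -> exists2 B : set R, nbhs t0 B &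
    forall s t, B s -> B t -> J s -> J t -> H (c s) (X s) -> H (c t) (X t).
  move: Js Jt loc; rewrite JE => Js Jt loc.
  exact: (@locally_invariant R a b (fun t => H (c t) (X t)) loc s t Js Jt).
move=> Jt0; pose i : idx M := chart_at S (c t0).
have it0 : dom S i (c t0) := slit_chart_at mM (sc.1 t0 Jt0).
have [oK _] := sc.2 i; set K := J `&` _ in oK; have Kt0 : K t0 by [].
pose C := `|transport_matrix i t0| + 1.
have nA : \forall s \near t0, `|transport_matrix i s| <= C.
  have /cvgrPdist_le /(_ 1 ltr01) := transport_matrix_continuous Jt0 it0.
  apply: filterS => s' ds; rewrite /C -lerBlDl.
  by apply: le_trans (lerB_dist _ _) _; rewrite distrC.
have nK : nbhs t0 K by exact: open_nbhs_nbhs.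
have : nbhs t0 [set s | K s /\ `|transport_matrix i s| <= C] by apply: filterI nK nA.
move=> /nbhs_ballP[e /= e0 eP].
have inB r : t0 - e < r < t0 + e -> K r /\ `|transport_matrix i r| <= C.
  move=> /andP[r1 r2]; apply: eP; rewrite /ball /= ltr_distlC r1 r2.
  by [].
exists (ball t0 e); first exact: nbhsx_ballx.
move=> s' t' Bs Bt _ _.
have toI r : ball t0 e r -> t0 - e < r < t0 + e by rewrite /ball /= ltr_distlC.
have [[_ is'] _] := inB _ (toI _ Bs); have [[_ it'] _] := inB _ (toI _ Bt).
move=> /(HE i _ _ is') s0; apply/(HE i _ _ it').
apply: (@linear_ode_zero R n C (t0 - e) (t0 + e)
  (fun s => part i (zt i s) (xi i s)) (transport_matrix i) _ _ s' t') => //.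
- by move=> r /inB[[Jr ir] _]; exact: dP.
- move=> r p q /inB[_ Ar]; apply: le_trans Ar.
  rewrite [leRHS]/Num.Def.normr/= mx_normrE; exact: (le_bigmax _ _ (p, q)).
- exact: toI.
- exact: toI.
Qed.

End Curve.

Lemma canon_transport_hor : transport_preserves (A := S) (canon_conn L) (canon_hor L).
Proof.
move=> a b c X J sc pX; apply: (transport_zero sc erefl (part := fun i z v => vpart (loc L i) z v)).
  by move=> i u v iu; exact: (canon_horE mM regL v iu).
by move=> i t Jt it; exact: (transport_vpart sc pX Jt it).
Qed.

Lemma canon_transport_vert : transport_preserves (A := S) (canon_conn L) (vertical (M := M)).
Proof.
move=> a b c X J sc pX; apply: (transport_zero sc erefl (part := fun i z v => lsubmx v)).
  by move=> i u v iu; exact: (verticalE mM v iu).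
by move=> i t Jt it; exact: (transport_lpart pX Jt it).
Qed.

End Transport.

(** * Canonical structures are unique and form a Riemann-Cartan manifold *)

Section CanonicalUnique.
Context {R : realType} {n : nat} (M : atlas R n).
Hypothesis mM : smooth_manifold M.
Variable L : pt (TM M) -> R.
Hypothesis regL : regular_lagrangian L.
Implicit Types (i : idx M) (z w : 'rV[R]_(n + n)).

Local Notation S := (slitTM M).
Implicit Types (u p : pt S) (O : set (pt S)) (X Y Z : vfield S).
Let mS : smooth_manifold S := slit_manifold mM.

Let oD i := mopen_dom mS i.
Let oW i : open (image (A := S) i (dom S i)) := open_slit_image (oD i).
Let sL i := @smooth_loc R n M mM L regL i (dom S i).
Let gU i := @Lg_loc_unit R n M L regL i (dom S i).

Let W_chart i u : dom S i u -> image (A := S) i (dom S i) (chart S i u).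
Proof. by exists u. Qed.

Lemma canon_conn_eh i u v (j : 'I_n) : dom S i u ->
  canon_conn L u v (eh L i j) = \sum_a
    conn_form (loc L i) (chart S i u) (tcoord (A := S) u i v) j a *: eh L i a u.
Proof.
move=> iu.
apply: (etrans (canon_connE mM regL v (oD i) iu iu (smooth_eh mM regL i j))).
apply: (tcoord_inj mS iu); apply: (etrans (tvecK mS _ iu)).
apply: (etrans _ (esym (tcoord_eh_comb mM L _ iu))).
have nh : \forall z \near chart S i u, coords (A := S) i (eh L i j) z = hframe (loc L i) j z.
  apply: (open_near (@oW i) (W_chart iu)) => _ [q [_ iq] <-].
  exact: coords_eh.
apply: (etrans (near_eq_covD _ _ nh)); rewrite /covD; congr assemble.
  apply: (etrans (eq_cov _ _ _ (_ : _ =1 (fun=> delta_mx 0 j)))).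
    by move=> z; rewrite hframeE row_mxKl.
  by rewrite cov_cst -rowE; apply/rowP => a; rewrite !mxE.
apply: (etrans (eq_cov _ _ _ (_ : _ =1 (fun=> 0)))).
  by move=> z; exact: vpart_hframe.
by rewrite cov_cst mul0mx.
Qed.

Lemma canon_conn_ev i u v (j : 'I_n) : dom S i u ->
  canon_conn L u v (ev i j) = \sum_a
    conn_form (loc L i) (chart S i u) (tcoord (A := S) u i v) j a *: ev i a u.
Proof.
move=> iu.
apply: (etrans (canon_connE mM regL v (oD i) iu iu (smooth_ev mM i j))).
apply: (tcoord_inj mS iu); apply: (etrans (tvecK mS _ iu)).
apply: (etrans _ (esym (tcoord_ev_comb mM L _ iu))).
have nh : \forall z \near chart S i u, coords (A := S) i (ev i j) z = vframe j.
  apply: (open_near (@oW i) (W_chart iu)) => _ [q [_ iq] <-].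
  exact: coords_ev.
apply: (etrans (near_eq_covD _ _ nh)); rewrite /covD; congr assemble.
  apply: (etrans (eq_cov _ _ _ (_ : _ =1 (fun=> 0)))).
    by move=> z; rewrite row_mxKl.
  by rewrite cov_cst mul0mx.
apply: (etrans (eq_cov _ _ _ (_ : _ =1 (fun=> delta_mx 0 j)))).
  by move=> z; exact: vpart_vframe.
by rewrite cov_cst -rowE; apply/rowP => a; rewrite !mxE.
Qed.

Let tcoord_eh i u k : dom S i u ->
  tcoord (A := S) u i (eh L i k u) = hframe (loc L i) k (chart S i u).
Proof. by move=> iu; exact: (tvecK mS _ iu). Qed.

Let tcoord_ev i u k : dom S i u -> tcoord (A := S) u i (ev i k u) = vframe k.
Proof. by move=> iu; exact: (tvecK mS _ iu). Qed.

Let mformE (l : 'rV[R]_(n + n) -> R) z (h k : 'rV[R]_n) :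
  mform l z h k = \sum_a \sum_b Lg l z a b * (h 0 a * k 0 b).
Proof.
rewrite /mform; move: (Lg l z) => G; rewrite mxE exchange_big /=.
apply: eq_bigr => b _; rewrite mxE mulr_suml; apply: eq_bigr => a _.
by rewrite mxE mulrAC mulrC mulrCA.
Qed.

Lemma canon_canonical : Defs.canonical L (canon_hor L) (canon_metric L) (canon_conn L).
Proof.
split.
- by move=> i u iu; exact: (canon_hor_span mM regL iu).
- move=> i u iu X Y l z x y; apply: (etrans (canon_metricE mM regL X Y iu)).
  have vE a w : vcoframe l a z w = vpart l z w 0 a.
    rewrite /vpart /vcoframe mxE [X in _ = X + _]mxE; congr (_ + _).
    rewrite [RHS]mxE; apply: eq_bigr => k _.
    by rewrite mulrC; congr (_ * _); rewrite mxE.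
  rewrite /chart_metric !mformE; congr (_ + _); apply: eq_bigr => a _;
    apply: eq_bigr => b _; congr (_ * _).
    by rewrite /hcoframe; congr (_ * _); rewrite mxE.
  exact: (esym (congr2 *%R (vE a x) (vE b y))).
- exact: (canon_conn_linear mM regL).
- move=> i u iu j k; apply: (etrans (canon_conn_eh _ _ iu)).
  apply: eq_bigr => a _; congr (_ *: _); rewrite (tcoord_eh _ iu) conn_form_hframe.
  exact: (esym (LhatE (@oW i) (@sL i) _ _ _ (W_chart iu))).
- move=> i u iu j k; apply: (etrans (canon_conn_ev _ _ iu)).
  apply: eq_bigr => a _; congr (_ *: _); rewrite (tcoord_eh _ iu) conn_form_hframe.
  exact: (esym (LhatE (@oW i) (@sL i) _ _ _ (W_chart iu))).
- move=> i u iu j k; apply: (etrans (canon_conn_eh _ _ iu)).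
  apply: eq_bigr => a _; congr (_ *: _); rewrite (tcoord_ev _ iu) conn_form_vframe.
  exact: (esym (ChatE (@oW i) (@sL i) _ _ _ (W_chart iu))).
- move=> i u iu j k; apply: (etrans (canon_conn_ev _ _ iu)).
  apply: eq_bigr => a _; congr (_ *: _); rewrite (tcoord_ev _ iu) conn_form_vframe.
  exact: (esym (ChatE (@oW i) (@sL i) _ _ _ (W_chart iu))).
Qed.

Section Determined.
Variable D : pt S -> 'rV[R]_(n + n) -> vfield S -> 'rV[R]_(n + n).
Hypothesis linD : linear_connection (A := S) D.

Lemma connection_zero p v : pts S p -> D p v (fun=> 0) = 0.
Proof.
move=> pp; pose i : idx M := chart_at S p; have ip : dom S i p := slit_chart_at mM pp.
have s0 : smooth_vf (A := S) (dom S i) (fun=> 0).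
  move=> j; apply: (eq_smooth _ _ (smooth_cst _ 0)); first exact: (open_slit_image (oD i)).
  by move=> x _; rewrite (tcoord0 (A := S)).
have near0 : smooth_vf_near (A := S) p (fun=> 0) by exists (dom S i).
have := conn_add linD v pp near0 near0.
have -> : (fun q : pt S => 0 + 0) = (fun=> 0 : 'rV[R]_(n + n)).
  by apply/funext => q; rewrite addr0.
by move=> E; apply: (addrI (D p v (fun=> 0))); rewrite addr0 -E.
Qed.

Lemma connection_combination (K : finType) O p v (f : K -> pt S -> R) (E : K -> vfield S) :
  mopen (A := S) O -> O p ->
  (forall k, smooth_fun (A := S) O (f k)) -> (forall k, smooth_vf (A := S) O (E k)) ->
  D p v (fun q => \sum_k f k q *: E k q) =
  \sum_k (dirder (A := S) p v (f k) *: E k p + f k p *: D p v (E k)).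
Proof.
move=> oO Op sf sE; have pp : pts S p by exact: oO.1.
elim: (index_enum K) => [|k s IH].
  have -> : (fun q : pt S => \sum_(k <- [::]) f k q *: E k q) = (fun=> 0).
    by apply/funext => q; rewrite big_nil.
  by rewrite big_nil connection_zero.
have -> : (fun q : pt S => \sum_(k <- k :: s) f k q *: E k q) =
    (fun q => f k q *: E k q + \sum_(k <- s) f k q *: E k q).
  by apply/funext => q; rewrite big_cons.
rewrite big_cons -IH (conn_add linD) //.
- congr (_ + _); apply: (conn_leibniz linD) => //; by exists O.
- by exists O; split => //; exact: smooth_vfZ.
- exists O; split => //; apply: smooth_vf_sum => // a; exact: smooth_vfZ.
Qed.

End Determined.

Let conn_dir_comb D (linD : linear_connection (A := S) D) (K : finType) p Y
  (a : K -> R) (e : K -> 'rV[R]_(n + n)) : pts S p -> smooth_vf_near (A := S) p Y ->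
  D p (\sum_k a k *: e k) Y = \sum_k a k *: D p (e k) Y.
Proof.
move=> pp sY.
have D0 : D p 0 Y = 0.
  have := conn_linear linD 1 0 0 pp sY; rewrite scaler0 addr0 scale1r => E.
  by apply: (addrI (D p 0 Y)); rewrite addr0 -E.
elim/big_rec2: _ => [|k x y _ <-] //.
by rewrite (conn_linear linD).
Qed.

(** Near [u], a smooth field is a combination of the adapted frame with smooth
    coefficients, to which the Leibniz rule applies. *)
Lemma conn_determined D D' i :
  linear_connection (A := S) D -> linear_connection (A := S) D' ->
  (forall u, dom S i u -> forall j k,
    [/\ D u (eh L i k u) (eh L i j) = D' u (eh L i k u) (eh L i j),
        D u (eh L i k u) (ev i j) = D' u (eh L i k u) (ev i j),
        D u (ev i k u) (eh L i j) = D' u (ev i k u) (eh L i j) &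
        D u (ev i k u) (ev i j) = D' u (ev i k u) (ev i j)]) ->
  forall u v Y, dom S i u -> smooth_vf_near (A := S) u Y -> D u v Y = D' u v Y.
Proof.
move=> lD lD' DD' u v Y iu [B [oB Bu sY]].
have pu : pts S u := dom_sub_pts mS iu.
pose O := B `&` dom S i; have oO : mopen (A := S) O := mopenI mS oB (oD i).
have Ou : O u by [].
pose h k (q : pt S) := lsubmx (tcoord (A := S) q i (Y q)) 0 k.
pose w k (q : pt S) := vpart (loc L i) (chart S i q) (tcoord (A := S) q i (Y q)) 0 k.
have oI : open (image (A := S) i O) := open_slit_image oO.
have sYi : smooth_on (image (A := S) i O) (coords (A := S) i Y).
  by apply: sub_smooth (sY i) => _ [q [[Bq _] iq] <-]; exists q.
have Oi : O `<=` dom S i by move=> q [].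
have sh k : smooth_fun (A := S) O (h k).
  apply: (smooth_fun_chart mS oO Oi).
  by have /(smooth_mxP _ oI) := smooth_lsubmx oI sYi; apply.
have sw k : smooth_fun (A := S) O (w k).
  apply: (smooth_fun_chart mS oO Oi).
  have /(smooth_mxP _ oI) /(_ 0 k) H := smooth_vpart oI (@smooth_loc R n M mM L regL i O)
    (@Lg_loc_unit R n M L regL i O) sYi.
  refine (eq_smooth oI _ H) => _ [q [_ iq] <-].
  have E : inv S i (chart S i q) = q := slit_chartK mM (proj1 iq).
  by rewrite (coordsE mS _ iq); exact: (esym (congr1 (w k) E)).
have seh k : smooth_vf (A := S) O (eh L i k).
  by apply: (sub_smooth_vf Oi); exact: (smooth_eh mM regL).
have sev k : smooth_vf (A := S) O (ev i k).
  by apply: (sub_smooth_vf Oi); exact: (smooth_ev mM).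
have sYO : smooth_vf (A := S) O Y by apply: (sub_smooth_vf _ sY) => q [].
pose Yh : vfield S := fun q => \sum_k h k q *: eh L i k q.
pose Yv : vfield S := fun q => \sum_k w k q *: ev i k q.
have sYh : smooth_vf_near (A := S) u Yh.
  exists O; split => //; apply: smooth_vf_sum => // k; exact: smooth_vfZ.
have sYv : smooth_vf_near (A := S) u Yv.
  exists O; split => //; apply: smooth_vf_sum => // k; exact: smooth_vfZ.
have YE q : O q -> Y q = Yh q + Yv q by move=> [_ iq]; exact: (frame_expansion mM L _ iq).
have dir F : smooth_vf_near (A := S) u F ->
    (forall k, D u (eh L i k u) F = D' u (eh L i k u) F) ->
    (forall k, D u (ev i k u) F = D' u (ev i k u) F) -> D u v F = D' u v F.
  move=> sF Fh Fv.
  have split_dir C (lC : linear_connection (A := S) C) (a b : 'I_n -> R) :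
      C u (\sum_k a k *: eh L i k u + \sum_k b k *: ev i k u) F =
      \sum_k a k *: C u (eh L i k u) F + \sum_k b k *: C u (ev i k u) F.
    have := conn_linear lC 1 (\sum_k a k *: eh L i k u) (\sum_k b k *: ev i k u) pu sF.
    by rewrite !scale1r !(conn_dir_comb lC).
  suff Dab (a b : 'I_n -> R) :
      D u (\sum_k a k *: eh L i k u + \sum_k b k *: ev i k u) F =
      D' u (\sum_k a k *: eh L i k u + \sum_k b k *: ev i k u) F.
    by rewrite (frame_expansion mM L v iu); exact: Dab.
  apply: (etrans (split_dir D lD a b)); apply: (etrans _ (esym (split_dir D' lD' a b))).
  by congr (_ + _); apply: eq_bigr => k _; rewrite ?Fh ?Fv.
have ehE k : D u v (eh L i k) = D' u v (eh L i k).
  apply: dir; first by exists O.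
    by move=> j; have [] := DD' u iu k j.
  by move=> j; have [] := DD' u iu k j.
have evE k : D u v (ev i k) = D' u v (ev i k).
  apply: dir; first by exists O.
    by move=> j; have [] := DD' u iu k j.
  by move=> j; have [] := DD' u iu k j.
rewrite (conn_local lD v oO Ou sYO YE) (conn_local lD' v oO Ou sYO YE).
rewrite (conn_add lD) // (conn_add lD') //; congr (_ + _).
  rewrite (connection_combination lD v oO Ou sh seh) (connection_combination lD' v oO Ou sh seh).
  by apply: eq_bigr => k _; rewrite ehE.
rewrite (connection_combination lD v oO Ou sw sev) (connection_combination lD' v oO Ou sw sev).
by apply: eq_bigr => k _; rewrite evE.
Qed.

Lemma canonical_unique hor g D hor' g' D' :
  Defs.canonical L hor g D -> Defs.canonical L hor' g' D' ->
  forall u, pts S u ->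
  [/\ hor' u = hor u, forall v w, g' u v w = g u v w &
      forall v Y, smooth_vf_near (A := S) u Y -> D' u v Y = D u v Y].
Proof.
move=> c c' u pu; pose i : idx M := chart_at S u.
have iu : dom S i u := slit_chart_at mM pu.
split.
- by rewrite (canonical_hor c iu) (canonical_hor c' iu).
- by move=> v w; exact: (etrans (canonical_metric c' iu v w) (esym (canonical_metric c iu v w))).
- move=> v Y sY.
  apply: (conn_determined (canonical_linear c') (canonical_linear c) _ v iu sY).
  move=> q iq j k; split.
  + exact: (etrans (canonical_hh c' iq j k) (esym (canonical_hh c iq j k))).
  + exact: (etrans (canonical_hv c' iq j k) (esym (canonical_hv c iq j k))).
  + exact: (etrans (canonical_vh c' iq j k) (esym (canonical_vh c iq j k))).
  + exact: (etrans (canonical_vv c' iq j k) (esym (canonical_vv c iq j k))).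
Qed.

Lemma canonical_structures_Riemann_Cartan : canonical_Riemann_Cartan L.
Proof.
exists (canon_hor L), (canon_metric L), (canon_conn L); split.
- exact: canon_canonical.
- by move=> hor' g' D' c'; exact: (canonical_unique canon_canonical c').
- split; first exact: mS.
  + exact: (canon_N_connection mM regL).
  + exact: (canon_d_metric mM regL).
  + split; [exact: (canon_conn_linear mM regL)|exact: (canon_transport_hor mM regL)|].
    exact: (canon_transport_vert mM regL).
  + exact: (canon_compatible mM regL).
Qed.

End CanonicalUnique.

Theorem mainTheorem2 (R : realType) (n : nat) (M : atlas R n)
    (manM : smooth_manifold M) :
  (forall L : pt (TM M) -> R,
     regular_lagrangian L -> canonical_Riemann_Cartan L) /\
  (forall F : pt (TM M) -> R,
     fundamental_finsler F ->
     canonical_Riemann_Cartan (fun u : pt (TM M) => F u ^+ 2)).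
Proof.
split=> [L regL|F finF]; first exact: canonical_structures_Riemann_Cartan.
exact: (canonical_structures_Riemann_Cartan manM (finsler_regular finF)).
Qed.
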